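(* Let $A$ be a locally $C^*$-algebra and let $E$ be a Hilbert $A$-module. Then: (1) $\{M(E_p);(\pi_{pq}^{A,E})_*\}_{p,q\in S(A),\,p\ge q}$ is an inverse system of Hilbert $C^*$-modules (over the inverse system of $C^*$-algebras $\{M(A_p);\pi''_{pq}\}_{p,q\in S(A),\,p\ge q}$). (2) The Hilbert $M(A)$-modules $M(E)$ and $\varprojlim_p M(E_p)$ are unitarily equivalent. (3) The isomorphism of (2), namely $t\mapsto ((\pi_p^{A,E})_*(t))_p$, identifies the strict topology on $M(E)$ with the topology on $\varprojlim_p M(E_p)$ obtained by taking the inverse limit of the strict topologies on the $M(E_p)$. (4) $M(E)$ is complete with respect to the strict topology. (5) The map $i_E:E\to M(E)$ defined by $i_E(\xi)(a)=\xi a$, $a\in A$, embeds $E$ as a closed submodule of $M(E)$. Moreover, if $t\in M(E)$, then $t\cdot a=i_E(t(a))$ for all $a\in A$, and $\langle t,i_E(\xi)\rangle_{M(A)}=t^*(\xi)$ for all $\xi\in E$. (6) The image of $i_E$ is dense in $M(E)$ with respect to the strict topology.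
   Context: A locally $C^*$-algebra is a complete Hausdorff complex topological $*$-algebra $A$ whose topology is determined by its continuous $C^*$-seminorms; $S(A)$ is the set of all continuous $C^*$-seminorms on $A$, directed by $p\ge q$ iff $p(a)\ge q(a)$ for all $a\in A$. For $p\in S(A)$, $A_p=A/\ker p$ is a $C^*$-algebra with the norm induced by $p$; $\pi_p:A\to A_p$ is the quotient map, and for $p\ge q$, $\pi_{pq}:A_p\to A_q$ is the canonical surjective morphism with $\pi_{pq}\circ\pi_p=\pi_q$, which extends to a morphism of $C^*$-algebras $\pi''_{pq}:M(A_p)\to M(A_q)$ of multiplier algebras. One identifies $A$ with $\varprojlim_p A_p$ and $M(A)$ with $\varprojlim_p M(A_p)$. A pre-Hilbert $A$-module is a complex vector space $E$ which is a right $A$-module (compatibly with the complex algebra structure), with an $A$-valued inner product $\langle\cdot,\cdot\rangle:E\times E\to A$ which is $\mathbb C$- and $A$-linear in the second variable, with $\langle\xi,\eta\rangle^*=\langle\eta,\xi\rangle$, $\langle\xi,\xi\rangle\ge 0$, and $\langle\xi,\xi\rangle=0$ iff $\xi=0$. It is a Hilbert $A$-module if it is complete for the topology given by the seminorms $\overline p_E(\xi)=\sqrt{p(\langle\xi,\xi\rangle)}$, $p\in S(A)$. $A$ is a Hilbert $A$-module with $\langle a,b\rangle=a^*b$. For $p\in S(A)$, $E_p=E/\ker\overline p_E$ is a Hilbert $A_p$-module with $(\xi+\ker\overline p_E)\pi_p(a)=\xi a+\ker\overline p_E$ and $\langle\xi+\ker\overline p_E,\eta+\ker\overline p_E\rangle=\pi_p(\langle\xi,\eta\rangle)$;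 $\sigma_p^E:E\to E_p$ is the quotient map, and for $p\ge q$, $\sigma_{pq}^E:E_p\to E_q$ is the canonical map with $\sigma_{pq}^E\circ\sigma_p^E=\sigma_q^E$. An inverse system of Hilbert $C^*$-modules over an inverse system of $C^*$-algebras $\{B_p;\rho_{pq}\}$ is a family of Hilbert $B_p$-modules $X_p$ with linear maps $\sigma_{pq}:X_p\to X_q$ ($p\ge q$) such that $\sigma_{pq}(xb)=\sigma_{pq}(x)\rho_{pq}(b)$, $\langle\sigma_{pq}(x),\sigma_{pq}(y)\rangle=\rho_{pq}(\langle x,y\rangle)$, $\sigma_{pp}=\mathrm{id}$ and $\sigma_{qr}\circ\sigma_{pq}=\sigma_{pr}$ for $p\ge q\ge r$; then $\varprojlim_p X_p$ is a Hilbert $\varprojlim_p B_p$-module. An $A$-module morphism $T:E\to F$ between Hilbert $A$-modules is adjointable if there is an $A$-module morphism $T^*:F\to E$ with $\langle T\xi,\eta\rangle=\langle\xi,T^*\eta\rangle$ for all $\xi\in E,\eta\in F$. $L_A(E,F)$ is the set of all such morphisms, with the topology given by the seminorms $\widetilde p_{L_A(E,F)}(T)=\|(\pi_p^{E,F})_*(T)\|_{L_{A_p}(E_p,F_p)}$, $p\in S(A)$, where $(\pi_p^{E,F})_*(T)(\sigma_p^E(\xi))=\sigma_p^F(T\xi)$; $L_A(E)=L_A(E,E)$. For $p\ge q$, $(\pi_{pq}^{E,F})_*:L_{A_p}(E_p,F_p)\to L_{A_q}(E_q,F_q)$ is given by $(\pi_{pq}^{E,F})_*(T_p)(\sigma_q^E(\xi))=\sigma_{pq}^F(T_p(\sigma_p^E(\xi)))$.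 Hilbert $A$-modules $E,F$ are unitarily equivalent if there is $U\in L_A(E,F)$ with $U^*U=\mathrm{id}_E$ and $UU^*=\mathrm{id}_F$. The multiplier algebra $M(A)$ is identified with the locally $C^*$-algebra $L_A(A)$; $A$ sits in $M(A)$ by left multiplication, i.e. $a\in A$ is identified with the operator $c\mapsto ac$. The multiplier module of $E$ is $M(E)=L_A(A,E)$, a Hilbert $M(A)$-module with action $t\cdot m=t\circ m$ and inner product $\langle s,t\rangle_{M(A)}=s^*\circ t$; its topology coincides with that given by the seminorms $\widetilde p_{L_A(A,E)}$, $p\in S(A)$. Likewise $M(E_p)=L_{A_p}(A_p,E_p)$ is a Hilbert $M(A_p)$-module. The strict topology on $M(E)$ is the one generated by the seminorms $\|t\|_{p,a,\xi}=\overline p_E(t(a))+p(t^*(\xi))$, $(p,a,\xi)\in S(A)\times A\times E$; the strict topology on $M(E_p)$ is generated by the seminorms $t\mapsto\|t(a)\|_{E_p}+\|t^*(\xi)\|_{A_p}$, $a\in A_p$, $\xi\in E_p$. *)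

(* Defs.v *)
From HB Require Import structures.
From mathcomp Require Import all_boot all_order all_algebra.
From mathcomp Require Import generic_quotient ring_quotient.
From mathcomp Require Import complex.
From mathcomp Require Import all_classical all_reals topology tvs.

Set Implicit Arguments.
Unset Strict Implicit.
Unset Printing Implicit Defensive.

Import Order.TTheory GRing.Theory Num.Theory.
Import numFieldTopology.Exports.

Local Open Scope classical_set_scope.
Local Open Scope ring_scope.
Local Open Scope quotient_scope.
Local Open Scope complex_scope.

Reserved Notation "a ** b" (at level 40, left associativity).
Reserved Notation "x <* b" (at level 40, left associativity).
Reserved Notation "<< x , y >>" (at level 0, format "<< x ,  y >>").

(* Complex *-algebras, not assumed unital, with a proper involution
   (a^* a = 0 only for a = 0): this is automatic once the C*-seminorms of the
   algebra separate its points, hence in every locally C*-algebra. *)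
HB.mixin Record isStarAlgebra (R : realType) A & GRing.Lmodule R[i] A := {
  smul : A -> A -> A;
  star : A -> A;
  smulA : associative smul;
  smulDl : left_distributive smul +%R;
  smulDr : right_distributive smul +%R;
  smulZl : forall (k : R[i]) (a b : A), smul (k *: a) b = k *: smul a b;
  smulZr : forall (k : R[i]) (a b : A), smul a (k *: b) = k *: smul a b;
  starK : involutive star;
  starD : {morph star : a b / a + b};
  starZ : forall (k : R[i]) (a : A), star (k *: a) = k^* *: star a;
  starM : forall a b : A, star (smul a b) = smul (star b) (star a);
  star_proper : forall a : A, smul (star a) a = 0 -> a = 0
}.

#[short(type="starAlgType")]
HB.structure Definition StarAlgebra (R : realType) :=
  {A of isStarAlgebra R A & GRing.Lmodule R[i] A}.

#[short(type="topStarAlgType")]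
HB.structure Definition TopStarAlgebra (R : realType) :=
  {A of StarAlgebra R A & TopologicalLmodule R[i] A}.

Notation "a ** b" := (smul a b) : ring_scope.

(* Right B-modules with a B-valued sesquilinear hermitian form; positivity,
   definiteness and completeness are stated in [hilbert_module]. *)
HB.mixin Record isIpModule (R : realType) (B : starAlgType R) X
    & GRing.Lmodule R[i] X := {
  act : X -> B -> X;
  ip : X -> X -> B;
  actDl : forall (x y : X) (b : B), act (x + y) b = act x b + act y b;
  actDr : forall (x : X) (b c : B), act x (b + c) = act x b + act x c;
  actM : forall (x : X) (b c : B), act x (b ** c) = act (act x b) c;
  actZl : forall (k : R[i]) (x : X) (b : B), act (k *: x) b = k *: act x b;
  actZr : forall (k : R[i]) (x : X) (b : B), act x (k *: b) = k *: act x b;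
  ipDr : forall x y z : X, ip x (y + z) = ip x y + ip x z;
  ipZr : forall (k : R[i]) (x y : X), ip x (k *: y) = k *: ip x y;
  ipMr : forall (x y : X) (b : B), ip x (act y b) = ip x y ** b;
  ipC : forall x y : X, star (ip x y) = ip y x
}.

#[short(type="ipModType")]
HB.structure Definition IpModule (R : realType) (B : starAlgType R) :=
  {X of isIpModule R B X & GRing.Lmodule R[i] X}.

Notation "x <* b" := (act x b) : ring_scope.
Notation "<< x , y >>" := (ip x y) : ring_scope.

Section StarAlgebraTheory.
Context {R : realType} {A : starAlgType R}.
Implicit Types a b c : A.

Lemma smul0l a : 0 ** a = 0.
Proof. by have := smulZl 0 (0 : A) a; rewrite !scale0r. Qed.

Lemma smul0r a : a ** 0 = 0.
Proof. by have := smulZr 0 a (0 : A); rewrite !scale0r. Qed.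

Lemma smulNl a b : - a ** b = - (a ** b).
Proof. by rewrite -scaleN1r smulZl scaleN1r. Qed.

Lemma smulNr a b : a ** - b = - (a ** b).
Proof. by rewrite -scaleN1r smulZr scaleN1r. Qed.

Lemma smulBl a b c : (a - b) ** c = a ** c - b ** c.
Proof. by rewrite smulDl smulNl. Qed.

Lemma smulBr a b c : a ** (b - c) = a ** b - a ** c.
Proof. by rewrite smulDr smulNr. Qed.

Lemma star0 : star 0 = 0 :> A.
Proof. by have := starZ 0 (0 : A); rewrite rmorph0 !scale0r. Qed.

Lemma starN a : star (- a) = - star a.
Proof. by rewrite -scaleN1r starZ rmorphN rmorph1 scaleN1r. Qed.

Lemma starB a b : star (a - b) = star a - star b.
Proof. by rewrite starD starN. Qed.

End StarAlgebraTheory.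

Section IpModuleTheory.
Context {R : realType} {B : starAlgType R} {X : ipModType B}.
Implicit Types (x y z : X) (b : B).

Lemma act0l b : (0 : X) <* b = 0.
Proof. by have := actZl 0 (0 : X) b; rewrite !scale0r. Qed.

Lemma actNl x b : - x <* b = - (x <* b).
Proof. by rewrite -scaleN1r actZl scaleN1r. Qed.

Lemma actNr x b : x <* - b = - (x <* b).
Proof. by rewrite -scaleN1r actZr scaleN1r. Qed.

Lemma ipDl x y z : << x + y, z >> = << x, z >> + << y, z >>.
Proof. by rewrite -ipC ipDr starD !ipC. Qed.

Lemma ipZl (k : R[i]) x y : << k *: x, y >> = k^* *: << x, y >>.
Proof. by rewrite -ipC ipZr starZ !ipC. Qed.

Lemma ipMl x y b : << x <* b, y >> = star b ** << x, y >>.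
Proof. by rewrite -ipC ipMr starM !ipC. Qed.

Lemma ip0l x : << 0, x >> = 0 :> B.
Proof. by have := ipZl 0 (0 : X) x; rewrite rmorph0 !scale0r. Qed.

Lemma ip0r x : << x, 0 >> = 0 :> B.
Proof. by rewrite -ipC ip0l star0. Qed.

Lemma ipNl x y : << - x, y >> = - << x, y >>.
Proof. by rewrite -scaleN1r ipZl rmorphN rmorph1 scaleN1r. Qed.

Lemma ipNr x y : << x, - y >> = - << x, y >>.
Proof. by rewrite -scaleN1r ipZr scaleN1r. Qed.

Lemma ipBl x y z : << x - y, z >> = << x, z >> - << y, z >>.
Proof. by rewrite ipDl ipNl. Qed.

Lemma ipBr x y z : << x, y - z >> = << x, y >> - << x, z >>.
Proof. by rewrite ipDr ipNr. Qed.

End IpModuleTheory.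

Definition nondegenerate {R : realType} {B : starAlgType R} (X : ipModType B) :=
  forall x : X, (forall y, << x, y >> = 0 :> B) -> x = 0.

(* B as a module over itself, with <a, b> = a^* b. *)
Definition regmod {R : realType} (B : starAlgType R) : Type := B.

Section RegularModule.
Context {R : realType} (B : starAlgType R).
HB.instance Definition _ := GRing.Lmodule.on (regmod B).

Let rip (a b : regmod B) : B := star (a : B) ** b.

Fact regmod_ipDr a b c : rip a (b + c) = rip a b + rip a c.
Proof. exact: smulDr. Qed.
Fact regmod_ipZr (k : R[i]) a b : rip a (k *: b) = k *: rip a b.
Proof. exact: smulZr. Qed.
Fact regmod_ipMr a b (c : B) : rip a (smul (b : B) c) = rip a b ** c.
Proof. exact: smulA. Qed.
Fact regmod_ipC a b : star (rip a b) = rip b a.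
Proof. by rewrite /rip starM starK. Qed.

HB.instance Definition _ := isIpModule.Build R B (regmod B)
  (fun a b c => smulDl a b c) (fun a b c => smulDr a b c)
  (fun a b c => smulA a b c) (fun k a b => smulZl k a b)
  (fun k a b => smulZr k a b)
  regmod_ipDr regmod_ipZr regmod_ipMr regmod_ipC.

Lemma regmod_nondegenerate : nondegenerate (regmod B).
Proof.
move=> a a0; apply/star_proper.
have := a0 (a : regmod B); done.
Qed.
End RegularModule.

Section Adjointable.
Context {R : realType} {B : starAlgType R}.

Definition module_morphism {X Y : ipModType B} (f : X -> Y) : Prop :=
  linear f /\ forall x (b : B), f (x <* b) = f x <* b.

Definition is_adjoint {X Y : ipModType B} (f : X -> Y) (g : Y -> X) : Prop :=
  forall x y, << f x, y >> = << x, g y >> :> B.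

Definition adjointable {X Y : ipModType B} (f : X -> Y) : Prop :=
  module_morphism f /\ exists g, module_morphism g /\ is_adjoint f g.

Definition adjointable_pred (X Y : ipModType B) : {pred X -> Y} :=
  fun f => `[< adjointable f >].

Fact adjointable_submod (X Y : ipModType B) :
  submod_closed (@adjointable_pred X Y).
Proof.
split=> [|k f g /asboolP[[fl fa] [f' [[f'l f'a] ff']]]
           /asboolP[[gl ga] [g' [[g'l g'a] gg']]]]; apply/asboolP.
  split; first by split=> [k x y|x b]; rewrite /= ?act0l ?scaler0 ?addr0.
  exists (fun=> 0); split; last by move=> x y; rewrite ip0l ip0r.
  by split=> [k x y|x b]; rewrite ?act0l ?scaler0 ?addr0.
split.
  split=> [l x y|x b].
    rewrite !fctE fl gl !scalerDr !scalerA mulrC -!addrA; congr (_ + _).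
    by rewrite addrCA.
  by rewrite !fctE fa ga actDl actZl.
exists (k^* *: f' + g'); split; last first.
  by move=> x y; rewrite !fctE ipDl ipZl ipDr ipZr ff' gg'.
split=> [l x y|x b].
  rewrite !fctE f'l g'l !scalerDr !scalerA mulrC -!addrA; congr (_ + _).
  by rewrite addrCA.
by rewrite !fctE f'a g'a actDl actZl.
Qed.

HB.instance Definition _ (X Y : ipModType B) :=
  GRing.isSubmodClosed.Build _ _ (@adjointable_pred X Y)
    (@adjointable_submod X Y).

(* L_B(X, Y) *)
Record adjop (X Y : ipModType B) :=
  AdjOp { adjfun :> X -> Y; adjopP : adjfun \in @adjointable_pred X Y }.

HB.instance Definition _ (X Y : ipModType B) :=
  [isSub for @adjfun X Y].
HB.instance Definition _ (X Y : ipModType B) :=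
  [Choice of adjop X Y by <:].
HB.instance Definition _ (X Y : ipModType B) :=
  [SubChoice_isSubLmodule of adjop X Y by <:].

End Adjointable.

Section AdjointableTheory.
Context {R : realType} {B : starAlgType R}.
Implicit Types X Y Z : ipModType B.

Lemma adjop_inj X Y : injective (@adjfun R B X Y).
Proof. exact: val_inj. Qed.

Lemma adjop_adjointable X Y (T : adjop X Y) : adjointable T.
Proof. exact/asboolP/adjopP. Qed.

Definition to_adjop X Y (f : X -> Y) (fP : adjointable f) : adjop X Y :=
  AdjOp (asboolT fP).

Lemma adjop_linear X Y (T : adjop X Y) : linear T.
Proof. by have [[]] := adjop_adjointable T. Qed.

Lemma adjopD X Y (T : adjop X Y) : {morph T : x y / x + y}.
Proof. by move=> x y; have := adjop_linear T 1 x y; rewrite !scale1r. Qed.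

Lemma adjop0 X Y (T : adjop X Y) : T 0 = 0.
Proof. by apply: (addrI (T 0)); rewrite -adjopD !addr0. Qed.

Lemma adjopZ X Y (T : adjop X Y) (k : R[i]) x : T (k *: x) = k *: T x.
Proof. by have := adjop_linear T k x 0; rewrite adjop0 !addr0. Qed.

Lemma adjopB X Y (T : adjop X Y) : {morph T : x y / x - y}.
Proof.
by move=> x y; rewrite adjopD -scaleN1r adjopZ scaleN1r.
Qed.

Lemma adjop_act X Y (T : adjop X Y) x (b : B) : T (x <* b) = T x <* b.
Proof. by have [[]] := adjop_adjointable T. Qed.

Lemma is_adjoint_sym X Y (f : X -> Y) (g : Y -> X) :
  is_adjoint f g -> is_adjoint g f.
Proof. by move=> fg y x; rewrite -[LHS]ipC -fg ipC. Qed.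

Lemma adj_exists X Y (T : adjop X Y) : exists S : adjop Y X, is_adjoint T S.
Proof.
have [TP [g [gP Tg]]] := adjop_adjointable T.
have gA : adjointable g.
  by split=> //; exists T; split=> //; exact: is_adjoint_sym.
by exists (to_adjop gA).
Qed.

(* T^*; it is the unique adjoint of T as soon as the domain of T is
   nondegenerate, see [adj_unique]. *)
Definition adj X Y (T : adjop X Y) : adjop Y X := projT1 (cid (adj_exists T)).

Lemma adjE X Y (T : adjop X Y) : is_adjoint T (adj T).
Proof. exact: projT2 (cid (adj_exists T)). Qed.

Lemma adjE' X Y (T : adjop X Y) : is_adjoint (adj T) T.
Proof. exact: is_adjoint_sym (adjE T). Qed.

Lemma adj_unique X Y (T : adjop X Y) (g : Y -> X) :
  nondegenerate X -> is_adjoint T g -> g = adj T.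
Proof.
move=> ndX Tg; apply/funext => y; apply/eqP; rewrite -subr_eq0; apply/eqP.
apply: ndX => x; rewrite -[LHS]ipC ipBr -Tg adjE subrr; exact: star0.
Qed.

Lemma comp_adjointable X Y Z (S : adjop Y Z) (T : adjop X Y) :
  adjointable (S \o T).
Proof.
split; first by split=> [k x y|x b] /=; rewrite ?adjop_linear // !adjop_act.
exists (adj T \o adj S); split; last by move=> x z /=; rewrite !adjE.
by split=> [k x y|x b] /=; rewrite ?adjop_linear // !adjop_act.
Qed.

Definition adjop_comp X Y Z (S : adjop Y Z) (T : adjop X Y) : adjop X Z :=
  to_adjop (comp_adjointable S T).

End AdjointableTheory.

Section MultiplierAlgebra.
Context {R : realType} (B : starAlgType R).

(* M(B) = L_B(B) *)
Definition mult : Type := adjop (regmod B) (regmod B).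
HB.instance Definition _ := GRing.Lmodule.on mult.

Implicit Types m n : mult.

Definition mult_mul m n : mult := adjop_comp m n.
Definition mult_star m : mult := adj m.

Let nd := @regmod_nondegenerate R B.

Fact mult_mulA : associative mult_mul.
Proof. by move=> m n q; apply: adjop_inj. Qed.
Fact mult_mulDl : left_distributive mult_mul +%R.
Proof. by move=> m n q; apply: adjop_inj. Qed.
Fact mult_mulDr : right_distributive mult_mul +%R.
Proof. by move=> m n q; apply: adjop_inj; apply/funext=> x /=; rewrite adjopD. Qed.
Fact mult_mulZl (k : R[i]) m n : mult_mul (k *: m) n = k *: mult_mul m n.
Proof. exact: adjop_inj. Qed.
Fact mult_mulZr (k : R[i]) m n : mult_mul m (k *: n) = k *: mult_mul m n.
Proof. by apply: adjop_inj; apply/funext=> x /=; rewrite adjopZ. Qed.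
Fact mult_starK : involutive mult_star.
Proof. by move=> m; apply/adjop_inj/esym/adj_unique => //; exact: adjE'. Qed.
Fact mult_starD : {morph mult_star : m n / m + n}.
Proof.
move=> m n; apply/adjop_inj/esym/adj_unique => // x y.
by rewrite /= ipDl !adjE -ipDr.
Qed.
Fact mult_starZ (k : R[i]) m : mult_star (k *: m) = k^* *: mult_star m.
Proof.
apply/adjop_inj/esym/adj_unique => // x y.
by rewrite /= ipZl adjE -ipZr.
Qed.
Fact mult_starM m n :
  mult_star (mult_mul m n) = mult_mul (mult_star n) (mult_star m).
Proof. by apply/adjop_inj/esym/adj_unique => // x y; rewrite /= !adjE. Qed.
Fact mult_proper m : mult_mul (mult_star m) m = 0 -> m = 0.
Proof.
move=> mm0; apply: adjop_inj; apply/funext => x; apply: star_proper.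
rewrite -[LHS]/(<< m x, m x >> : B) adjE.
by rewrite -[X in << _, X >>]/(mult_mul (mult_star m) m x) mm0 ip0r.
Qed.

HB.instance Definition _ := isStarAlgebra.Build R mult
  mult_mulA mult_mulDl mult_mulDr mult_mulZl mult_mulZr
  mult_starK mult_starD mult_starZ mult_starM mult_proper.

Lemma lmult_adjointable (b : B) :
  adjointable (fun c : regmod B => b ** c : regmod B).
Proof.
have mor (d : B) : module_morphism (fun c : regmod B => d ** c : regmod B).
  split=> [k x y|x c]; last exact: smulA.
  by rewrite -smulZr -smulDr.
split=> //; exists (fun c : regmod B => star b ** c : regmod B); split=> //.
by move=> x y; rewrite /ip /= starM smulA.
Qed.

(* The embedding of B into M(B) by left multiplication. *)
Definition lmult (b : B) : mult := to_adjop (lmult_adjointable b).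

End MultiplierAlgebra.

Section MultiplierModule.
Context {R : realType} {B : starAlgType R} (X : ipModType B).

(* M(X) = L_B(B, X) *)
Definition mmod : Type := adjop (regmod B) X.
HB.instance Definition _ := GRing.Lmodule.on mmod.

Implicit Types (s t u : mmod) (m n : mult B).

Definition mmod_act t m : mmod := adjop_comp t m.
Definition mmod_ip s t : mult B := adjop_comp (adj s) t.

Let nd := @regmod_nondegenerate R B.

Fact mmod_actDl s t m : mmod_act (s + t) m = mmod_act s m + mmod_act t m.
Proof. exact: adjop_inj. Qed.
Fact mmod_actDr t m n : mmod_act t (m + n) = mmod_act t m + mmod_act t n.
Proof. by apply: adjop_inj; apply/funext=> x /=; rewrite adjopD. Qed.
Fact mmod_actM t m n : mmod_act t (m ** n) = mmod_act (mmod_act t m) n.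
Proof. exact: adjop_inj. Qed.
Fact mmod_actZl (k : R[i]) t m : mmod_act (k *: t) m = k *: mmod_act t m.
Proof. exact: adjop_inj. Qed.
Fact mmod_actZr (k : R[i]) t m : mmod_act t (k *: m) = k *: mmod_act t m.
Proof. by apply: adjop_inj; apply/funext=> x /=; rewrite adjopZ. Qed.
Fact mmod_ipDr s t u : mmod_ip s (t + u) = mmod_ip s t + mmod_ip s u.
Proof. by apply: adjop_inj; apply/funext=> x /=; rewrite adjopD. Qed.
Fact mmod_ipZr (k : R[i]) s t : mmod_ip s (k *: t) = k *: mmod_ip s t.
Proof. by apply: adjop_inj; apply/funext=> x /=; rewrite adjopZ. Qed.
Fact mmod_ipMr s t m : mmod_ip s (mmod_act t m) = mmod_ip s t ** m.
Proof. exact: adjop_inj. Qed.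
Fact mmod_ipC s t : star (mmod_ip s t) = mmod_ip t s.
Proof.
by apply/adjop_inj/esym/adj_unique => // x y; rewrite /= adjE' adjE.
Qed.

HB.instance Definition _ := isIpModule.Build R (mult B) mmod
  mmod_actDl mmod_actDr mmod_actM mmod_actZl mmod_actZr
  mmod_ipDr mmod_ipZr mmod_ipMr mmod_ipC.

Lemma imod_adjointable (x : X) : adjointable (fun b : regmod B => x <* (b : B)).
Proof.
split; first by split=> [k b c|b c]; [rewrite actDr actZr|exact: actM].
exists (fun y => << x, y >> : regmod B); split.
  by split=> [k y z|y b]; [rewrite ipDr ipZr|exact: ipMr].
by move=> b y; exact: ipMl.
Qed.

(* The map i_X : X -> M(X) *)
Definition imod (x : X) : mmod := to_adjop (imod_adjointable x).

End MultiplierModule.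

Section SeminormTopology.
Context {R : realType} {V : lmodType R[i]} {I : Type}.

(* V with the topology generated by the family P of seminorms. *)
Definition snorm_top (P : I -> V -> R) : Type := V.

Variable P : I -> V -> R.

Definition snorm_open : set_system V := [set U | forall x, U x ->
  exists J : set I, finite_set J /\ exists2 e : R, 0 < e &
    forall y, (forall i, J i -> P i (y - x) < e) -> U y].

Fact snorm_openT : snorm_open setT.
Proof. by move=> x _; exists set0; split=> //; exists 1. Qed.

Fact snorm_openI : setI_closed snorm_open.
Proof.
move=> U W Uo Wo x [/Uo[J [Jf [d d0 dU]]] /Wo[K [Kf [e e0 eW]]]].
exists (J `|` K); split; first by rewrite finite_setU.
exists (Num.min d e); first by rewrite lt_min d0.
move=> y yxJK; split; [apply: dU|apply: eW] => i iJ.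
  by have := yxJK i (or_introl iJ); rewrite lt_min => /andP[].
by have := yxJK i (or_intror iJ); rewrite lt_min => /andP[].
Qed.

Fact snorm_open_bigU (J : Type) (f : J -> set V) :
  (forall j, snorm_open (f j)) -> snorm_open (\bigcup_j f j).
Proof.
move=> fo x [j _ /fo[K [Kf [e e0 eK]]]]; exists K; split=> //; exists e => //.
by move=> y yK; exists j => //; exact: eK.
Qed.

HB.instance Definition _ := GRing.Lmodule.on (snorm_top P).
HB.instance Definition _ := isOpenTopological.Build (snorm_top P)
  snorm_openT snorm_openI snorm_open_bigU.

End SeminormTopology.

(* Completeness for the translation-invariant uniform structure. *)
Definition tvs_complete {R : realType} (T : preTopologicalLmodType R[i]) :=
  forall F : set_system T, ProperFilter F ->
    (forall U, nbhs (0 : T) U -> \forall x & y \near F, U (x - y)) ->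
  exists x : T, F --> x.

Definition homeomorphism (S T : topologicalType) (f : S -> T) :=
  bijective f /\ forall U : set T, open (f @^-1` U) <-> open U.

Definition topological_embedding (S T : topologicalType) (f : S -> T) :=
  injective f /\
  forall U : set S, open U <-> exists2 V : set T, open V & f @^-1` V = U.

Arguments homeomorphism S T f : clear implicits.
Arguments topological_embedding S T f : clear implicits.

Section LocallyCstar.
Context {R : realType}.

Record Cstar_seminorm {A : starAlgType R} (p : A -> R) : Prop := {
  csnD : forall a b, p (a + b) <= p a + p b;
  csnZ : forall (k : R[i]) a, p (k *: a) = ComplexField.Normc.normc k * p a;
  csnM : forall a b, p (a ** b) <= p a * p b;
  csnX : forall a, p (star a ** a) = p a ^+ 2
}.

Record csemi (A : starAlgType R) :=
  CSemi { csemi_fun :> A -> R; csemiP : Cstar_seminorm csemi_fun }.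

(* The set S(A) of continuous C*-seminorms, and its order. *)
Record ccsemi (A : topStarAlgType R) :=
  CCSemi { ccsemi_csemi :> csemi A; ccsemi_continuous : continuous ccsemi_csemi }.

Definition csge {A : starAlgType R} (p q : csemi A) : Prop :=
  forall a, q a <= p a.

Record locally_Cstar (A : topStarAlgType R) : Prop := {
  lc_smul_continuous : continuous (fun x : A * A => x.1 ** x.2);
  lc_star_continuous : continuous (star : A -> A);
  lc_hausdorff : hausdorff_space A;
  lc_complete : tvs_complete A;
  lc_seminorms : forall U : set A,
    open U <-> open (U : set (snorm_top (fun p : ccsemi A => p : A -> R)))
}.

Record Cstar_algebra {B : starAlgType R} (nrm : B -> R) : Prop := {
  ca_seminorm : Cstar_seminorm nrm;
  ca_definite : forall b, nrm b = 0 -> b = 0;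
  ca_complete : tvs_complete (snorm_top (fun _ : unit => nrm))
}.

End LocallyCstar.

Section HilbertModule.
Context {R : realType} {B : starAlgType R}.

Definition is_positive (b : B) : Prop := exists c, b = star c ** c.

Definition hseminorm {X : ipModType B} (p : B -> R) (x : X) : R :=
  Num.sqrt (p << x, x >>).

(* X is a Hilbert module over B, where P is a family of C*-seminorms defining
   the topology of B; a C*-algebra is the case of a single norm. *)
Definition hilbert_module {I : Type} (P : I -> B -> R) (X : ipModType B) :=
  [/\ forall x : X, is_positive << x, x >>,
      forall x : X, << x, x >> = 0 :> B -> x = 0 &
      tvs_complete (snorm_top (fun i => @hseminorm X (P i)))].

(* The set is bounded when X and Y are Hilbert modules over a C*-algebra. *)
Definition opnorm {X Y : ipModType B} (nrm : B -> R) (T : adjop X Y) : R :=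
  sup [set hseminorm nrm (T x) | x in [set x | hseminorm nrm x <= 1]].

End HilbertModule.

Section LinearQuotient.
Context {K : nzRingType} {V : lmodType K} {S : {pred V}}.
Variable SP : submod_closed S.

Definition lquot_ker (_ : submod_closed S) : {pred V} := S.
HB.instance Definition _ := GRing.isSubmodClosed.Build K V (lquot_ker SP) SP.
Let N : zmodClosed V := lquot_ker SP.

Definition lquot : Type := Quotient.quot N.
HB.instance Definition _ := GRing.Zmodule.on lquot.

Definition lpi (x : V) : lquot := \pi x.
Definition lrepr (x : lquot) : V := repr (x : Quotient.quot N).

Lemma lreprK x : lpi (lrepr x) = x. Proof. exact: reprK. Qed.

Lemma lpi_eq x y : lpi x = lpi y <-> x - y \in S.
Proof.
by rewrite (Quotient.idealrBE N); split=> [xy|/eqP//]; apply/eqP.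
Qed.

Lemma lpiD x y : lpi (x + y) = lpi x + lpi y.
Proof. by rewrite /lpi !piE. Qed.

Lemma lrepr_lpi x : x - lrepr (lpi x) \in S.
Proof. by apply/lpi_eq; rewrite lreprK. Qed.

Definition lquot_scale (k : K) (x : lquot) : lquot := lpi (k *: lrepr x).

Lemma lpiZ k x : lpi (k *: x) = lquot_scale k (lpi x).
Proof. by apply/lpi_eq; rewrite -scalerBr; exact: (@rpredZ _ _ (lquot_ker SP)) (lrepr_lpi x). Qed.

Fact lquot_scaleA k l x :
  lquot_scale k (lquot_scale l x) = lquot_scale (k * l) x.
Proof. by rewrite -(lreprK x) -!lpiZ scalerA. Qed.
Fact lquot_scale1 : left_id 1 lquot_scale.
Proof. by move=> x; rewrite -(lreprK x) -lpiZ scale1r. Qed.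
Fact lquot_scaleDr : right_distributive lquot_scale +%R.
Proof.
by move=> k x y; rewrite -(lreprK x) -(lreprK y) -lpiD -!lpiZ -lpiD scalerDr.
Qed.
Fact lquot_scaleDl x : {morph lquot_scale^~ x : k l / k + l}.
Proof. by move=> k l; rewrite -(lreprK x) -!lpiZ -lpiD scalerDl. Qed.

HB.instance Definition _ := GRing.Zmodule_isLmodule.Build K lquot
  lquot_scaleA lquot_scale1 lquot_scaleDr lquot_scaleDl.

Lemma lpi_linear : linear lpi.
Proof. by move=> k x y; rewrite lpiD lpiZ. Qed.

End LinearQuotient.

Section CseminormTheory.
Context {R : realType} {B : starAlgType R} (p : csemi B).
Implicit Types a b c : B.

Lemma csemi0 : p 0 = 0.
Proof.
have := csnZ (csemiP p) 0 0.
by rewrite scale0r ComplexField.Normc.normc0 mul0r.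
Qed.

Lemma csemiN a : p (- a) = p a.
Proof.
have := csnZ (csemiP p) (-1) a.
by rewrite scaleN1r normcN ComplexField.Normc.normc1 mul1r.
Qed.

Lemma csemi_ge0 a : 0 <= p a.
Proof.
have := csnD (csemiP p) a (- a).
by rewrite subrr csemi0 csemiN -mulr2n pmulrn_lge0.
Qed.

Lemma csemi_star_le a : p a <= p (star a).
Proof.
have := csnM (csemiP p) (star a) a; rewrite (csnX (csemiP p)) expr2.
have [->|a0] := eqVneq (p a) 0; first by rewrite csemi_ge0.
by rewrite ler_pM2r // lt_neqAle eq_sym a0 csemi_ge0.
Qed.

Lemma csemi_star a : p (star a) = p a.
Proof.
apply/le_anti; rewrite csemi_star_le andbT.
by rewrite -{2}(starK a) csemi_star_le.
Qed.

Lemma csemi_le0 a : p a <= 0 -> p a = 0.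
Proof. by move=> a0; apply/le_anti; rewrite a0 csemi_ge0. Qed.

Lemma csemi0D a b : p a = 0 -> p b = 0 -> p (a + b) = 0.
Proof.
move=> a0 b0; apply: csemi_le0; apply: le_trans (csnD (csemiP p) _ _) _.
by rewrite a0 b0 addr0.
Qed.

Lemma csemi0Z (k : R[i]) a : p a = 0 -> p (k *: a) = 0.
Proof. by rewrite (csnZ (csemiP p)) => ->; rewrite mulr0. Qed.

Lemma csemi0Ml a b : p a = 0 -> p (a ** b) = 0.
Proof.
move=> a0; apply: csemi_le0; apply: le_trans (csnM (csemiP p) _ _) _.
by rewrite a0 mul0r.
Qed.

Lemma csemi0Mr a b : p b = 0 -> p (a ** b) = 0.
Proof.
move=> b0; apply: csemi_le0; apply: le_trans (csnM (csemiP p) _ _) _.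
by rewrite b0 mulr0.
Qed.

Lemma csemi0B_eq a b : p (a - b) = 0 -> p a = p b.
Proof.
have h (c d : B) : p (c - d) = 0 -> p c <= p d.
  move=> cd; rewrite -(subrK d c); apply: le_trans (csnD (csemiP p) _ _) _.
  by rewrite cd add0r.
by move=> ab; apply/le_anti; rewrite !h // -opprB csemiN.
Qed.

End CseminormTheory.

Section QuotientAlgebra.
Context {R : realType} {B : starAlgType R} (p : csemi B).

Definition csemi_ker : {pred B} := [pred b | p b == 0].

Fact csemi_ker_submod : submod_closed csemi_ker.
Proof.
split=> [|k a b]; rewrite !inE ?csemi0 // => /eqP a0 /eqP b0; apply/eqP.
by apply: csemi0D => //; exact: csemi0Z.
Qed.

(* The C*-algebra B_p = B / ker p *)
Definition qalg : Type := lquot csemi_ker_submod.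
HB.instance Definition _ := GRing.Lmodule.on qalg.

Definition qpi (b : B) : qalg := lpi csemi_ker_submod b.
Definition qrepr (x : qalg) : B := lrepr x.
Definition qnorm (x : qalg) : R := p (qrepr x).

Definition qmul (x y : qalg) : qalg := qpi (qrepr x ** qrepr y).
Definition qstar (x : qalg) : qalg := qpi (star (qrepr x)).

Lemma qreprK x : qpi (qrepr x) = x. Proof. exact: lreprK. Qed.

Lemma qpi_eq a b : qpi a = qpi b <-> p (a - b) = 0.
Proof.
rewrite /qpi lpi_eq; split=> [|ab]; first by rewrite inE => /eqP.
by rewrite inE ab.
Qed.

Lemma qpi_linear : linear qpi.
Proof. exact: lpi_linear. Qed.

Lemma qpiD a b : qpi (a + b) = qpi a + qpi b.
Proof. exact: lpiD. Qed.

Lemma qpiZ (k : R[i]) a : qpi (k *: a) = k *: qpi a.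
Proof. exact: lpiZ. Qed.

Lemma qpi_eq0 a : qpi a = 0 <-> p a = 0.
Proof.
have <- : qpi 0 = 0 by have := qpiZ 0 0; rewrite !scale0r.
by rewrite qpi_eq subr0.
Qed.

Lemma qrepr_qpi a : p (a - qrepr (qpi a)) = 0.
Proof. by apply/qpi_eq; rewrite qreprK. Qed.

Lemma qnorm_qpi a : qnorm (qpi a) = p a.
Proof. by apply/esym/csemi0B_eq/qrepr_qpi. Qed.

Lemma qpiM a b : qpi (a ** b) = qmul (qpi a) (qpi b).
Proof.
apply/qpi_eq; set a' := qrepr _; set b' := qrepr _.
have -> : a ** b - a' ** b' = (a - a') ** b + a' ** (b - b').
  by rewrite smulBl smulBr addrA subrK.
by apply: csemi0D; [apply: csemi0Ml|apply: csemi0Mr]; exact: qrepr_qpi.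
Qed.

Lemma qpi_star a : qpi (star a) = qstar (qpi a).
Proof. by apply/qpi_eq; rewrite -starB csemi_star qrepr_qpi. Qed.

Fact qmulA : associative qmul.
Proof.
by move=> x y z; rewrite -(qreprK x) -(qreprK y) -(qreprK z) -!qpiM smulA.
Qed.
Fact qmulDl : left_distributive qmul +%R.
Proof.
move=> x y z; rewrite -(qreprK x) -(qreprK y) -(qreprK z).
by rewrite -qpiD -!qpiM -qpiD smulDl.
Qed.
Fact qmulDr : right_distributive qmul +%R.
Proof.
move=> x y z; rewrite -(qreprK x) -(qreprK y) -(qreprK z).
by rewrite -qpiD -!qpiM -qpiD smulDr.
Qed.
Fact qmulZl (k : R[i]) x y : qmul (k *: x) y = k *: qmul x y.
Proof. by rewrite -(qreprK x) -(qreprK y) -qpiZ -!qpiM -qpiZ smulZl. Qed.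
Fact qmulZr (k : R[i]) x y : qmul x (k *: y) = k *: qmul x y.
Proof. by rewrite -(qreprK x) -(qreprK y) -qpiZ -!qpiM -qpiZ smulZr. Qed.
Fact qstarK : involutive qstar.
Proof. by move=> x; rewrite -(qreprK x) -!qpi_star starK. Qed.
Fact qstarD : {morph qstar : x y / x + y}.
Proof.
by move=> x y; rewrite -(qreprK x) -(qreprK y) -qpiD -!qpi_star -qpiD starD.
Qed.
Fact qstarZ (k : R[i]) x : qstar (k *: x) = k^* *: qstar x.
Proof. by rewrite -(qreprK x) -qpiZ -!qpi_star -qpiZ starZ. Qed.
Fact qstarM x y : qstar (qmul x y) = qmul (qstar y) (qstar x).
Proof.
by rewrite -(qreprK x) -(qreprK y) -qpiM -!qpi_star -qpiM starM.
Qed.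
Fact qproper x : qmul (qstar x) x = 0 -> x = 0.
Proof.
rewrite -(qreprK x) -qpi_star -qpiM => /qpi_eq0.
by rewrite (csnX (csemiP p)) => /eqP; rewrite sqrf_eq0 => /eqP/qpi_eq0.
Qed.

HB.instance Definition _ := isStarAlgebra.Build R qalg
  qmulA qmulDl qmulDr qmulZl qmulZr qstarK qstarD qstarZ qstarM qproper.

End QuotientAlgebra.

Section QuotientModule.
Context {R : realType} {B : starAlgType R} (p : csemi B) (X : ipModType B).

(* The kernel of the seminorm x |-> p(<x, x>)^(1/2). By the Cauchy-Schwarz
   inequality the second condition follows from the first one when X is a
   Hilbert module; it is included so that the inner product passes to the
   quotient for every X : ipModType B. *)
Definition hsemi_ker : {pred X} :=
  fun x => `[< hseminorm p x = 0 /\ forall y : X, p << x, y >> = 0 >].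

Lemma hsemi_kerP x : reflect (forall y : X, p << x, y >> = 0) (x \in hsemi_ker).
Proof.
apply: (iffP (asboolP _)) => [[]//|x0]; split=> //.
by rewrite /hseminorm x0 sqrtr0.
Qed.

Fact hsemi_ker_submod : submod_closed hsemi_ker.
Proof.
split=> [|k x y /hsemi_kerP x0 /hsemi_kerP y0]; apply/hsemi_kerP => z.
  by rewrite ip0l csemi0.
by rewrite ipDl ipZl; apply: csemi0D => //; exact: csemi0Z.
Qed.

(* The Hilbert B_p-module X_p *)
Definition qmod : Type := lquot hsemi_ker_submod.
HB.instance Definition _ := GRing.Lmodule.on qmod.

Definition qsigma (x : X) : qmod := lpi hsemi_ker_submod x.
Definition qmrepr (u : qmod) : X := lrepr u.

Definition qact (u : qmod) (b : qalg p) : qmod :=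
  qsigma (qmrepr u <* qrepr b).
Definition qip (u v : qmod) : qalg p := qpi p << qmrepr u, qmrepr v >>.

Lemma qmreprK u : qsigma (qmrepr u) = u. Proof. exact: lreprK. Qed.

Lemma qsigma_eq x y : qsigma x = qsigma y <-> x - y \in hsemi_ker.
Proof. exact: lpi_eq. Qed.

Lemma qsigma_linear : linear qsigma.
Proof. exact: lpi_linear. Qed.

Lemma qsigmaD x y : qsigma (x + y) = qsigma x + qsigma y.
Proof. exact: lpiD. Qed.

Lemma qsigmaZ (k : R[i]) x : qsigma (k *: x) = k *: qsigma x.
Proof. exact: lpiZ. Qed.

Lemma qmrepr_qsigma x : x - qmrepr (qsigma x) \in hsemi_ker.
Proof. by apply/qsigma_eq; rewrite qmreprK. Qed.

Lemma qsigma_act x b : qsigma (x <* b) = qact (qsigma x) (qpi p b).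
Proof.
apply/qsigma_eq; set x' := qmrepr _; set b' := qrepr _.
have -> : x <* b - x' <* b' = (x - x') <* b + x' <* (b - b').
  by rewrite actDl actNl actDr actNr addrA subrK.
apply/hsemi_kerP => y; rewrite ipDl !ipMl; apply: csemi0D.
  by apply: csemi0Mr; apply/hsemi_kerP/qmrepr_qsigma.
by apply: csemi0Ml; rewrite csemi_star qrepr_qpi.
Qed.

Lemma qsigma_ip x y : qpi p << x, y >> = qip (qsigma x) (qsigma y).
Proof.
apply/qpi_eq; set x' := qmrepr _; set y' := qmrepr _.
have -> : << x, y >> - << x', y' >> = << x - x', y >> + << x', y - y' >> :> B.
  by rewrite ipBl ipBr addrA subrK.
apply: csemi0D; first exact/hsemi_kerP/qmrepr_qsigma.
by rewrite -ipC csemi_star; apply/hsemi_kerP/qmrepr_qsigma.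
Qed.

Fact qactDl u v b : qact (u + v) b = qact u b + qact v b.
Proof.
rewrite -(qmreprK u) -(qmreprK v) -(qreprK b) -qsigmaD -!qsigma_act.
by rewrite -qsigmaD actDl.
Qed.
Fact qactDr u b c : qact u (b + c) = qact u b + qact u c.
Proof.
rewrite -(qmreprK u) -(qreprK b) -(qreprK c) -qpiD -!qsigma_act.
by rewrite -qsigmaD actDr.
Qed.
Fact qactM u (b c : qalg p) : qact u (b ** c) = qact (qact u b) c.
Proof.
rewrite -(qmreprK u) -(qreprK b) -(qreprK c).
by rewrite -[X in qact _ X]qpiM -!qsigma_act actM.
Qed.
Fact qactZl (k : R[i]) u b : qact (k *: u) b = k *: qact u b.
Proof.
by rewrite -(qmreprK u) -(qreprK b) -qsigmaZ -!qsigma_act -qsigmaZ actZl.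
Qed.
Fact qactZr (k : R[i]) u b : qact u (k *: b) = k *: qact u b.
Proof.
by rewrite -(qmreprK u) -(qreprK b) -qpiZ -!qsigma_act -qsigmaZ actZr.
Qed.
Fact qipDr u v w : qip u (v + w) = qip u v + qip u w.
Proof.
rewrite -(qmreprK u) -(qmreprK v) -(qmreprK w) -qsigmaD -!qsigma_ip.
by rewrite -qpiD ipDr.
Qed.
Fact qipZr (k : R[i]) u v : qip u (k *: v) = k *: qip u v.
Proof.
by rewrite -(qmreprK u) -(qmreprK v) -qsigmaZ -!qsigma_ip -qpiZ ipZr.
Qed.
Fact qipMr u v b : qip u (qact v b) = qip u v ** b.
Proof.
rewrite -(qmreprK u) -(qmreprK v) -(qreprK b) -qsigma_act -!qsigma_ip ipMr.
exact: qpiM.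
Qed.
Fact qipC u v : star (qip u v) = qip v u.
Proof.
rewrite -(qmreprK u) -(qmreprK v) -!qsigma_ip -[in RHS]ipC.
exact/esym/qpi_star.
Qed.

HB.instance Definition _ := isIpModule.Build R (qalg p) qmod
  qactDl qactDr qactM qactZl qactZr qipDr qipZr qipMr qipC.

Lemma qmod_nondegenerate : nondegenerate qmod.
Proof.
move=> u u0; rewrite -(qmreprK u).
have s0 : qsigma 0 = 0.
  by have := qsigmaZ 0 0; rewrite !scale0r.
rewrite -s0; apply/qsigma_eq; rewrite subr0; apply/hsemi_kerP => y.
by apply/qpi_eq0; rewrite qsigma_ip qmreprK; exact: u0.
Qed.

End QuotientModule.

Section Morphisms.
Context {R : realType}.

Record star_morphism {B B' : starAlgType R} (f : B -> B') : Prop := {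
  sm_linear : linear f;
  sm_mul : forall a b, f (a ** b) = f a ** f b;
  sm_star : forall a, f (star a) = star (f a)
}.

Record module_map {B B' : starAlgType R} (rho : B -> B')
    {X : ipModType B} {X' : ipModType B'} (f : X -> X') : Prop := {
  mm_linear : linear f;
  mm_act : forall x b, f (x <* b) = f x <* rho b;
  mm_ip : forall x y, << f x, f y >> = rho << x, y >>
}.

Record quotient_map {B B' : starAlgType R} (rho : B -> B')
    (X : ipModType B) (X' : ipModType B') := QuotientMap {
  qmap :> X -> X';
  qmapP : module_map rho qmap;
  rho_surj : forall b', exists b, rho b = b';
  qmap_surj : forall x', exists x, qmap x = x';
  qmap_nondegenerate : nondegenerate X'
}.

End Morphisms.

Section Push.
Context {R : realType} {B B' : starAlgType R} {rho : B -> B'}.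

Lemma qmap_eq (X Y : ipModType B) (X' Y' : ipModType B')
    (sX : quotient_map rho X X') (sY : quotient_map rho Y Y')
    (T : adjop X Y) x1 x2 :
  sX x1 = sX x2 -> sY (T x1) = sY (T x2).
Proof.
move=> x12; apply/eqP; rewrite -subr_eq0; apply/eqP.
apply: (qmap_nondegenerate sY) => y'.
have [y <-] := qmap_surj sY y'.
rewrite ipBl !(mm_ip (qmapP sY)) !adjE -!(mm_ip (qmapP sX)) x12.
exact: subrr.
Qed.

Variables (X Y : ipModType B) (X' Y' : ipModType B').
Variables (sX : quotient_map rho X X') (sY : quotient_map rho Y Y').

Definition push_fun (T : adjop X Y) (x' : X') : Y' :=
  sY (T (projT1 (cid (qmap_surj sX x')))).

Lemma push_funE T x : push_fun T (sX x) = sY (T x).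
Proof. exact: (qmap_eq sY T (projT2 (cid (qmap_surj sX (sX x))))). Qed.

End Push.

Section Push2.
Context {R : realType} {B B' : starAlgType R} {rho : B -> B'}.
Context (X Y : ipModType B) (X' Y' : ipModType B').
Variables (sX : quotient_map rho X X') (sY : quotient_map rho Y Y').

Lemma push_fun_morphism (U V : ipModType B) (U' V' : ipModType B')
    (sU : quotient_map rho U U') (sV : quotient_map rho V V')
    (T : adjop U V) : module_morphism (push_fun sU sV T).
Proof.
split=> [k u' v'|u' b'].
  have [u <-] := qmap_surj sU u'; have [v <-] := qmap_surj sU v'.
  rewrite -(mm_linear (qmapP sU)) !push_funE adjop_linear.
  exact: (mm_linear (qmapP sV)).
have [u <-] := qmap_surj sU u'; have [b <-] := rho_surj sU b'.
rewrite -(mm_act (qmapP sU)) !push_funE adjop_act.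
exact: (mm_act (qmapP sV)).
Qed.

Lemma push_adjointable (T : adjop X Y) : adjointable (push_fun sX sY T).
Proof.
split; first exact: push_fun_morphism.
exists (push_fun sY sX (adj T)); split; first exact: push_fun_morphism.
move=> x' y'; have [x <-] := qmap_surj sX x'; have [y <-] := qmap_surj sY y'.
by rewrite !push_funE (mm_ip (qmapP sY)) (mm_ip (qmapP sX)) adjE.
Qed.

(* The operator T' with T' \o sX = sY \o T, see [pushE]. *)
Definition push (T : adjop X Y) : adjop X' Y' := to_adjop (push_adjointable T).

Lemma pushE T x : push T (sX x) = sY (T x).
Proof. exact: push_funE. Qed.

Lemma push_unique (T : adjop X Y) (T' : adjop X' Y') :
  (forall x, T' (sX x) = sY (T x)) -> T' = push T.
Proof.
move=> T'E; apply/adjop_inj/funext => x'; have [x <-] := qmap_surj sX x'.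
by rewrite T'E pushE.
Qed.

Lemma push_linear : linear push.
Proof.
move=> k S T; apply/esym/push_unique => x.
rewrite -[LHS]/(k *: push S (sX x) + push T (sX x)) !pushE.
exact/esym/(mm_linear (qmapP sY)).
Qed.

End Push2.

Section PushTheory.
Context {R : realType} {B B' : starAlgType R} {rho : B -> B'}.
Context (X Y Z : ipModType B) (X' Y' Z' : ipModType B').
Variables (sX : quotient_map rho X X') (sY : quotient_map rho Y Y').
Variable sZ : quotient_map rho Z Z'.

Lemma push_comp (S : adjop Y Z) (T : adjop X Y) :
  push sX sZ (adjop_comp S T) = adjop_comp (push sY sZ S) (push sX sY T).
Proof.
apply/esym/push_unique => x.
by rewrite -[LHS]/(push sY sZ S (push sX sY T (sX x))) !pushE.
Qed.

Lemma push_adj (T : adjop X Y) : push sY sX (adj T) = adj (push sX sY T).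
Proof.
apply/adjop_inj/adj_unique; first exact: (qmap_nondegenerate sX).
move=> x' y'; have [x <-] := qmap_surj sX x'; have [y <-] := qmap_surj sY y'.
by rewrite !pushE (mm_ip (qmapP sY)) (mm_ip (qmapP sX)) adjE.
Qed.

End PushTheory.

Section CanonicalMaps.
Context {R : realType} {B : starAlgType R}.

Fact qpi_morphism (p : csemi B) : star_morphism (qpi p).
Proof.
split; [exact: qpi_linear|exact: qpiM|exact: qpi_star].
Qed.

Lemma qpi_surj (p : csemi B) b' : exists b, qpi p b = b'.
Proof. by exists (qrepr b'); exact: qreprK. Qed.

Lemma regmod_module_map {B1 B2 : starAlgType R} (f : B1 -> B2) :
  star_morphism f -> module_map f (f : regmod B1 -> regmod B2).
Proof.
move=> fP; split=> [|x b|x y]; [exact: sm_linear|exact: sm_mul|].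
by rewrite /ip /= -(sm_star fP) -(sm_mul fP).
Qed.

(* pi_p : B -> B_p and sigma_p : X -> X_p *)
Definition pi_ (p : csemi B) :
    quotient_map (qpi p) (regmod B) (regmod (qalg p)) :=
  QuotientMap (regmod_module_map (qpi_morphism p)) (@qpi_surj p)
    (@qpi_surj p) (@regmod_nondegenerate R (qalg p)).

Fact qsigma_module_map (p : csemi B) (X : ipModType B) :
  module_map (qpi p) (@qsigma R B p X).
Proof.
split=> [|x b|x y]; [exact: qsigma_linear|exact: qsigma_act|].
exact/esym/qsigma_ip.
Qed.

Lemma qsigma_surj (p : csemi B) (X : ipModType B) (u : qmod p X) :
  exists x, qsigma p x = u.
Proof. by exists (qmrepr u); exact: qmreprK. Qed.

Definition sigma_ (p : csemi B) (X : ipModType B) :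
    quotient_map (qpi p) X (qmod p X) :=
  QuotientMap (qsigma_module_map p X) (@qpi_surj p) (@qsigma_surj p X)
    (@qmod_nondegenerate R B p X).

(* pi_pq : B_p -> B_q and sigma_pq : X_p -> X_q; they satisfy
   pi_pq \o pi_p = pi_q and sigma_pq \o sigma_p = sigma_q when p >= q. *)
Definition qpi2 (p q : csemi B) (b : qalg p) : qalg q := qpi q (qrepr b).
Definition qsigma2 (p q : csemi B) (X : ipModType B) (u : qmod p X) :
  qmod q X := qsigma q (qmrepr u).

Section Ordered.
Context {p q : csemi B}.
Hypothesis pq : csge p q.

Lemma csge_eq0 b : p b = 0 -> q b = 0.
Proof. by move=> b0; apply: csemi_le0; rewrite -b0; exact: pq. Qed.

Lemma qpi2E b : qpi2 q (qpi p b) = qpi q b.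
Proof.
by apply/esym/qpi_eq/csge_eq0/qpi_eq; rewrite qreprK.
Qed.

Lemma qsigma2E (X : ipModType B) (x : X) :
  qsigma2 q (qsigma p x) = qsigma q x.
Proof.
apply/esym/qsigma_eq/hsemi_kerP => y; apply: csge_eq0.
exact/hsemi_kerP/qmrepr_qsigma.
Qed.

Fact qpi2_morphism : star_morphism (@qpi2 p q).
Proof.
split=> [k a b|a b|a]; rewrite -(qreprK a) ?[in LHS]/(qpi p _).
- rewrite -(qreprK b) -qpi_linear !qpi2E; exact: qpi_linear.
- by rewrite -(qreprK b) -[X in qpi2 q X]qpiM !qpi2E; exact: qpiM.
- by rewrite -[X in qpi2 q X]qpi_star !qpi2E; exact: qpi_star.
Qed.

Lemma qpi2_surj b' : exists b, @qpi2 p q b = b'.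
Proof. by exists (qpi p (qrepr b')); rewrite qpi2E; exact: qreprK. Qed.

Definition pi2_ : quotient_map (@qpi2 p q) (regmod (qalg p)) (regmod (qalg q)) :=
  QuotientMap (regmod_module_map qpi2_morphism) qpi2_surj qpi2_surj
    (@regmod_nondegenerate R (qalg q)).

Fact qsigma2_module_map (X : ipModType B) :
  module_map (@qpi2 p q) (@qsigma2 p q X).
Proof.
split=> [k u v|u b|u v]; rewrite -(qmreprK u).
- rewrite -(qmreprK v) -qsigma_linear !qsigma2E; exact: qsigma_linear.
- rewrite -(qreprK b) -[X in qsigma2 q X]qsigma_act !qsigma2E qpi2E.
  exact: qsigma_act.
- rewrite -(qmreprK v) !qsigma2E -[X in qpi2 q X]qsigma_ip qpi2E.
  exact/esym/qsigma_ip.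
Qed.

Lemma qsigma2_surj (X : ipModType B) (u' : qmod q X) :
  exists u : qmod p X, qsigma2 q u = u'.
Proof. by exists (qsigma p (qmrepr u')); rewrite qsigma2E; exact: qmreprK. Qed.

Definition sigma2_ (X : ipModType B) :
    quotient_map (@qpi2 p q) (qmod p X) (qmod q X) :=
  QuotientMap (qsigma2_module_map X) qpi2_surj (@qsigma2_surj X)
    (@qmod_nondegenerate R B q X).

(* The extension pi''_pq : M(B_p) -> M(B_q) of pi_pq, and
   (pi_pq^{B,X})_* : M(X_p) -> M(X_q) *)
Definition mult2 : mult (qalg p) -> mult (qalg q) := push pi2_ pi2_.
Definition mmod2 {X : ipModType B} : mmod (qmod p X) -> mmod (qmod q X) :=
  push pi2_ (sigma2_ X).

Lemma mult2_lmult (b : qalg p) : mult2 (lmult b) = lmult (qpi2 q b).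
Proof.
apply/adjop_inj/funext => c'; have [c <-] := qpi2_surj c'.
rewrite -[LHS]/(push pi2_ pi2_ (lmult b) (pi2_ c)) pushE.
exact: (sm_mul qpi2_morphism).
Qed.

End Ordered.

(* (pi_p^{B,B})_* : M(B) -> M(B_p) and (pi_p^{B,X})_* : M(X) -> M(X_p) *)
Definition mult1 (p : csemi B) : mult B -> mult (qalg p) := push (pi_ p) (pi_ p).
Definition mmod1 (p : csemi B) {X : ipModType B} : mmod X -> mmod (qmod p X) :=
  push (pi_ p) (sigma_ p X).

End CanonicalMaps.

Section LinearLimit.
Context {K : nzRingType} {I : Type} {ge : I -> I -> Prop} {X : I -> lmodType K}.
Variable f : forall p q, ge p q -> X p -> X q.
Hypothesis f_linear : forall p q (pq : ge p q), linear (f pq).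

Record llim (fl : forall p q (pq : ge p q), linear (f pq)) := LLim {
  lproj :> forall p, X p;
  lprojP : forall p q (pq : ge p q), f pq (lproj p) = lproj q
}.

Local Notation lim := (llim f_linear).

Lemma llim_eq (x y : lim) : (forall p, x p = y p) -> x = y.
Proof.
case: x y => [x xP] [y yP] /= xy; have {}xy : x = y by exact/functional_extensionality_dep.
by case: _ / xy yP => yP; congr LLim; exact: Prop_irrelevance.
Qed.

HB.instance Definition _ := gen_eqMixin lim.
HB.instance Definition _ := gen_choiceMixin lim.

Let f0 p q (pq : ge p q) : f pq 0 = 0.
Proof.
have := f_linear pq 1 0 0; rewrite !scale1r addr0 => f0.
by apply: (addrI (f pq 0)); rewrite addr0.
Qed.
Let fD p q (pq : ge p q) x y : f pq (x + y) = f pq x + f pq y.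
Proof. by have := f_linear pq 1 x y; rewrite !scale1r. Qed.
Let fZ p q (pq : ge p q) k x : f pq (k *: x) = k *: f pq x.
Proof. by have := f_linear pq k x 0; rewrite f0 !addr0. Qed.
Let fN p q (pq : ge p q) x : f pq (- x) = - f pq x.
Proof. by rewrite -scaleN1r fZ scaleN1r. Qed.

Definition llim0 : lim := @LLim f_linear (fun=> 0) f0.
Definition llimD (x y : lim) : lim := @LLim f_linear (fun p => x p + y p)
  (fun p q pq => etrans (fD pq _ _)
     (congr2 +%R (lprojP x pq) (lprojP y pq))).
Definition llimN (x : lim) : lim := @LLim f_linear (fun p => - x p)
  (fun p q pq => etrans (fN pq _) (congr1 -%R (lprojP x pq))).
Definition llimZ (k : K) (x : lim) : lim := @LLim f_linear (fun p => k *: x p)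
  (fun p q pq => etrans (fZ pq _ _) (congr1 ( *:%R k) (lprojP x pq))).

Fact llimDA : associative llimD.
Proof. by move=> x y z; apply: llim_eq => p; exact: addrA. Qed.
Fact llimDC : commutative llimD.
Proof. by move=> x y; apply: llim_eq => p; exact: addrC. Qed.
Fact llim0D : left_id llim0 llimD.
Proof. by move=> x; apply: llim_eq => p; exact: add0r. Qed.
Fact llimND : left_inverse llim0 llimN llimD.
Proof. by move=> x; apply: llim_eq => p; exact: addNr. Qed.
HB.instance Definition _ := GRing.isZmodule.Build lim llimDA llimDC llim0D llimND.

Fact llimZA k l x : llimZ k (llimZ l x) = llimZ (k * l) x.
Proof. by apply: llim_eq => p; exact: scalerA. Qed.
Fact llimZ1 : left_id 1 llimZ.
Proof. by move=> x; apply: llim_eq => p; exact: scale1r. Qed.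
Fact llimZDr : right_distributive llimZ +%R.
Proof. by move=> k x y; apply: llim_eq => p; exact: scalerDr. Qed.
Fact llimZDl x : {morph llimZ^~ x : k l / k + l}.
Proof. by move=> k l; apply: llim_eq => p; exact: scalerDl. Qed.
HB.instance Definition _ := GRing.Zmodule_isLmodule.Build K lim
  llimZA llimZ1 llimZDr llimZDl.

End LinearLimit.

Section InverseSystems.
Context {R : realType} {I : Type} {ge : I -> I -> Prop}.

Record star_system {B : I -> starAlgType R}
    (rho : forall p q, ge p q -> B p -> B q) : Prop := {
  ss_morphism : forall p q (pq : ge p q), star_morphism (rho p q pq);
  ss_id : forall p (pp : ge p p) b, rho p p pp b = b;
  ss_comp : forall p q r (pq : ge p q) (qr : ge q r) (pr : ge p r) b,
    rho q r qr (rho p q pq b) = rho p r pr b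
}.

Record module_system {B : I -> starAlgType R}
    (rho : forall p q, ge p q -> B p -> B q) {X : forall p, ipModType (B p)}
    (sigma : forall p q, ge p q -> X p -> X q) : Prop := {
  ms_map : forall p q (pq : ge p q), module_map (rho p q pq) (sigma p q pq);
  ms_id : forall p (pp : ge p p) x, sigma p p pp x = x;
  ms_comp : forall p q r (pq : ge p q) (qr : ge q r) (pr : ge p r) x,
    sigma q r qr (sigma p q pq x) = sigma p r pr x
}.

(* {X; sigma} is an inverse system of Hilbert C*-modules over the inverse
   system {B; rho} of C*-algebras with norms nrm. *)
Definition hilbert_system {B : I -> starAlgType R} (nrm : forall p, B p -> R)
    (rho : forall p q, ge p q -> B p -> B q) {X : forall p, ipModType (B p)}
    (sigma : forall p q, ge p q -> X p -> X q) : Prop :=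
  [/\ forall p, Cstar_algebra (nrm p),
      star_system rho,
      forall p, hilbert_module (fun _ : unit => nrm p) (X p) &
      module_system rho sigma].

Section Limits.
Context {B : I -> starAlgType R} {rho : forall p q, ge p q -> B p -> B q}.
Context {X : forall p, ipModType (B p)}.
Context {sigma : forall p q, ge p q -> X p -> X q}.
Variables (rhoP : star_system rho) (sigmaP : module_system rho sigma).

Lemma ss_linear p q (pq : ge p q) : linear (rho pq).
Proof. exact: sm_linear (ss_morphism rhoP pq). Qed.

Lemma ms_linear p q (pq : ge p q) : linear (sigma pq).
Proof. exact: mm_linear (ms_map sigmaP pq). Qed.

(* lim_p B_p *)
Definition slim : Type := llim ss_linear.
HB.instance Definition _ := GRing.Lmodule.on slim.

Definition slim_mul (x y : slim) : slim :=
  @LLim _ _ _ B rho ss_linear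
    (fun p => x p ** y p)
    (fun p q pq => etrans (sm_mul (ss_morphism rhoP pq) _ _)
       (congr2 smul (lprojP x pq) (lprojP y pq))).
Definition slim_star (x : slim) : slim :=
  @LLim _ _ _ B rho ss_linear
    (fun p => star (x p))
    (fun p q pq => etrans (sm_star (ss_morphism rhoP pq) _)
       (congr1 star (lprojP x pq))).

Fact slim_mulA : associative slim_mul.
Proof. by move=> x y z; apply: llim_eq => p; exact: smulA. Qed.
Fact slim_mulDl : left_distributive slim_mul +%R.
Proof. by move=> x y z; apply: llim_eq => p; exact: smulDl. Qed.
Fact slim_mulDr : right_distributive slim_mul +%R.
Proof. by move=> x y z; apply: llim_eq => p; exact: smulDr. Qed.
Fact slim_mulZl (k : R[i]) x y : slim_mul (k *: x) y = k *: slim_mul x y.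
Proof. by apply: llim_eq => p; exact: smulZl. Qed.
Fact slim_mulZr (k : R[i]) x y : slim_mul x (k *: y) = k *: slim_mul x y.
Proof. by apply: llim_eq => p; exact: smulZr. Qed.
Fact slim_starK : involutive slim_star.
Proof. by move=> x; apply: llim_eq => p; exact: starK. Qed.
Fact slim_starD : {morph slim_star : x y / x + y}.
Proof. by move=> x y; apply: llim_eq => p; exact: starD. Qed.
Fact slim_starZ (k : R[i]) x : slim_star (k *: x) = k^* *: slim_star x.
Proof. by apply: llim_eq => p; exact: starZ. Qed.
Fact slim_starM x y :
  slim_star (slim_mul x y) = slim_mul (slim_star y) (slim_star x).
Proof. by apply: llim_eq => p; exact: starM. Qed.
Fact slim_proper x : slim_mul (slim_star x) x = 0 -> x = 0.
Proof.
move=> x0; apply: llim_eq => p; apply: star_proper.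
exact: (congr1 (fun y : slim => y p) x0).
Qed.
HB.instance Definition _ := isStarAlgebra.Build R slim
  slim_mulA slim_mulDl slim_mulDr slim_mulZl slim_mulZr
  slim_starK slim_starD slim_starZ slim_starM slim_proper.

(* lim_p X_p; the argument only fixes the coefficient algebra lim_p B_p. *)
Definition mlim (_ : star_system rho) : Type :=
  llim ms_linear.
HB.instance Definition _ := GRing.Lmodule.on (mlim rhoP).

Definition mlim_act (x : mlim rhoP) (b : slim) : mlim rhoP :=
  @LLim _ _ _ X sigma ms_linear
    (fun p => x p <* b p)
    (fun p q pq => etrans (mm_act (ms_map sigmaP pq) _ _)
       (congr2 act (lprojP x pq) (lprojP b pq))).
Definition mlim_ip (x y : mlim rhoP) : slim :=
  @LLim _ _ _ B rho ss_linear
    (fun p => << x p, y p >>)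
    (fun p q pq => etrans (esym (mm_ip (ms_map sigmaP pq) _ _))
       (congr2 ip (lprojP x pq) (lprojP y pq))).

Fact mlim_actDl x y b : mlim_act (x + y) b = mlim_act x b + mlim_act y b.
Proof. by apply: llim_eq => p; exact: actDl. Qed.
Fact mlim_actDr x b c : mlim_act x (b + c) = mlim_act x b + mlim_act x c.
Proof. by apply: llim_eq => p; exact: actDr. Qed.
Fact mlim_actM x b c : mlim_act x (b ** c) = mlim_act (mlim_act x b) c.
Proof. by apply: llim_eq => p; exact: actM. Qed.
Fact mlim_actZl (k : R[i]) x b : mlim_act (k *: x) b = k *: mlim_act x b.
Proof. by apply: llim_eq => p; exact: actZl. Qed.
Fact mlim_actZr (k : R[i]) x b : mlim_act x (k *: b) = k *: mlim_act x b.
Proof. by apply: llim_eq => p; exact: actZr. Qed.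
Fact mlim_ipDr x y z : mlim_ip x (y + z) = mlim_ip x y + mlim_ip x z.
Proof. by apply: llim_eq => p; exact: ipDr. Qed.
Fact mlim_ipZr (k : R[i]) x y : mlim_ip x (k *: y) = k *: mlim_ip x y.
Proof. by apply: llim_eq => p; exact: ipZr. Qed.
Fact mlim_ipMr x y b : mlim_ip x (mlim_act y b) = mlim_ip x y ** b.
Proof. by apply: llim_eq => p; exact: ipMr. Qed.
Fact mlim_ipC x y : star (mlim_ip x y) = mlim_ip y x.
Proof. by apply: llim_eq => p; exact: ipC. Qed.
HB.instance Definition _ := isIpModule.Build R slim (mlim rhoP)
  mlim_actDl mlim_actDr mlim_actM mlim_actZl mlim_actZr
  mlim_ipDr mlim_ipZr mlim_ipMr mlim_ipC.

End Limits.
End InverseSystems.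

Section MultiplierSystem.
Context {R : realType} {B : starAlgType R}.

Lemma qpi2_id (p : csemi B) (b : qalg p) : qpi2 p b = b.
Proof. exact: qreprK. Qed.

Lemma qpi2_comp (p q r : csemi B) (qr : csge q r) (b : qalg p) :
  qpi2 r (qpi2 q b) = qpi2 r b.
Proof. exact: qpi2E. Qed.

Lemma qsigma2_id (p : csemi B) (X : ipModType B) (u : qmod p X) :
  qsigma2 p u = u.
Proof. exact: qmreprK. Qed.

Lemma qsigma2_comp (p q r : csemi B) (qr : csge q r) (X : ipModType B)
  (u : qmod p X) : qsigma2 r (qsigma2 q u) = qsigma2 r u.
Proof. exact: qsigma2E. Qed.

Lemma mult2E (p q : csemi B) (pq : csge p q) (m : mult (qalg p)) b :
  mult2 pq m (qpi2 q b) = qpi2 q (m b).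
Proof. exact: (pushE (pi2_ pq) (pi2_ pq)). Qed.

Lemma mmod2E (p q : csemi B) (pq : csge p q) (X : ipModType B)
  (t : mmod (qmod p X)) b : mmod2 pq t (qpi2 q b) = qsigma2 q (t b).
Proof. exact: (pushE (pi2_ pq) (sigma2_ pq X)). Qed.

Lemma mult1E (p : csemi B) (m : mult B) b : mult1 p m (qpi p b) = qpi p (m b).
Proof. exact: (pushE (pi_ p) (pi_ p)). Qed.

Lemma mmod1E (p : csemi B) (X : ipModType B) (t : mmod X) b :
  mmod1 p t (qpi p b) = qsigma p (t b).
Proof. exact: (pushE (pi_ p) (sigma_ p X)). Qed.

Lemma mult2_mult1 (p q : csemi B) (pq : csge p q) (m : mult B) :
  mult2 pq (mult1 p m) = mult1 q m.
Proof.
apply: push_unique => b; rewrite -[qmap _ b]/(qpi q b) -(qpi2E pq).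
by rewrite mult2E mult1E qpi2E.
Qed.

Lemma mmod2_mmod1 (p q : csemi B) (pq : csge p q) (X : ipModType B)
  (t : mmod X) : mmod2 pq (mmod1 p t) = mmod1 q t.
Proof.
apply: push_unique => b; rewrite -[qmap _ b]/(qpi q b) -(qpi2E pq).
by rewrite mmod2E mmod1E qsigma2E.
Qed.

End MultiplierSystem.

Section MultiplierLimit.
Context {R : realType} (A : topStarAlgType R) (E : ipModType A).

Definition ccsemi_ge (p q : ccsemi A) : Prop := csge p q.

(* {M(A_p); pi''_pq} and {M(E_p); (pi_pq^{A,E})_*} *)
Definition MAp (p : ccsemi A) : starAlgType R := mult (qalg p).
Definition MAp_map (p q : ccsemi A) (pq : ccsemi_ge p q) : MAp p -> MAp q :=
  mult2 pq.
Definition MEp (p : ccsemi A) : ipModType (MAp p) := mmod (qmod p E).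
Definition MEp_map (p q : ccsemi A) (pq : ccsemi_ge p q) : MEp p -> MEp q :=
  mmod2 pq.

Fact MAp_system : star_system MAp_map.
Proof.
split=> [p q pq|p pp m|p q r pq qr pr m].
- by split=> [|m n|m]; [exact: push_linear|exact: push_comp|exact: push_adj].
- apply/esym/push_unique => b.
  by rewrite -[qmap _ b]/(qpi2 p b) -[RHS]/(qpi2 p (m b)) !qpi2_id.
- apply: push_unique => b.
  rewrite -[qmap _ b]/(qpi2 r b) -[RHS]/(qpi2 r (m b)) -(qpi2_comp qr).
  by rewrite mult2E mult2E (qpi2_comp qr).
Qed.

Fact MEp_system : module_system MAp_map MEp_map.
Proof.
split=> [p q pq|p pp t|p q r pq qr pr t].
- split=> [|t m|s t]; [exact: push_linear|exact: push_comp|].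
  by rewrite /ip /= /mmod_ip -push_adj; exact/esym/push_comp.
- apply/esym/push_unique => b.
  by rewrite -[qmap _ b]/(qpi2 p b) -[RHS]/(qsigma2 p (t b)) qpi2_id qsigma2_id.
- apply: push_unique => b.
  rewrite -[qmap _ b]/(qpi2 r b) -[RHS]/(qsigma2 r (t b)) -(qpi2_comp qr).
  by rewrite mmod2E mmod2E (qsigma2_comp qr).
Qed.

Definition limMA : starAlgType R := slim MAp_system.
Definition limME : ipModType limMA := mlim MEp_system MAp_system.

(* The identification M(A) -> lim_p M(A_p) *)
Definition MA_lim (m : mult A) : limMA :=
  @LLim _ _ _ MAp MAp_map (ss_linear MAp_system) (fun p => mult1 p m)
    (fun p q pq => mult2_mult1 pq m).

(* t |-> ((pi_p^{A,E})_*(t))_p *)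
Definition ME_lim (t : mmod E) : limME :=
  @LLim _ _ _ MEp MEp_map (ms_linear MEp_system) (fun p => mmod1 p t)
    (fun p q pq => mmod2_mmod1 pq t).

(* The seminorms defining the topologies of A, M(A) = L_A(A), M(E) = L_A(A, E)
   and lim_p M(A_p), indexed by S(A). *)
Definition A_seminorm (p : ccsemi A) (a : A) : R := p a.
Definition MA_seminorm (p : ccsemi A) (m : mult A) : R :=
  opnorm (@qnorm R A p) (mult1 p m).
Definition ME_seminorm (p : ccsemi A) (t : mmod E) : R :=
  opnorm (@qnorm R A p) (mmod1 p t).
Definition MAp_norm (p : ccsemi A) (m : MAp p) : R := opnorm (@qnorm R A p) m.
Definition limMA_seminorm (p : ccsemi A) (m : limMA) : R := MAp_norm (lproj m p).

End MultiplierLimit.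

(* The strict topology on M(X), where X is a Hilbert module over B and P a
   family of C*-seminorms defining the topology of B. *)
Definition strict_seminorm {R : realType} {B : starAlgType R} {I : Type}
    (P : I -> B -> R) {X : ipModType B} (i : I * B * X) (t : mmod X) : R :=
  hseminorm (P i.1.1) (t i.1.2) + P i.1.1 (adj t i.2).

Definition strict_top {R : realType} {B : starAlgType R} {I : Type}
  (P : I -> B -> R) (X : ipModType B) := snorm_top (@strict_seminorm R B I P X).

Section Strict.
Context {R : realType} (A : topStarAlgType R) (E : ipModType A).

Definition MEp_strict (p : ccsemi A) :=
  strict_top (fun _ : unit => @qnorm R A p) (qmod p E).

Definition limME_prod (x : limME E) : prod_topology MEp_strict :=
  fun p => lproj x p.

(* lim_p M(E_p) with the inverse limit of the strict topologies *)
Definition limME_strict := initial_topology limME_prod.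

End Strict.

(* Unitary equivalence of X and Y along an identification Phi of their
   coefficient algebras: U is adjointable with adjoint V, V \o U = id and
   U \o V = id. *)
Definition unitary_along {R : realType} {B B' : starAlgType R} (Phi : B -> B')
    {X : ipModType B} {Y : ipModType B'} (U : X -> Y) : Prop :=
  [/\ linear U, forall x b, U (x <* b) = U x <* Phi b &
  exists V : Y -> X,
    [/\ linear V, forall y b, V (y <* Phi b) = V y <* b,
        forall x y, << U x, y >> = Phi << x, V y >>,
        cancel U V & cancel V U]].

(* Main.v *)
(** The C*-algebras [A / ker p] and the Hilbert modules [E / ker p] have to be
    shown complete, which rests on positivity. In a unital C*-algebra, call a
    self-adjoint [h] positive when [|t - h| <= t] for some [t >= 0]; the series
    of [sqrt (1 - x)] for [|x| <= 1] gives square roots, and [w + i k] being a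
    multiple of a unitary when [w^2 + k^2] is a scalar shows that squares are
    positive. Hence [c^* c] is positive, and so is [<t, t>] in [M(B)] as soon
    as all [b^* <t, t> b] are. An arbitrary C*-seminorm reduces to this case:
    complete, then pass to the multiplier algebra, whose elements are bounded
    by the uniform boundedness principle.

    In a complete module the resolvent [y = x (1 + l <x, x>)^-1] exists, as a
    limit over all seminorms of Neumann series, and [l q(<y, y>) <= 2] for
    every [q], while [x - y] is small for a given [p] if [l p(<x, x>)] is. So
    elements small for [p] are, up to a smaller error, small for every [q],
    which gives the completeness of [E / ker p] by an open-mapping iteration.
    The same resolvents are approximate units, which yield the density of [E]
    in [M(E)] and the inclusion of [E M(A)] in [E]. Compatible families over
    the quotients glue because [A] and [E] are complete; the positive square
    roots in the [M(A_p)] are unique, hence compatible. *)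

From HB Require Import structures.
From mathcomp Require Import all_boot all_order all_algebra.
From mathcomp Require Import complex.
From mathcomp Require Import all_classical all_reals topology normedtype sequences.
From mathcomp Require Import ring lra.
Require Import Defs.

Set Implicit Arguments.
Unset Strict Implicit.
Unset Printing Implicit Defensive.

Import Order.TTheory GRing.Theory Num.Theory.
Import numFieldTopology.Exports numFieldNormedType.Exports.

Local Open Scope classical_set_scope.
Local Open Scope ring_scope.
Local Open Scope complex_scope.

(** * Families of seminorms and completeness *)

(** Positivity and completeness depend on each other: completeness of the quotients by [p] rests on
    inequalities for positive elements, and these need an algebra that is already complete.
    [Cstar_embedding] cuts the circle: the [p]-Cauchy sequences are complete for their limit
    seminorm without any positivity, and only inequalities between values of [p] are brought back to
    [A]. Cauchy-Schwarz has the same loop: it is a hypothesis until it can be proved, and [regmod]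
    satisfies it from the start. The other obstacle is that [S(A)] need not have a countable cofinal
    subset, and that approximations made for one seminorm are useless for another. Hence existence
    over all seminorms goes through filters: [approx_limit] yields the resolvents, the gluing and
    the closed range, each with its own defect function. *)

Lemma finite_set_filter (T I : Type) (F : set_system T) (J : set I)
    (f : I -> set T) : Filter F -> finite_set J ->
  (forall i, J i -> F (f i)) -> F [set x | forall i, J i -> f i x].
Proof.
move=> FF [n]; elim: n J => [|n IHn] J.
  rewrite II0 card_eq0 => /eqP -> _; apply: filterS filterT => x _ i [].
move=> /eq_cardSP[i Ji Jn] Jf.
have IH : F [set x | forall j, (J `\ i) j -> f j x].
  by apply: IHn => // j [Jj _]; exact: Jf.
apply: filterS (filterI (Jf i Ji) IH) => x [fi fJ] j Jj.
by have [->//|ji] := pselect (j = i); apply: fJ.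
Qed.

Section Seminorms.
Context {R : realType} {V : lmodType R[i]}.

Record seminorm (N : V -> R) : Prop := {
  snD : forall x y, N (x + y) <= N x + N y;
  snZ : forall (k : R[i]) x, N (k *: x) = ComplexField.Normc.normc k * N x
}.

Lemma normcR (r : R) : ComplexField.Normc.normc r%:C = `|r|.
Proof. by rewrite /= expr0n addr0 sqrtr_sqr. Qed.

Section Theory.
Variables (N : V -> R) (NP : seminorm N).

Lemma snZr (r : R) x : N (r%:C *: x) = `|r| * N x.
Proof. by rewrite snZ // normcR. Qed.

Lemma sn0 : N 0 = 0.
Proof. by have := snZr 0 0; rewrite scaler0 normr0 mul0r. Qed.

Lemma snN x : N (- x) = N x.
Proof. by have := snZr (-1) x; rewrite rmorphN rmorph1 scaleN1r normrN1 mul1r. Qed.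

Lemma sn_ge0 x : 0 <= N x.
Proof. by have := snD NP x (- x); rewrite subrr sn0 snN -mulr2n pmulrn_lge0. Qed.

Lemma snB x y : N (x - y) <= N x + N y.
Proof. by rewrite -(snN y) snD. Qed.

Lemma sn_sym x y : N (x - y) = N (y - x).
Proof. by rewrite -opprB snN. Qed.

Lemma sn_tri y x z : N (x - z) <= N (x - y) + N (y - z).
Proof. by rewrite -[x - z](subrKA y) snD. Qed.

Lemma sn_le_sub x y : N x <= N y + N (x - y).
Proof. by have := snD NP (x - y) y; rewrite subrK addrC. Qed.

End Theory.
End Seminorms.

Section SeminormFamily.
Context {R : realType} {V : lmodType R[i]} {I : Type}.
Variables (P : I -> V -> R) (PP : forall i, seminorm (P i)).

Lemma snorm_nbhsP (x : V) (U : set V) :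
  nbhs (x : snorm_top P) U <-> exists J : set I, finite_set J /\
    exists2 e : R, 0 < e & forall y, (forall i, J i -> P i (y - x) < e) -> U y.
Proof.
split.
  rewrite nbhsE => -[O [Oo Ox] OU]; have [J [Jf [e e0 eO]]] := Oo _ Ox.
  by exists J; split=> //; exists e => // y /eO/OU.
move=> [J [Jf [e e0 eU]]]; rewrite nbhsE; exists
  [set y | exists2 d, 0 < d & forall z, (forall i, J i -> P i (z - y) < d) -> U z].
  split; last by exists e.
  move=> y [d d0 dU]; exists J; split=> //; exists (d / 2); first by rewrite divr_gt0.
  move=> z zd; exists (d / 2); first by rewrite divr_gt0.
  move=> w wd; apply: dU => i Ji; apply: le_lt_trans (sn_tri (PP i) z _ _) _.
  by rewrite [ltRHS]splitr ltrD ?wd ?zd.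
move=> y [d d0 dU]; apply: dU => i _.
by rewrite subrr (sn0 (PP i)).
Qed.

Lemma snorm_nbhs1 (i : I) (x : V) (e : R) : 0 < e ->
  nbhs (x : snorm_top P) [set y | P i (y - x) < e].
Proof.
move=> e0; apply/snorm_nbhsP; exists [set i]; split; first exact: finite_set1.
by exists e => // y; apply.
Qed.

Lemma snorm_cvgP (F : set_system V) (x : V) : Filter F ->
  (F --> (x : snorm_top P)) <-> forall i (e : R), 0 < e -> F [set y | P i (y - x) < e].
Proof.
move=> FF; split=> [Fx i e e0|Fx U /snorm_nbhsP[J [Jf [e e0 eU]]]].
  exact/Fx/snorm_nbhs1.
have := finite_set_filter FF Jf (fun i _ => Fx i e e0).
exact: filterS => y /= /eU.
Qed.

(* Completeness without the uniform structure: a filter is Cauchy when it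
   contains arbitrarily small balls. *)
Definition complete_fam : Prop := forall F : set_system V, ProperFilter F ->
  (forall i (e : R), 0 < e -> exists x, F [set y | P i (y - x) < e]) ->
  exists x, forall i (e : R), 0 < e -> F [set y | P i (y - x) < e].

Lemma complete_famP : tvs_complete (snorm_top P) <-> complete_fam.
Proof.
split=> cP F FF Fc.
  have [x Fx] : exists x : snorm_top P, F --> x.
    apply: cP => U /snorm_nbhsP[J [Jf [e e0 eU]]].
    have e2 : 0 < e / 2 by rewrite divr_gt0.
    pose c i := projT1 (cid (Fc i _ e2)).
    pose D := [set y | forall i, J i -> P i (y - c i) < e / 2].
    have FD : F D.
      by apply: finite_set_filter => // i _; exact: projT2 (cid (Fc i _ e2)).
    exists (D, D) => // -[x y] [/= xD yD]; apply: eU => i Ji; rewrite subr0.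
    apply: le_lt_trans (sn_tri (PP i) (c i) _ _) _.
    by rewrite [ltRHS]splitr ltrD ?xD // (sn_sym (PP i)) yD.
  by exists x; apply/snorm_cvgP.
have [|x xF] := cP F FF.
  move=> i e e0; have [|[U W] [/= FU FW] UW] := Fc [set y | P i y < e].
    by have := snorm_nbhs1 i 0 e0; apply: filterS => y; rewrite /= subr0.
  have [y Wy] := filter_ex FW; exists y.
  by apply: filterS FU => x Ux; exact: (UW (x, y)).
by exists x; apply/snorm_cvgP.
Qed.

(** The rate [b] is common to all seminorms, so it survives as a bound on the distance to the
    limit. *)
Lemma complete_fam_seq (s : nat -> V) (b : nat -> R) : complete_fam ->
  (forall e : R, 0 < e -> exists n, forall m, (n <= m)%N -> b m < e) ->
  (forall i m n, (n <= m)%N -> P i (s m - s n) <= b n) ->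
  exists x, forall i n, P i (x - s n) <= b n.
Proof.
move=> cP b0 sb.
have [i e e0|x xs] := cP (s @ \oo) _.
  have [n nb] := b0 _ e0; exists (s n); exists n => // m /= nm.
  exact: le_lt_trans (sb _ _ _ nm) (nb _ _).
exists x => i n; apply/ler_addgt0Pr => e e0.
have [k _ ke] := xs i _ e0; have := ke (maxn k n) (leq_maxl _ _) => /= xe.
apply: le_trans (sn_tri (PP i) (s (maxn k n)) _ _) _.
by rewrite addrC lerD ?sb ?leq_maxr // (sn_sym (PP i)) ltW.
Qed.

End SeminormFamily.

Section Geometric.
Context {R : realType}.

Lemma geometric_small (q C e : R) : 0 <= q <= 2^-1 -> 0 < e ->
  exists n, forall m, (n <= m)%N -> C * q ^+ m < e.
Proof.
move=> /andP[q0 q2] e0.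
(* As [q] is at most one half, [q ^+ m] is at most [2^-m], and [m < 2 ^ m] does the rest. *)
have [n nC] : exists n : nat, `|C| / e < n%:R.
  by exists (Num.truncn (`|C| / e)).+1; exact: truncnS_gt.
exists n => m nm; apply: le_lt_trans (_ : `|C| * 2^-1 ^+ m < e).
  apply: le_trans (_ : `|C| * q ^+ m <= _).
    by rewrite ler_wpM2r ?exprn_ge0 // ler_norm.
  by rewrite ler_wpM2l // lerXn2r // nnegrE invr_ge0.
rewrite exprVn ltr_pdivrMr ?exprn_gt0 //.
rewrite ltr_pdivrMr // in nC; apply: lt_le_trans nC _.
rewrite mulrC ler_pM2l // -natrX ler_nat.
exact: leq_trans nm (ltnW (ltn_expl _ _)).
Qed.

(** [N m n] stands for the distance between two terms of a sequence. Keeping the exact difference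
    [q ^+ n - q ^+ m] makes the induction telescope. *)
Lemma geometric_partial (q C : R) (N : nat -> nat -> R) : 0 <= q < 1 ->
  (forall n, N n n = 0) ->
  (forall m n k, N m k <= N m n + N n k) ->
  (forall n, N n.+1 n <= C * q ^+ n) -> 0 <= C ->
  forall m n, (n <= m)%N -> N m n <= C / (1 - q) * q ^+ n.
Proof.
move=> /andP[q0 q1] N0 Nt Ns C0 m n nm; rewrite -(subnK nm).
have q10 : 0 < 1 - q by rewrite subr_gt0.
apply: (@le_trans _ _ (C / (1 - q) * (q ^+ n - q ^+ (m - n + n)))); last first.
  by rewrite ler_wpM2l ?divr_ge0 ?(ltW q10) // gerBl exprn_ge0.
elim: (m - n)%N => [|d IHd]; first by rewrite add0n subrr mulr0 N0.
apply: le_trans (Nt _ (d + n)%N _) _; have := Ns (d + n)%N.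
rewrite addSn exprS; set u := _ ^+ (d + n); move: IHd; rewrite -/u.
set v := _ ^+ n => IHd H.
have -> : C / (1 - q) * (v - q * u) = C * u + C / (1 - q) * (v - u).
  by field; rewrite gt_eqF.
by rewrite lerD.
Qed.
End Geometric.

Section SingleSeminorm.
Context {R : realType} {V : lmodType R[i]}.
Variables (N : V -> R) (NP : seminorm N).

Local Notation half n := (2^-1 ^+ n).

(** One seminorm is a pseudometric, so sequences suffice. The factor 2 comes from the centers of two
    balls of radii [2^-m] and [2^-n] that meet. *)
Lemma complete_fam1P : (forall s : nat -> V,
    (forall m n, (n <= m)%N -> N (s m - s n) <= 2 * half n) ->
    exists x, forall e : R, 0 < e -> exists k, forall n, (k <= n)%N ->
      N (s n - x) < e) ->
  complete_fam (fun _ : unit => N).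
Proof.
move=> H F FF Fc.
have h0 n : 0 < half n :> R by rewrite exprn_gt0 // invr_gt0.
have /choice[s sF] n := Fc tt _ (h0 n).
have [m n nm|x xs] := H s.
  have [y [/= ym yn]] := filter_ex (filterI (sF m) (sF n)).
  apply: le_trans (sn_tri NP y _ _) _; rewrite (sn_sym NP).
  have : half m <= half n :> R by apply: ler_wiXn2l nm; lra.
  by lra.
exists x => _ e e0; have [k kx] := xs _ (divr_gt0 e0 (ltr0Sn R 1)).
have half2 : 0 <= (2^-1 : R) <= 2^-1 by rewrite invr_ge0 lexx ler0n.
have [n ne] := geometric_small 1 half2 (divr_gt0 e0 (ltr0Sn R 1)).
apply: filterS (sF (maxn k n)) => y /= ys.
apply: le_lt_trans (sn_tri NP (s (maxn k n)) _ _) _.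
have := kx _ (leq_maxl k n); have := ne _ (leq_maxr k n); rewrite mul1r.
by lra.
Qed.

End SingleSeminorm.

(** Filters are pulled back along a set-theoretic section of [f], which preserves distances by the
    second hypothesis. *)
Lemma complete_fam_surj (R : realType) (V W : lmodType R[i]) (I : Type)
    (P : I -> V -> R) (Q : I -> W -> R) (f : V -> W) :
  (forall w, exists v, f v = w) ->
  (forall i x y, Q i (f x - f y) = P i (x - y)) ->
  complete_fam P -> complete_fam Q.
Proof.
move=> fs fPQ cP F FF Fc; have /choice[g gK] := fs.
have [i e e0|x xF] := cP (g @ F) _.
- have [y yF] := Fc i e e0; exists (g y).
  by apply: (@filterS _ F _ _ _ _ yF) => z /=; rewrite -fPQ !gK.
- exists (f x) => i e e0; apply: (@filterS _ F _ _ _ _ (xF i e e0)) => z /=.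
  by rewrite -fPQ gK.
Qed.

(** * Square roots and positivity in unital C*-algebras *)

Section StarScalars.
Context {R : realType} {B : starAlgType R}.
Implicit Types a b c z : B.

Definition imag : R[i] := Complex 0 1.

Lemma imag2 : imag * imag = -1.
Proof. by apply/eqP; rewrite eq_complex /=; apply/andP; split; apply/eqP; ring. Qed.

Lemma normc_imag : ComplexField.Normc.normc imag = 1.
Proof. by rewrite /= expr0n expr1n add0r sqrtr1. Qed.

Lemma starZr (r : R) a : star (r%:C *: a) = r%:C *: star a.
Proof.
rewrite starZ; congr (_ *: _); apply/eqP.
by rewrite eq_complex /= ?oppr0 ?eqxx.
Qed.

Lemma starZi a : star (imag *: a) = - (imag *: star a).
Proof.
rewrite starZ -scaleNr; congr (_ *: _); apply/eqP.
by rewrite eq_complex /= ?oppr0 ?eqxx.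
Qed.

Lemma scaleCA (r s : R) (V : lmodType R[i]) (v : V) :
  r%:C *: (s%:C *: v) = (r * s)%:C *: v.
Proof. by rewrite scalerA -rmorphM. Qed.

Lemma scaleC1 (V : lmodType R[i]) (v : V) : (1 : R)%:C *: v = v.
Proof. by rewrite rmorph1 scale1r. Qed.

Lemma scaleC0 (V : lmodType R[i]) (v : V) : (0 : R)%:C *: v = 0.
Proof. by rewrite rmorph0 scale0r. Qed.

Lemma scaleCD (r s : R) (V : lmodType R[i]) (v : V) :
  (r + s)%:C *: v = r%:C *: v + s%:C *: v.
Proof. by rewrite rmorphD scalerDl. Qed.

Lemma half_twice (V : lmodType R[i]) (v : V) :
  (2^-1 : R)%:C *: (v + v) = v.
Proof. by rewrite scalerDr -scaleCD [_ + _](_ : _ = 1) ?scaleC1 //; field. Qed.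

Definition commutes a b := a ** b = b ** a.

Lemma commutes_sym a b : commutes a b -> commutes b a.
Proof. by []. Qed.

Lemma commutes0 z : commutes z 0.
Proof. by rewrite /commutes smul0l smul0r. Qed.

Lemma commutesD z a b : commutes z a -> commutes z b -> commutes z (a + b).
Proof. by rewrite /commutes smulDl smulDr => -> ->. Qed.

Lemma commutesN z a : commutes z a -> commutes z (- a).
Proof. by rewrite /commutes smulNl smulNr => ->. Qed.

Lemma commutesB z a b : commutes z a -> commutes z b -> commutes z (a - b).
Proof. by move=> za zb; apply: commutesD => //; exact: commutesN. Qed.

Lemma commutesZ z (k : R[i]) a : commutes z a -> commutes z (k *: a).
Proof. by rewrite /commutes smulZl smulZr => ->. Qed.

Lemma commutesM z a b : commutes z a -> commutes z b -> commutes z (a ** b).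
Proof. by rewrite /commutes => za zb; rewrite smulA za -smulA zb smulA. Qed.

Lemma sqr_sub_comm a b : commutes a b -> a ** a - b ** b = (a - b) ** (a + b).
Proof. by move=> ab; rewrite smulDr !smulBl ab addrA subrK. Qed.

End StarScalars.

Section CstarSeminorm.
Context {R : realType} {B : starAlgType R} (nrm : B -> R).
Hypothesis nrmP : Cstar_seminorm nrm.

Lemma csn_seminorm : seminorm nrm.
Proof. by split; [exact: csnD|exact: csnZ]. Qed.

Lemma csn_ge0 a : 0 <= nrm a. Proof. exact: (sn_ge0 csn_seminorm). Qed.

Lemma csn_star a : nrm (star a) = nrm a.
Proof. exact: (csemi_star (CSemi nrmP)). Qed.

Lemma csn_sqr a : star a = a -> nrm (a ** a) = nrm a ^+ 2.
Proof. by move=> sa; rewrite -{1}sa (csnX nrmP). Qed.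

Lemma csn_sqr' a : nrm (a ** star a) = nrm a ^+ 2.
Proof. by rewrite -{1}(starK a) (csnX nrmP) csn_star. Qed.

(** The C*-identity yields exponents that are powers of 2 only; the fourth power is compared with
    the cube and one factor [nrm a] is cancelled. *)
Lemma csn_cube a : star a = a -> nrm a ^+ 3 <= nrm (a ** (a ** a)).
Proof.
move=> sa; have [a0|a0] := eqVneq (nrm a) 0.
  by rewrite a0 expr0n /= csn_ge0.
have : nrm a ^+ 4 <= nrm (a ** (a ** a)) * nrm a.
  rewrite -[4%N]/(2 * 2)%N exprM -!csn_sqr ?starM ?sa //.
  by rewrite -smulA (le_trans (csnM nrmP _ _)) // mulrC smulA.
by rewrite exprSr ler_pM2r // lt_neqAle eq_sym a0 csn_ge0.
Qed.
End CstarSeminorm.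

Section Rate.
Context {R : realType}.

(** The scale is harmonic because the square root iteration is no faster at norm 1; the shift makes
    [2 * rate 0] equal to the initial gap [1 - sqrt_eta 0]. *)
Definition rate (n : nat) : R := n.+2%:R^-1.

Lemma rate_small (C e : R) : 0 < e ->
  exists n, forall m, (n <= m)%N -> C * rate m < e.
Proof.
move=> e0; exists (Num.truncn (`|C| / e)) => m nm; rewrite ltr_pdivrMr ?ltr0n //.
apply: le_lt_trans (ler_norm _) _; rewrite -ltr_pdivrMl // mulrC.
by apply: lt_le_trans (truncnS_gt _) _; rewrite ler_nat ltnS leqW.
Qed.

Lemma rate_le m n : (n <= m)%N -> rate m <= rate n.
Proof. by move=> nm; rewrite lef_pV2 ?posrE ?ltr0n // ler_nat !ltnS. Qed.

End Rate.
Arguments rate {R} n.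

Section CstarLimits.
Context {R : realType} {U : starAlgType R} (nrm : U -> R).
Hypothesis CU : Cstar_algebra nrm.
Let cs := ca_seminorm CU.
Let sn := csn_seminorm cs.

Lemma cstar_small_eq0 (a : U) (C : R) :
  (forall n, nrm a <= C * rate n) -> a = 0.
Proof.
move=> aC; apply: (ca_definite CU); apply/le_anti.
rewrite (csn_ge0 cs) andbT; apply/ler_addgt0Pr => d d0; rewrite add0r.
have [n nd] := rate_small C d0.
exact: le_trans (aC n) (ltW (nd _ (leqnn n))).
Qed.

Lemma cstar_seq (s : nat -> U) (C : R) :
  (forall m n, (n <= m)%N -> nrm (s m - s n) <= C * rate n) ->
  exists x, forall n, nrm (x - s n) <= C * rate n.
Proof.
move=> sC.
have /(complete_famP (fun _ : unit => sn)) cP := ca_complete CU.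
have [d d0|//|x xs] := @complete_fam_seq _ _ _ _ (fun _ : unit => sn) s
   (fun n => C * rate n) cP; first exact: rate_small.
by exists x => n; exact: (xs tt).
Qed.

End CstarLimits.

Section Unital.
Context {R : realType} {U : starAlgType R} (nrm : U -> R) (e : U).
Hypothesis CU : Cstar_algebra nrm.
Hypothesis el : forall x, e ** x = x.
Hypothesis er : forall x, x ** e = x.
Let cs := ca_seminorm CU.
Let sn := csn_seminorm cs.

Lemma unit_star : star e = e.
Proof. by have := congr1 star (er (star e)); rewrite starM !starK er. Qed.

Lemma unit_norm : nrm e <= 1.
Proof.
have := csn_sqr cs unit_star; rewrite er => ee.
have := csn_ge0 cs e; nra.
Qed.

Lemma commutes_unit z : commutes z e.
Proof. by rewrite /commutes el er. Qed.

Section SqrtIteration.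
Variables (x : U) (sx : star x = x) (nx : nrm x <= 1).

(** A fixed point [y] satisfies [y + y = x + y ** y], that is [(e - y) ** (e - y) = e - x]. Each
    iterate is a polynomial in [x], hence commutes with all that commutes with [x]. *)
Fixpoint sqrt_it (n : nat) : U :=
  if n is n'.+1 then (2^-1 : R)%:C *: (x + sqrt_it n' ** sqrt_it n') else 0.

(** The same iteration at the scalar [x = 1], the worst case; it majorizes the norms and the
    increments of [sqrt_it]. *)
Fixpoint sqrt_eta (n : nat) : R :=
  if n is n'.+1 then 2^-1 * (1 + sqrt_eta n' ^+ 2) else 0.

Lemma sqrt_itS n :
  sqrt_it n.+1 = (2^-1 : R)%:C *: (x + sqrt_it n ** sqrt_it n).
Proof. by []. Qed.

Lemma sqrt_etaS n : sqrt_eta n.+1 = 2^-1 * (1 + sqrt_eta n ^+ 2).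
Proof. by []. Qed.

Lemma sqrt_it_commutes z : commutes z x -> forall n, commutes z (sqrt_it n).
Proof.
move=> zx; elim=> [|n IHn] /=; first exact: commutes0.
by apply/commutesZ/commutesD => //; exact: commutesM.
Qed.

Lemma sqrt_it_star n : star (sqrt_it n) = sqrt_it n.
Proof.
elim: n => [|n IHn] /=; first exact: star0.
by rewrite starZr starD starM IHn sx.
Qed.

Lemma sqrt_eta_ge0 n : 0 <= sqrt_eta n.
Proof. by case: n => [|n] //=; nra. Qed.

Lemma sqrt_eta_le1 n : sqrt_eta n <= 1.
Proof. by elim: n => [|n IHn] //=; have := sqrt_eta_ge0 n; nra. Qed.

(** A step sends the gap [d] to [d - d ^+ 2 / 2], which increases with [d] on [[0, 1]]; with
    [N = n + 2], the bound [d <= 2 / N] becomes [2 / N - 2 / N ^+ 2 <= 2 / (N + 1)]. *)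
Lemma sqrt_eta_rate n : 1 - sqrt_eta n <= 2 * rate n.
Proof.
elim: n => [|n IHn] /=; first by rewrite /rate subr0 divff ?pnatr_eq0.
have -> : 1 - 2^-1 * (1 + sqrt_eta n ^+ 2) =
    (1 - sqrt_eta n) - (1 - sqrt_eta n) ^+ 2 / 2 by field.
have h1 := sqrt_eta_le1 n; have h0 := sqrt_eta_ge0 n.
move: IHn; set d := 1 - sqrt_eta n => IHn.
have d1 : d <= 1 by rewrite /d; lra.
have n2 : 2 <= n.+2%:R :> R by rewrite ler_nat.
rewrite /rate in IHn *; rewrite -[n.+3]addn1 natrD; move: n2 IHn;
  set N := n.+2%:R => n2 IHn.
have Nd : N * d <= 2 by rewrite mulrC -ler_pdivlMr //; lra.
rewrite ler_pdivlMr; last lra.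
have d0 : 0 <= d by rewrite /d; lra.
have N0 : 0 < N by lra.
rewrite -(ler_pM2l N0) -(ler_pM2l N0).
have -> : N * (N * ((d - d ^+ 2 / 2) * (N + 1))) =
  (N * d) * (2 * N - N * d) / 2 * (N + 1) by field.
have h : (N * d) * (2 * N - N * d) <= 2 * (2 * N - 2).
  have : 0 <= (2 - N * d) * (2 * N - 2 - N * d) by apply: mulr_ge0; lra.
  by lra.
have : (N * d) * (2 * N - N * d) / 2 * (N + 1) <= (2 * N - 2) * (N + 1).
  by rewrite ler_wpM2r; lra.
by lra.
Qed.

Lemma sqrt_it_le n : nrm (sqrt_it n) <= sqrt_eta n.
Proof.
elim: n => [|n IHn] /=; first by rewrite (sn0 sn).
rewrite (snZr sn) ger0_norm ?invr_ge0 // ler_wpM2l ?invr_ge0 //.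
apply: le_trans (snD sn _ _) _; apply: lerD => //.
by rewrite (csn_sqr cs) ?sqrt_it_star // ler_sqr ?nnegrE ?(csn_ge0 cs) // sqrt_eta_ge0.
Qed.

(** The iterates commute, so the difference of their squares factors exactly as that of the scalars
    does. *)
Lemma sqrt_it_step n :
  nrm (sqrt_it n.+1 - sqrt_it n) <= sqrt_eta n.+1 - sqrt_eta n.
Proof.
elim: n => [|n IHn].
  by rewrite [sqrt_it 0]/= !subr0; exact: sqrt_it_le.
rewrite (sqrt_itS n.+1) [X in _ - X]sqrt_itS -scalerBr opprD addrACA subrr add0r
  sqr_sub_comm; last first.
  by apply: sqrt_it_commutes; apply/commutes_sym/sqrt_it_commutes.
rewrite (snZr sn) ger0_norm ?invr_ge0 //.
rewrite (sqrt_etaS n.+1) [X in _ <= _ - X]sqrt_etaS.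
set u := sqrt_it n.+1 in IHn *; set v := sqrt_it n in IHn *.
have uv : nrm (u + v) <= sqrt_eta n.+1 + sqrt_eta n.
  by apply: le_trans (snD sn _ _) _; rewrite lerD // sqrt_it_le.
have -> : 2^-1 * (1 + sqrt_eta n.+1 ^+ 2) - 2^-1 * (1 + sqrt_eta n ^+ 2) =
  2^-1 * ((sqrt_eta n.+1 - sqrt_eta n) * (sqrt_eta n.+1 + sqrt_eta n)) by ring.
rewrite ler_wpM2l ?invr_ge0 //; apply: le_trans (csnM cs _ _) _.
by apply: ler_pM => //; exact: csn_ge0 cs _.
Qed.

Lemma sqrt_it_cauchy m n : (n <= m)%N ->
  nrm (sqrt_it m - sqrt_it n) <= 2 * rate n.
Proof.
move=> nm; apply: le_trans (_ : sqrt_eta m - sqrt_eta n <= _); last first.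
  by apply: le_trans (sqrt_eta_rate n); rewrite lerD2r sqrt_eta_le1.
rewrite -(subnK nm); elim: (m - n)%N => [|d IHd].
  by rewrite add0n !subrr (sn0 sn).
apply: le_trans (sn_tri sn (sqrt_it (d + n)) _ _) _; rewrite addSn.
rewrite -[leRHS](subrKA (sqrt_eta (d + n))); apply: lerD IHd.
exact: sqrt_it_step.
Qed.

Lemma sqrt_one_sub : exists w, [/\ star w = w, w ** w = e - x,
  nrm (e - w) <= 1 & forall z, commutes z x -> commutes z w].
Proof.
have [y yn] := cstar_seq CU sqrt_it_cauchy.
have y1 : nrm y <= 1.
  apply/ler_addgt0Pr => d d0; have [n nd] := rate_small 2 d0.
  apply: le_trans (sn_le_sub sn y (sqrt_it n)) _; apply: lerD.
    exact: le_trans (sqrt_it_le n) (sqrt_eta_le1 n).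
  exact: le_trans (yn n) (ltW (nd _ (leqnn n))).
have ys : star y = y.
  apply/eqP; rewrite -subr_eq0; apply/eqP.
  apply: (cstar_small_eq0 CU (C := 4)) => n.
  apply: le_trans (sn_tri sn (sqrt_it n) _ _) _.
  rewrite -{1}(sqrt_it_star n) -starB (csn_star cs) [X in _ + X](sn_sym sn).
  by have := yn n; lra.
have yc z : commutes z x -> commutes z y.
  move=> zx; apply/eqP; rewrite -subr_eq0; apply/eqP.
  apply: (cstar_small_eq0 CU (C := nrm z * 2 + nrm z * 2)) => n.
  have -> : z ** y - y ** z = z ** (y - sqrt_it n) - (y - sqrt_it n) ** z.
    by rewrite smulBr smulBl (sqrt_it_commutes zx n) opprB addrA subrK.
  apply: le_trans (snB sn _ _) _; rewrite mulrDl.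
  have z0 := csn_ge0 cs z; apply: lerD; apply: le_trans (csnM cs _ _) _.
    by rewrite -mulrA ler_wpM2l.
  by rewrite mulrC -mulrA ler_wpM2l.
(* The recursion in the limit; the constant 8 collects four errors of size [2 * rate n]. *)
have yE : y + y = x + y ** y.
  apply/eqP; rewrite -subr_eq0; apply/eqP.
  apply: (cstar_small_eq0 CU (C := 8)) => n.
  have E : sqrt_it n.+1 + sqrt_it n.+1 = x + sqrt_it n ** sqrt_it n.
    by rewrite /= -scalerDr half_twice.
  have F : y ** (y - sqrt_it n) + (y - sqrt_it n) ** sqrt_it n =
      y ** y - sqrt_it n ** sqrt_it n by rewrite smulBr smulBl addrA subrK.
  have -> : y + y - (x + y ** y) = (y - sqrt_it n.+1) + (y - sqrt_it n.+1)
      - (y ** (y - sqrt_it n) + (y - sqrt_it n) ** sqrt_it n).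
    rewrite F addrACA -opprD E opprB -[RHS]addrA.
    by congr (_ + _); rewrite !opprD -addrA addKr.
  apply: le_trans (snB sn _ _) _.
  have h1 : nrm (y - sqrt_it n.+1) <= 2 * rate n.
    by apply: le_trans (yn n.+1) _; rewrite ler_pM2l // rate_le.
  have h2 := snD sn (y - sqrt_it n.+1) (y - sqrt_it n.+1).
  have h3 := snD sn (y ** (y - sqrt_it n)) ((y - sqrt_it n) ** sqrt_it n).
  have h4 : nrm (y ** (y - sqrt_it n)) <= 1 * (2 * rate n).
    by apply: le_trans (csnM cs _ _) _; apply: ler_pM => //; exact: csn_ge0 cs _.
  have h5 : nrm ((y - sqrt_it n) ** sqrt_it n) <= (2 * rate n) * 1.
    apply: le_trans (csnM cs _ _) _; apply: ler_pM => //; try exact: csn_ge0 cs _.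
    exact: le_trans (sqrt_it_le n) (sqrt_eta_le1 n).
  by move: h1 h2 h3 h4 h5; lra.
exists (e - y); split.
- by rewrite starB unit_star ys.
- rewrite smulBl !smulBr !el er opprB [y ** y - y]addrC addrA -[_ - y - y]addrA
  -opprD yE.
  by rewrite opprD addrA subrK.
- by rewrite subKr.
- by move=> z zx; apply: commutesB; [exact: commutes_unit|exact: yc].
Qed.

End SqrtIteration.
End Unital.

Section Positive.
Context {R : realType} {U : starAlgType R} (nrm : U -> R) (e : U).
Hypothesis CU : Cstar_algebra nrm.
Hypothesis el : forall x, e ** x = x.
Hypothesis er : forall x, x ** e = x.
Let cs := ca_seminorm CU.
Let sn := csn_seminorm cs.
Implicit Types a b c h k g w z : U.
Let es : star e = e := unit_star er.
Let e1 : nrm e <= 1 := unit_norm CU er.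

(* The condition says that the spectrum of [h] lies in the disc of radius [t]
   centered at [t], which for a self-adjoint [h] is positivity. *)
Definition pos (h : U) : Prop :=
  star h = h /\ exists2 t : R, 0 <= t & nrm (t%:C *: e - h) <= t.

Let nrm_eq0 a : nrm a <= 0 -> a = 0.
Proof. by move=> a0; apply: (ca_definite CU); apply/le_anti;
  rewrite a0 (csn_ge0 cs). Qed.

Let nrm_unit (r : R) : 0 <= r -> nrm (r%:C *: e) <= r.
Proof. by move=> r0; rewrite (snZr sn) ger0_norm // ler_piMr. Qed.

Let commutes_e (k : R[i]) z : commutes z (k *: e).
Proof. by apply/commutesZ/commutes_unit. Qed.

Lemma norm_double a : nrm (a + a) = 2 * nrm a.
Proof.
by rewrite -{1 2}[a]scaleC1 -scaleCD (snZr sn) -[1 + 1]/(2 : R) ger0_norm.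
Qed.

Lemma sqr_polar a b :
  (a + b) ** (a + b) - (a - b) ** (a - b) = a ** (b + b) + b ** (a + a).
Proof.
rewrite smulDl smulBl opprB [b ** (a - b) - _]addrC addrACA -smulBr -smulDr.
congr (_ ** _ + _ ** _); first by rewrite opprB [b - a]addrC addrACA subrr add0r.
by rewrite addrACA subrr addr0.
Qed.

Lemma self_adj_eq0 a : star a = a -> a ** a = 0 -> a = 0.
Proof. by move=> sa aa; apply: star_proper; rewrite sa. Qed.

Lemma pos0 : pos 0.
Proof. by split; [exact: star0|exists 0; rewrite // subr0 scaleC0 (sn0 sn)]. Qed.

Lemma posD h k : pos h -> pos k -> pos (h + k).
Proof.
move=> [sh [t t0 ht]] [sk [s s0 ks]]; split; first by rewrite starD sh sk.
exists (t + s); first exact: addr_ge0.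
rewrite scaleCD opprD addrACA; apply: le_trans (snD sn _ _) _; exact: lerD.
Qed.

Lemma posZ (r : R) h : 0 <= r -> pos h -> pos (r%:C *: h).
Proof.
move=> r0 [sh [t t0 ht]]; split; first by rewrite starZr sh.
exists (r * t); first exact: mulr_ge0.
by rewrite -scaleCA -scalerBr (snZr sn) ger0_norm // ler_wpM2l.
Qed.

Lemma pos_sub h (t : R) : star h = h -> nrm h <= t -> pos (t%:C *: e - h).
Proof.
move=> sh ht; split; first by rewrite starB starZr es sh.
exists t; first exact: le_trans (csn_ge0 cs h) ht.
by rewrite subKr.
Qed.

(** For [t > 0] write [h = t (e - x)] with [x = e - h / t] of norm at most 1, and scale the root of
    [e - x] by that of [t]. The commutation clause stands in for functional calculus. *)
Lemma pos_sqrt h : pos h -> exists k, [/\ pos k, k ** k = h &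
  forall z, commutes z h -> commutes z k].
Proof.
move=> [sh [t]]; rewrite le_eqVlt => /orP[/eqP <-|t0 ht].
  rewrite scaleC0 sub0r (snN sn) => /nrm_eq0 ->; exists 0.
  by rewrite smul0l; split=> //; exact: pos0.
have tne : t != 0 by rewrite gt_eqF.
pose x := e - t^-1%:C *: h.
have sx : star x = x by rewrite starB es starZr sh.
have nx : nrm x <= 1.
  have -> : x = t^-1%:C *: (t%:C *: e - h).
    by rewrite scalerBr scaleCA mulVf // scaleC1.
  by rewrite (snZr sn) gtr0_norm ?invr_gt0 // mulrC ler_pdivrMr // mul1r.
have [w [sw ww ew wc]] := sqrt_one_sub CU el er sx nx.
exists ((Num.sqrt t)%:C *: w); split.
- split; first by rewrite starZr sw.
  exists (Num.sqrt t); first exact: sqrtr_ge0.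
  by rewrite -scalerBr (snZr sn) ger0_norm ?sqrtr_ge0 // ler_piMr // sqrtr_ge0.
- rewrite smulZl smulZr ww scaleCA -expr2 sqr_sqrtr ?ltW // subKr.
  by rewrite scaleCA divff // scaleC1.
- move=> z zh; apply/commutesZ/wc/commutesB; first exact: commutes_unit.
  exact: commutesZ.
Qed.

(* [w + i k] is a multiple of a unitary. *)
Lemma sum_sqr_le w k (s : R) : star w = w -> star k = k -> commutes w k ->
  0 <= s -> w ** w + k ** k = s%:C *: e -> nrm w ^+ 2 <= s /\ nrm k ^+ 2 <= s.
Proof.
move=> sw sk wk s0 E; pose u := w + imag *: k.
have su : star u = w - imag *: k by rewrite starD starZi sw sk.
have us : nrm u ^+ 2 <= s.
  rewrite -(csnX cs) su; suff -> : (w - imag *: k) ** u = s%:C *: e.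
    exact: nrm_unit.
  rewrite -E /u smulDr !smulBl !(smulZl, smulZr) scalerA imag2 scaleN1r opprK.
  by rewrite wk addrA subrK.
have wu : 2 * nrm w <= 2 * nrm u.
  rewrite -norm_double; have -> : w + w = u + star u by rewrite su /u addrACA
    subrr addr0.
  by apply: le_trans (snD sn _ _) _; rewrite (csn_star cs) mulr2n mulrDl mul1r.
have ku : 2 * nrm k <= 2 * nrm u.
  rewrite -norm_double; have -> : nrm (k + k) = nrm (u - star u).
    rewrite su /u opprB [w + _]addrC addrACA subrr addr0 -scalerDr (snZ sn) normc_imag.
    by rewrite mul1r.
  by apply: le_trans (snB sn _ _) _; rewrite (csn_star cs) mulr2n mulrDl mul1r.
have := csn_ge0 cs w; have := csn_ge0 cs k; have := csn_ge0 cs u.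
by split; apply: le_trans us; rewrite ler_sqr ?nnegrE //; lra.
Qed.

(** For [t > 0] the root [w'] of [t e - k ^ 2] commutes with [k], and [w' ^ 2 + k ^ 2 = t e], so
    [sum_sqr_le] bounds [w']. *)
Lemma pos_sqr_le k (t : R) : star k = k -> nrm k ^+ 2 <= t ->
  nrm (t%:C *: e - k ** k) <= t.
Proof.
move=> sk kt; have := sqr_ge0 (nrm k) => k0.
have := le_trans k0 kt; rewrite le_eqVlt => /orP[/eqP t0|t0].
  rewrite -t0 scaleC0 sub0r (snN sn) (csn_sqr cs sk); lra.
have tne : t != 0 by rewrite gt_eqF.
have [||w [sw ww _ wc]] := @sqrt_one_sub _ _ _ _ CU el er (t^-1%:C *: (k ** k)).
- by rewrite starZr starM sk.
- rewrite (snZr sn) (csn_sqr cs sk) gtr0_norm ?invr_gt0 //.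
  by rewrite mulrC ler_pdivrMr // mul1r.
pose w' := (Num.sqrt t)%:C *: w.
have w'w' : w' ** w' = t%:C *: e - k ** k.
  rewrite smulZl smulZr ww scaleCA -expr2 sqr_sqrtr ?ltW // scalerBr.
  by rewrite scaleCA divff // scaleC1.
have sw' : star w' = w' by rewrite starZr sw.
have [] := @sum_sqr_le w' k t sw' sk.
- apply/commutes_sym/commutesZ/wc/commutesZ; exact: commutesM.
- exact: ltW.
- by rewrite w'w' subrK.
by rewrite -(csn_sqr cs sw') w'w'.
Qed.

Lemma pos_sqr k : star k = k -> pos (k ** k).
Proof.
move=> sk; split; first by rewrite starM sk.
by exists (nrm k ^+ 2); [exact: sqr_ge0|exact: pos_sqr_le].
Qed.

(** [pos] provides some radius; a square root shows that every radius above the norm will do. *)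
Lemma pos_le h (t : R) : pos h -> nrm h <= t -> nrm (t%:C *: e - h) <= t.
Proof.
move=> /pos_sqrt[k [[sk _] <- _]]; rewrite (csn_sqr cs sk); exact: pos_sqr_le.
Qed.

(** [(nrm g) e - h] is the sum of the positive elements [(nrm g) e - g] and [g - h]; its root
    commutes with that of [h], and the two squares add up to [(nrm g) e]. *)
Lemma pos_mono h g : pos h -> pos (g - h) -> nrm h <= nrm g.
Proof.
move=> ph pgh; have [sh _] := ph; have [sgh _] := pgh.
have sg : star g = g by rewrite -[g](subrK h) starD sgh sh.
have ps : pos ((nrm g)%:C *: e - h).
  by rewrite -[_ - h](subrKA g); apply: posD => //; exact: pos_sub.
have [w [[sw _] ww wc]] := pos_sqrt ps.
have [k [[sk _] kk kc]] := pos_sqrt ph.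
rewrite -kk (csn_sqr cs sk).
have [] // := @sum_sqr_le w k (nrm g) sw sk.
- apply/commutes_sym/wc/commutesB; first exact: commutes_e.
  by rewrite -kk; exact: commutesM.
- exact: csn_ge0 cs _.
- by rewrite ww kk subrK.
Qed.

Lemma pos_anti h : pos h -> pos (- h) -> h = 0.
Proof.
move=> ph pn; apply: nrm_eq0; rewrite -(sn0 sn).
by apply: pos_mono => //; rewrite sub0r.
Qed.

(** The square roots commute too, so the product is the square of a self-adjoint element. *)
Lemma pos_mul h k : pos h -> pos k -> commutes h k -> pos (h ** k).
Proof.
move=> /pos_sqrt[h' [[sh' _] <- hc]] /pos_sqrt[k' [[sk' _] kk kc]] hk.
have k'h : commutes k' (h' ** h') by apply/commutes_sym/kc.
have kh : commutes h' k'.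
  by apply: kc; apply/commutes_sym/hc; rewrite -kk; apply/commutes_sym/commutesM.
have -> : h' ** h' ** k = (h' ** k') ** (h' ** k').
  by rewrite -kk -!smulA; congr (_ ** _); rewrite !smulA kh.
by apply: pos_sqr; rewrite starM sh' sk' kh.
Qed.

(* With [m = |h|], take [g = m - h] and [j] the square root of [m]. *)
Lemma abs_split h : star h = h -> exists g j, [/\ star g = g,
  star (j ** g) = j ** g, g ** h ** g = - ((j ** g) ** (j ** g)) &
  j ** g = 0 -> pos h].
Proof.
move=> sh; have [m [pm mm mc]] := pos_sqrt (pos_sqr sh).
have [j [[sj _] jj jc]] := pos_sqrt pm; have [sm _] := pm.
have hm : commutes h m by apply: mc; exact: commutesM.
have hg : h ** (m - h) = - (m ** (m - h)).
  by rewrite !smulBr -hm mm opprB.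
have sg : star (m - h) = m - h by rewrite starB sm sh.
have gj : commutes (m - h) j.
  apply: jc; apply/commutes_sym/commutesB => //; exact/commutes_sym.
have gmg g : commutes g j -> g ** (m ** g) = (j ** g) ** (j ** g).
  by move=> gj'; rewrite -jj -(smulA j) smulA gj'.
exists (m - h), j; split=> //.
- by rewrite starM sj sg gj.
- by rewrite -smulA hg smulNr gmg.
- move=> jg; have mg : m ** (m - h) = 0 by rewrite -{1}jj -smulA jg smul0r.
  have : m - h = 0.
    by apply: self_adj_eq0 => //; rewrite smulBl mg hg mg oppr0 subr0.
  by move/subr0_eq <-.
Qed.

(** By [abs_split] it suffices that [k = j ** g] vanishes, where [d = c ** g] has
    [star d ** d = - k ^ 2]. The usual argument compares the spectra of [star d ** d] and
    [d ** star d]; here two estimates for the norm of one element [y] replace it. *)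
Lemma pos_star_mul c : pos (star c ** c).
Proof.
have sh : star (star c ** c) = star c ** c by rewrite starM starK.
have [g [j [sg sjg gh]]] := abs_split sh; apply; apply: self_adj_eq0 => //.
move: (j ** g) sjg gh => k sk gh.
pose d := c ** g; pose f := d ** star d; pose v := k ** k.
have dd : star d ** d = - v by rewrite /d starM sg smulA -(smulA g) gh.
have pv : pos v by exact: pos_sqr.
(* [d ** star d + star d ** d] is half the sum of the squares of the self-adjoint [d + star d] and
   [i (d - star d)]; adding [v = - star d ** d] gives [f]. *)
have pf : pos f.
  have E : (d + star d) ** (d + star d) +
      (imag *: (d - star d)) ** (imag *: (d - star d)) = f + f - (v + v).
    rewrite smulZl smulZr scalerA imag2 scaleN1r sqr_polar !smulDr dd -/f.
    by rewrite opprD.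
  have -> : f = (2^-1 : R)%:C *: ((f + f - (v + v)) + (v + v)).
    by rewrite subrK half_twice.
  apply: posZ; first by rewrite invr_ge0.
  apply: posD; last exact: posD.
  rewrite -E; apply: posD; apply: pos_sqr.
    by rewrite starD starK addrC.
  by rewrite starZi starB starK -scalerN opprB.
pose s := nrm d ^+ 2; have s0 : 0 <= s := sqr_ge0 _.
have fs : nrm f = s by exact: csn_sqr'.
have vs : nrm v = s by rewrite -(snN sn) -dd (csnX cs).
suff s00 : s = 0.
  by apply: nrm_eq0; rewrite -/v vs s00.
(* As [d ** v = - f ** d], also [y = (s e - f) ** d]: the first form makes [star y ** y] large, the
   second makes [y ** star y] small. *)
pose y := s%:C *: d + d ** v.
have yl : y = (s%:C *: e - f) ** d.
  by rewrite smulBl smulZl el -smulA dd smulNr opprK.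
have sf : star f = f by rewrite starM starK.
have [sv _] := pv.
have n1 : nrm y ^+ 2 <= s * (s ^+ 2 / 4).
  have sfs : nrm (s%:C *: e - f) <= s by apply: pos_le => //; rewrite fs.
  rewrite -(csn_sqr' cs) yl starM starB starZr es sf -smulA [d ** _]smulA -/f.
  apply: le_trans (csnM cs _ _) _; apply: ler_pM => //; try exact: csn_ge0 cs _.
  have ffe : commutes f (s%:C *: e - f) by apply: commutesB => //; exact: commutes_e.
  have pw : pos (s%:C *: e - f) by apply: pos_sub => //; rewrite fs.
  (* [s ^ 2 / 4] is the maximum of [u (s - u)]; its distance to [f (s - f)] is the square of
     [s / 2 - f]. *)
  have s4 : 0 <= s ^+ 2 / 4 by rewrite divr_ge0 // sqr_ge0.
  apply: le_trans (nrm_unit s4); apply: pos_mono.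
    exact: pos_mul.
  have -> : (s ^+ 2 / 4)%:C *: e - f ** (s%:C *: e - f) =
      ((s / 2)%:C *: e - f) ** ((s / 2)%:C *: e - f).
    rewrite smulBl !smulBr !(smulZl, smulZr) !el !er scaleCA.
    rewrite (_ : s / 2 * (s / 2) = s ^+ 2 / 4); last by field.
    by rewrite -[RHS]addrA -opprD addrA -scaleCD -splitr.
  by apply: pos_sqr; rewrite starB starZr es sf.
(* [- (star y ** y)] equals [s ^ 2 v + 2 s v ^ 2 + v ^ 3], which dominates [v ^ 3]; with [n1] this
   gives [s ^ 3 <= s ^ 3 / 4]. *)
have n2 : s ^+ 3 <= nrm y ^+ 2.
  have sy : star y = s%:C *: star d + v ** star d by rewrite /y starD starZr starM sv.
  have := csn_cube cs sv; rewrite vs => /le_trans; apply; rewrite -(csnX cs).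
  rewrite -[nrm (star y ** y)](snN sn); apply: pos_mono.
    by apply: pos_mul => //; [exact: pos_sqr|exact: commutesM].
  have -> : - (star y ** y) = s%:C *: (s%:C *: v) + s%:C *: (v ** v) + (s%:C *:
    (v ** v) + v ** (v ** v)).
    have dy : star d ** y = - (s%:C *: v + v ** v).
      by rewrite smulDr smulZr smulA dd smulNl scalerN opprD.
    rewrite sy smulDl smulZl -smulA dy scalerN smulNr -opprD opprK.
    by rewrite scalerDr smulDr smulZr.
  rewrite addrA addrK; apply: posD; first apply: posD.
  - by do 2!apply: posZ => //.
  - by apply: posZ => //; exact: pos_sqr.
  - by apply: posZ => //; exact: pos_sqr.
have : s ^+ 3 <= s ^+ 3 / 4 by apply: le_trans n2 (le_trans n1 _);
  rewrite le_eqVlt; apply/orP; left; apply/eqP; field.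
move=> s3; have : s ^+ 3 <= 0 by lra.
by rewrite le_eqVlt ltNge exprn_ge0 // orbF expf_eq0 => /andP[_ /eqP].
Qed.

Lemma pos_conj h c : pos h -> pos (star c ** h ** c).
Proof.
move=> /pos_sqrt[k [[sk _] <- _]].
have -> : star c ** (k ** k) ** c = star (k ** c) ** (k ** c).
  by rewrite starM sk !smulA.
exact: pos_star_mul.
Qed.

(** For commuting positive [l] and [r] with equal squares and [D = l - r], the positive elements
    [D l D] and [D r D] have sum 0, so both vanish and [D ^ 3 = 0]. *)
Lemma pos_sqrt_unique k l : pos k -> pos l -> k ** k = l ** l -> k = l.
Proof.
move=> pk pl kl; have [r [pr rr rc]] := pos_sqrt (pos_sqr (proj1 pk)).
(* [k] and [l] are each compared with the root [r] of [pos_sqrt], because [r] is known to commute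
   with both. *)
suff H m : pos m -> m ** m = r ** r -> m = r.
  by rewrite (H k) ?rr // (H l) // rr -kl.
clear l pl kl; move: m => l pl lr; have [sl _] := pl; have [sr _] := pr.
have lcr : commutes l r by apply: rc; rewrite -rr -lr; exact: commutesM.
set D := l - r; have sD : star D = D by rewrite starB sl sr.
have pD m : pos m -> commutes D m -> pos (D ** m ** D).
  by move=> pm _; have := pos_conj D pm; rewrite sD.
have Dl := pD l pl; have Dr := pD r pr.
have S0 : D ** l ** D + D ** r ** D = 0.
  rewrite -smulDl -smulDr /D -sqr_sub_comm // lr subrr; exact: smul0l.
have pDl : pos (D ** l ** D) by apply: Dl; apply/commutes_sym/commutesB.
have pDr : pos (D ** r ** D) by apply: Dr; apply/commutes_sym/commutesB.
have El : D ** l ** D = 0.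
  by apply: pos_anti => //; rewrite (addr0_eq S0).
have Er : D ** r ** D = 0 by move: S0; rewrite El add0r.
have DD : nrm D ^+ 3 <= 0.
  apply: le_trans (csn_cube cs sD) _; rewrite smulA {2}/D smulBr smulBl El Er.
  by rewrite subrr (sn0 sn).
apply/subr0_eq/nrm_eq0; move: DD.
by rewrite le_eqVlt ltNge exprn_ge0 ?(csn_ge0 cs) // orbF expf_eq0 => /andP[_ /eqP ->].
Qed.

End Positive.

(** * Operators between Hilbert modules *)

Section HilbertSeminorm.
Context {R : realType} {B : starAlgType R} (p : B -> R) {X : ipModType B}.
Hypothesis pP : Cstar_seminorm p.
Let ps := csn_seminorm pP.

(** Kept as a hypothesis for now: it is immediate for [regmod], and only that case enters the
    embedding from which [positive_cauchy_schwarz] is derived. *)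
Definition cauchy_schwarz : Prop :=
  forall x y : X, p << x, y >> <= hseminorm p x * hseminorm p y.

Lemma hs_ge0 (x : X) : 0 <= hseminorm p x.
Proof. exact: sqrtr_ge0. Qed.

Lemma hs_sqr (x : X) : hseminorm p x ^+ 2 = p << x, x >>.
Proof. by rewrite sqr_sqrtr // (csn_ge0 pP). Qed.

Lemma hs_le (x : X) (c : R) : 0 <= c ->
  p << x, x >> <= c ^+ 2 -> hseminorm p x <= c.
Proof. by move=> c0 xc; rewrite -ler_sqr ?nnegrE ?hs_ge0 // hs_sqr. Qed.

Lemma hs_act (x : X) b : hseminorm p (x <* b) <= hseminorm p x * p b.
Proof.
apply: hs_le; first by rewrite mulr_ge0 ?hs_ge0 ?(csn_ge0 pP).
rewrite ipMl ipMr exprMn hs_sqr; apply: le_trans (csnM pP _ _) _.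
rewrite (csn_star pP) mulrC expr2 mulrA ler_wpM2r ?(csn_ge0 pP) //.
exact: csnM.
Qed.

Lemma hs_seminorm : cauchy_schwarz -> seminorm (@hseminorm R B X p).
Proof.
move=> cs; split=> [x y|k x]; last first.
  rewrite /hseminorm ipZl ipZr scalerA (snZ ps) -[X in _ = X * _]ger0_norm.
    rewrite -sqrtr_sqr -sqrtrM ?sqr_ge0 //; congr (Num.sqrt (_ * _)).
    rewrite ComplexField.Normc.normcM expr2; congr (_ * _).
    by case: k => a b /=; rewrite sqrrN.
  by case: k => a b; exact: sqrtr_ge0.
apply: hs_le; first by rewrite addr_ge0 ?hs_ge0.
have -> : (hseminorm p x + hseminorm p y) ^+ 2 =
   (p << x, x >> + hseminorm p x * hseminorm p y) +
   (hseminorm p y * hseminorm p x + p << y, y >>).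
  by rewrite -!hs_sqr; ring.
rewrite ipDl !ipDr; apply: le_trans (snD ps _ _) _; apply: lerD.
  by apply: le_trans (snD ps _ _) _; rewrite lerD2l cs.
by apply: le_trans (snD ps _ _) _; rewrite lerD2r cs.
Qed.

Lemma hs_regmod (a : regmod B) : hseminorm p a = p a.
Proof. by rewrite /hseminorm /ip /= (csnX pP) sqrtr_sqr ger0_norm ?(csn_ge0 pP). Qed.

End HilbertSeminorm.
Arguments cauchy_schwarz {R B} p X.

Lemma regmod_cauchy_schwarz (R : realType) (B : starAlgType R) (p : B -> R) :
  Cstar_seminorm p -> cauchy_schwarz p (regmod B).
Proof.
move=> pP x y; rewrite !hs_regmod // -[X in X * _](csn_star pP); exact: csnM.
Qed.

Section AdjointPairs.
Context {R : realType} {B : starAlgType R}.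

(** Linearity is automatic, so operators obtained as pointwise limits or by gluing need only the
    adjoint relation. *)
Lemma is_adjoint_morphism (X Y : ipModType B) (f : X -> Y) (g : Y -> X) :
  nondegenerate Y -> is_adjoint f g -> module_morphism f.
Proof.
move=> nd fg; split=> [k x x'|x b]; apply/subr0_eq/nd => y.
  by rewrite ipBl ipDl ipZl !fg -ipZl -ipDl subrr.
by rewrite ipBl ipMl !fg ipMl subrr.
Qed.

Lemma is_adjoint_adjointable (X Y : ipModType B) (f : X -> Y) (g : Y -> X) :
  nondegenerate X -> nondegenerate Y -> is_adjoint f g -> adjointable f.
Proof.
move=> ndX ndY fg; split; first exact: is_adjoint_morphism fg.
exists g; split=> //; apply: is_adjoint_morphism (is_adjoint_sym fg) => //.
Qed.

Lemma adj_linear (X Y : ipModType B) (k : R[i]) (S T : adjop X Y) y :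
  nondegenerate X -> adj (k *: S + T) y = k^* *: adj S y + adj T y.
Proof.
move=> nd; suff /(congr1 (fun f => f y)) <- :
  (fun y => k^* *: adj S y + adj T y) = adj (k *: S + T) by [].
apply: adj_unique => // x z; rewrite /= ipDl ipZl !adjE ipDr ipZr.
by [].
Qed.

Lemma adjD (X Y : ipModType B) (S T : adjop X Y) y :
  nondegenerate X -> adj (S + T) y = adj S y + adj T y.
Proof.
move=> nd; have := adj_linear 1 S T y nd; rewrite !scale1r => ->.
by rewrite rmorph1 scale1r.
Qed.

Lemma adjN (X Y : ipModType B) (T : adjop X Y) y :
  nondegenerate X -> adj (- T) y = - adj T y.
Proof.
move=> nd; suff /(congr1 (fun f => f y)) <- :
  (fun y => - adj T y) = adj (- T) by [].
by apply: adj_unique => // x z; rewrite /= ipNl adjE ipNr.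
Qed.

Lemma adjB (X Y : ipModType B) (S T : adjop X Y) y :
  nondegenerate X -> adj (S - T) y = adj S y - adj T y.
Proof. by move=> nd; rewrite adjD // adjN. Qed.

End AdjointPairs.

(** * Completeness of the strict topology *)

Section StrictTopology.
Context {R : realType} {B : starAlgType R} {I : Type} (P : I -> B -> R).
Context {X : ipModType B}.
Hypothesis PP : forall i, Cstar_seminorm (P i).
Hypothesis Psep : forall b, (forall i, P i b = 0) -> b = 0.
Hypothesis CSX : forall i, cauchy_schwarz (P i) X.
Hypothesis Xdef : forall x : X, << x, x >> = 0 :> B -> x = 0.
Hypothesis cB : complete_fam P.
Hypothesis cX : complete_fam (fun i => @hseminorm R B X (P i)).
Let ps i := csn_seminorm (PP i).
Let xs i := hs_seminorm (PP i) (CSX i).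
Let ndX : nondegenerate X. Proof. by move=> x /(_ x)/Xdef. Qed.
Let ndB := @regmod_nondegenerate R B.

Lemma strict_seminormP j : seminorm (@strict_seminorm R B I P X j).
Proof.
case: j => [[i a] x]; rewrite /strict_seminorm /=; split=> [s t|k t].
  rewrite adjD // addrACA; apply: lerD; first exact: snD (xs i) _ _.
  exact: snD (ps i) _ _.
rewrite mulrDr; congr (_ + _); first exact: (snZ (xs i)).
have -> : adj (k *: t) x = k^* *: adj t x.
  have := adj_linear k t 0 x ndB; rewrite addr0 => ->.
  suff -> : adj (0 : adjop (regmod B) X) x = 0 by rewrite addr0.
  by have := adjB t t x ndB; rewrite !subrr.
by rewrite (snZ (ps i)); congr (_ * _); case: k => u v /=; rewrite sqrrN.
Qed.

(** A strict Cauchy filter converges pointwise, on [t a] as well as on [adj t x]; the adjoint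
    relation passes to the limit and makes it an operator. *)
Lemma strict_complete : complete_fam (@strict_seminorm R B I P X).
Proof.
move=> F FF Fc.
have Fa a : exists y : X, forall i (e : R), 0 < e ->
    F [set t : mmod X | hseminorm (P i) (t a - y) < e].
  have [i e e0|y yF] := cX (F := (fun t : mmod X => t a) @ F).
    have [s sF] := Fc (i, a, 0) e e0; exists (s a).
    apply: (@filterS _ F _ _ _ _ sF) => t /=; apply: le_lt_trans.
    by rewrite /strict_seminorm /= lerDl (csn_ge0 (PP i)).
  by exists y => i e e0; exact: yF.
have Fx x : exists b : B, forall i (e : R), 0 < e ->
    F [set t : mmod X | P i ((adj t x : B) - b) < e].
  have [i e e0|y yF] := cB (F := (fun t : mmod X => adj t x : B) @ F).
    have [s sF] := Fc (i, 0, x) e e0; exists (adj s x).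
    apply: (@filterS _ F _ _ _ _ sF) => t /=; apply: le_lt_trans.
    by rewrite /strict_seminorm /= adjB // lerDr hs_ge0.
  by exists y => i e e0; exact: yF.
have [T TF] := choice Fa; have [S SF] := choice Fx.
have TS : is_adjoint (T : regmod B -> X) (S : X -> regmod B).
  move=> a x; apply/subr0_eq/Psep => i; apply/le_anti.
  rewrite (csn_ge0 (PP i)) andbT; apply/ler_addgt0Pr => e e0; rewrite add0r.
  pose c := hseminorm (P i) x + P i a + 1.
  have x0 := @hs_ge0 _ _ (P i) X x; have a0 := csn_ge0 (PP i) a.
  have c0 : 0 < c by rewrite /c; lra.
  have [t [/= t1 t2]] := filter_ex (filterI (TF a i _ (divr_gt0 e0 c0)) (SF x i
    _ (divr_gt0 e0 c0))).
  have -> : << T a, x >> - << (a : regmod B), S x >> =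
     << (a : regmod B), (adj t x : regmod B) - S x >> - << t a - T a, x >> :> B.
    by rewrite ipBr ipBl adjE opprB [X in _ = X]addrC addrA subrK.
  apply: le_trans (snB (ps i) _ _) _.
  have h1 := regmod_cauchy_schwarz (PP i) (a : regmod B) ((adj t x : regmod B) - S x).
  have h2 := CSX i (t a - T a) x.
  rewrite !(hs_regmod (PP i)) in h1.
  have h3 : P i a * P i ((adj t x : B) - S x) <= P i a * (e / c) by rewrite
    ler_wpM2l // ltW.
  have h4 : hseminorm (P i) (t a - T a) * hseminorm (P i) x <= (e / c) *
    hseminorm (P i) x.
    by rewrite ler_wpM2r // ltW.
  have ec : e / c * c = e by rewrite divfK // gt_eqF.
  have ec0 : 0 < e / c by rewrite divr_gt0.
  apply: le_trans (lerD (le_trans h1 h3) (le_trans h2 h4)) _.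
  by rewrite -[leRHS]ec /c; nra.
pose T' : mmod X := to_adjop (is_adjoint_adjointable ndB ndX TS).
have adjT : S = adj T' := adj_unique (T := T') ndB TS.
exists T' => -[[i a] x] e e0; have e2 : 0 < e / 2 by rewrite divr_gt0.
apply: (@filterS _ F _ _ _ _ (filterI (TF a i _ e2) (SF x i _ e2))) => t [/= h1 h2].
rewrite /strict_seminorm /= adjB // -adjT [ltRHS]splitr.
exact: ltrD h1 h2.
Qed.

End StrictTopology.

Section OperatorSeminorms.
Context {R : realType} {B : starAlgType R} {I : Type} (P : I -> B -> R).
Hypothesis PP : forall i, Cstar_seminorm (P i).
Hypothesis Psep : forall b, (forall i, P i b = 0) -> b = 0.
Hypothesis cB : complete_fam P.

(* Used in place of [opnorm], whose [sup] is a junk value on unbounded sets. *)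
Record operator_seminorms {X : ipModType B} (N : I -> mmod X -> R) : Prop := {
  os_ge0 : forall i t, 0 <= N i t;
  os_le : forall i (t : mmod X) b, hseminorm (P i) (t b) <= N i t * P i b;
  os_adj : forall i (t : mmod X) x, P i (adj t x : B) <= N i t * hseminorm (P i) x;
  os_lub : forall i (t : mmod X) c, 0 <= c ->
    (forall b, hseminorm (P i) (t b) <= c * P i b) -> N i t <= c
}.

Lemma Psep0 b : (forall i, P i b <= 0) -> b = 0.
Proof. by move=> b0; apply: Psep => i; apply/le_anti; rewrite b0 (csn_ge0 (PP i)). Qed.

Section Module.
Context {X : ipModType B} (N : I -> mmod X -> R) (NP : operator_seminorms N).
Hypothesis CSX : forall i, cauchy_schwarz (P i) X.
Hypothesis Xdef : forall x : X, << x, x >> = 0 :> B -> x = 0.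
Hypothesis cX : complete_fam (fun i => @hseminorm R B X (P i)).
Let xs i := hs_seminorm (PP i) (CSX i).

Lemma os_seminorm i : seminorm (N i).
Proof.
have Nk (k : R[i]) (t : mmod X) : N i (k *: t) <= ComplexField.Normc.normc k * N i t.
  have k0 : 0 <= ComplexField.Normc.normc k by case: k => a b; exact: sqrtr_ge0.
  apply: (os_lub NP); first by rewrite mulr_ge0 ?(os_ge0 NP).
  move=> b; rewrite -[(k *: t) b]/(k *: t b) (snZ (xs i)) -mulrA ler_wpM2l //.
  exact: os_le NP _ _ _.
split=> [s t|k t].
  apply: (os_lub NP); first by rewrite addr_ge0 ?(os_ge0 NP).
  move=> b; rewrite mulrDl; apply: le_trans (snD (xs i) _ _) _.
  by apply: lerD; exact: os_le NP _ _ _.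
apply/le_anti; rewrite Nk /=.
have [->|k0] := eqVneq k 0.
  by rewrite ComplexField.Normc.normc0 mul0r (os_ge0 NP).
have n0 : 0 < ComplexField.Normc.normc k.
  rewrite lt_neqAle eq_sym; apply/andP; split.
    by apply: contraNneq k0 => /ComplexField.Normc.eq0_normc ->.
  by case: k {k0} => a b; exact: sqrtr_ge0.
have := Nk k^-1 (k *: t).
rewrite scalerA mulVf // scale1r ComplexField.Normc.normcV.
by rewrite ler_pdivlMl.
Qed.

Lemma os_separated (t : mmod X) : (forall i, N i t = 0) -> t = 0.
Proof.
move=> t0; apply: adjop_inj; apply/funext => b; apply: Xdef; apply: Psep0 => i.
rewrite -(hs_sqr (PP i)); have := os_le NP i t b; rewrite t0 mul0r => h.
by have := @hs_ge0 _ _ (P i) X (t b); nra.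
Qed.

(** The filter is also strictly Cauchy, and its strict limit is the limit for [N]: [os_lub] turns
    the pointwise bounds on [T - s] into a bound on its seminorm. *)
Lemma os_complete : complete_fam N.
Proof.
move=> F FF Fc; have [] := strict_complete PP Psep CSX Xdef cB cX (F := F).
  move=> [[i a] x] e e0; pose c := P i a + hseminorm (P i) x + 1.
  have x0 := @hs_ge0 _ _ (P i) X x; have a0 := csn_ge0 (PP i) a.
  have c0 : 0 < c by rewrite /c; lra.
  have [s sF] := Fc i _ (divr_gt0 e0 c0); exists s.
  apply: filterS sF => t /=; rewrite ltr_pdivlMr // => ts.
  rewrite /strict_seminorm /=; have h1 := os_le NP i (t - s) a.
  have h2 := os_adj NP i (t - s) x; have h3 := os_ge0 NP i (t - s).
  apply: le_lt_trans (lerD h1 h2) _; apply: le_lt_trans ts.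
  by rewrite /c; nra.
move=> T TF; exists T => i e e0; have e4 : 0 < e / 4 by rewrite divr_gt0.
have [s sF] := Fc i _ e4.
have Ts : N i (T - s) <= e / 4.
  apply: (os_lub NP); first exact: ltW.
  move=> b; apply/ler_addgt0Pr => d d0.
  have [t [/= t1 t2]] := filter_ex (filterI (TF (i, b, 0) _ d0) sF).
  change (hseminorm (P i) (T b - s b) <= e / 4 * P i b + d).
  apply: le_trans (sn_tri (xs i) (t b) _ _) _.
  rewrite addrC; apply: lerD; last first.
    rewrite (sn_sym (xs i)); apply: ltW; apply: le_lt_trans t1.
    by rewrite /strict_seminorm /= lerDl (csn_ge0 (PP i)).
  apply: le_trans (os_le NP i (t - s) b) _.
  by rewrite ler_wpM2r ?(csn_ge0 (PP i)) // ltW.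
apply: filterS sF => t /= ts; apply: le_lt_trans (sn_tri (os_seminorm i) s _ _) _.
by rewrite [X in _ + X](sn_sym (os_seminorm i)); lra.
Qed.

(** The C*-identity for operators; the harder half holds because the square of the length of [t b]
    is the value at [<< b, adj t (t b) >>]. *)
Lemma os_ip (M : I -> mult B -> R) i (t : mmod X) :
  @operator_seminorms (regmod B) M -> M i << t, t >> = N i t ^+ 2.
Proof.
move=> MP; apply/le_anti/andP; split.
  apply: (os_lub MP); first exact: sqr_ge0.
  move=> b; rewrite (hs_regmod (PP i)).
  apply: le_trans (os_adj NP i t (t b)) _.
  by rewrite expr2 -mulrA ler_wpM2l ?(os_ge0 NP) // (os_le NP).
have m0 := os_ge0 MP i << t, t >>.
rewrite -(sqr_sqrtr m0) ler_sqr ?nnegrE ?(os_ge0 NP) ?sqrtr_ge0 //.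
apply: (os_lub NP); first exact: sqrtr_ge0.
move=> b; apply: (hs_le (PP i)).
  by rewrite mulr_ge0 ?sqrtr_ge0 ?(csn_ge0 (PP i)).
rewrite exprMn sqr_sqrtr // adjE.
have h := regmod_cauchy_schwarz (PP i) b (adj t (t b)); apply: le_trans h _.
rewrite (hs_regmod (PP i)) mulrC expr2 mulrA.
rewrite ler_wpM2r ?(csn_ge0 (PP i)) //.
by have := os_le MP i << t, t >> b; rewrite (hs_regmod (PP i)).
Qed.

Lemma os_hseminorm (M : I -> mult B -> R) i (t : mmod X) :
  @operator_seminorms (regmod B) M -> hseminorm (M i) t = N i t.
Proof.
by move=> MP; rewrite /hseminorm os_ip // sqrtr_sqr ger0_norm // (os_ge0 NP).
Qed.

End Module.

Section Multipliers.
Context (M : I -> mult B -> R) (MP : @operator_seminorms (regmod B) M).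
Let CSB i := regmod_cauchy_schwarz (PP i).

Lemma os_Cstar i : Cstar_seminorm (M i).
Proof.
split=> [m n|k m|m n|m].
- exact: snD (os_seminorm MP CSB i) _ _.
- exact: snZ (os_seminorm MP CSB i) _ _.
- apply: (os_lub MP); first by rewrite mulr_ge0 ?(os_ge0 MP).
  move=> b; rewrite -mulrA; apply: le_trans (os_le MP i m (n b)) _.
  by rewrite ler_wpM2l ?(os_ge0 MP) // -(hs_regmod (PP i)) (os_le MP).
- exact: (os_ip MP).
Qed.

Lemma os_lmult i b : M i (lmult b) = P i b.
Proof.
apply/le_anti/andP; split.
  apply: (os_lub MP); first exact: csn_ge0 (PP i) _.
  by move=> c; rewrite (hs_regmod (PP i)); exact: csnM (PP i) _ _.
have [->|b0] := eqVneq (P i b) 0; first exact: os_ge0 MP _ _.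
(* Up to scaling, the norm of [lmult b] is attained at [star b]. *)
have := os_le MP i (lmult b) (star b); rewrite (hs_regmod (PP i)).
rewrite [lmult b _]/(_ ** _) (csn_sqr' (PP i)) (csn_star (PP i)) expr2.
by rewrite ler_pM2r // lt_neqAle eq_sym b0 (csn_ge0 (PP i)).
Qed.

End Multipliers.
End OperatorSeminorms.

(** * Adjointable operators are bounded *)

Section UniformBoundedness.
Context {R : realType} {B : starAlgType R} (nrm : B -> R) {X : ipModType B}.
Hypothesis CB : Cstar_algebra nrm.
Hypothesis CSX : cauchy_schwarz nrm X.
Let cs := ca_seminorm CB.
Let sn := csn_seminorm cs.
Let CSB := regmod_cauchy_schwarz cs.

(* Gliding hump: [a_(n+1) = a_n +- c_n] where [c_n] is the vector of length
   [4^-n] in the direction of [b_n]; one of the two signs makes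
   [b_n^* a_(n+1)] at least as large as [b_n^* c_n]. *)
Lemma adj_bounded (T : mmod X) : exists C : R,
  forall x, hseminorm nrm x <= 1 -> nrm (adj T x : B) <= C.
Proof.
have [//|H] := pselect (exists C : R, forall x, hseminorm nrm x <= 1 ->
  nrm (adj T x : B) <= C).
have /choice[x xP] (n : nat) : exists x : X, hseminorm nrm x <= 1 /\
    n%:R * 4 ^+ n < nrm (adj T x : B).
  have [//|H'] := pselect (exists x : X, hseminorm nrm x <= 1 /\ n%:R * 4 ^+ n <
    nrm (adj T x : B)).
  case: H; exists (n%:R * 4 ^+ n) => x x1; rewrite leNgt; apply/negP => xn.
  by apply: H'; exists x.
pose b n : B := adj T (x n).
have b0 n : 0 < nrm (b n).
  by apply: le_lt_trans (proj2 (xP n)); rewrite mulr_ge0 // exprn_ge0.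
pose q : R := 4^-1; have q0 : 0 < q by rewrite invr_gt0.
pose c n : B := (q ^+ n / nrm (b n))%:C *: b n.
have nc n : nrm (c n) = q ^+ n.
  rewrite (snZr sn) ger0_norm ?divr_ge0 ?exprn_ge0 ?(ltW q0) ?(ltW (b0 n)) //.
  by rewrite divfK // gt_eqF.
have nbc n : nrm (star (b n) ** c n) = q ^+ n * nrm (b n).
  rewrite smulZr (snZr sn) (csnX cs).
  rewrite ger0_norm ?divr_ge0 ?exprn_ge0 ?(ltW q0) ?(ltW (b0 n)) //.
  by rewrite expr2 mulrA divfK // gt_eqF.
pose fix a n : B := if n is m.+1 then
  (if q ^+ m * nrm (b m) <= nrm (star (b m) ** (a m + c m)) then a m + c m
   else a m - c m) else 0.
have a1 n : nrm (a n.+1 - a n) = q ^+ n.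
  rewrite /=; case: ifP => _; rewrite [_ + _ - _]addrC addKr ?(snN sn) nc //.
have a2 n : q ^+ n * nrm (b n) <= nrm (star (b n) ** a n.+1).
  have h := snB sn (star (b n) ** (a n + c n)) (star (b n) ** (a n - c n)).
  have E : a n + c n - (a n - c n) = c n + c n.
    by rewrite opprB [c n - _]addrC addrACA subrr add0r.
  rewrite -smulBr E smulDr -{1 2}[_ ** c n]scaleC1 -scaleCD (snZr sn) nbc in h.
  rewrite ger0_norm ?addr_ge0 // in h.
  rewrite /=; case: ifP => // /negbT; rewrite -ltNge => lt;
    rewrite -(lerD2l (q ^+ n * nrm (b n))).
  by rewrite mulrDl mul1r in h; apply: le_trans h _; rewrite lerD2r ltW.
have q1 : 0 <= q < 1 by rewrite /q; apply/andP; split; lra.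
have ac := geometric_partial (N := fun m n => nrm (a m - a n)) (C := 1) q1.
have /(complete_famP (fun _ : unit => sn)) cP := ca_complete CB.
have [|_ m n|l lP] := complete_fam_seq (fun _ : unit => sn) (s := a)
    (b := fun n => 1 / (1 - q) * q ^+ n) cP.
- by move=> e; apply: geometric_small; rewrite /q; apply/andP; split; lra.
- apply: ac => //.
  + by move=> k; rewrite subrr (sn0 sn).
  + by move=> i j k; exact: sn_tri sn _ _ _.
  + by move=> k; rewrite mul1r a1.
(* The later steps have total length [q ^+ n.+1 / (1 - q)], a third of [q ^+ n], so they cannot undo
   the hump. *)
have {lP} lP n : nrm (l - a n.+1) <= q ^+ n / 3.
  apply: le_trans (lP tt n.+1) _; rewrite exprS /q.
  have : 0 <= 4^-1 ^+ n :> R by rewrite exprn_ge0 // invr_ge0.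
  set z := _ ^+ n; have -> : 1 / (1 - 4^-1) * (4^-1 * z) = z / 3 :> R by field.
  by [].
pose Tl := hseminorm nrm (T l).
(* [star (b n) ** l] is [<< x n, T l >>], of norm at most [Tl] for every [n], while the hump keeps
   this norm above [2 n / 3]. *)
have key n : (n%:R * 2 <= Tl * 3).
  have h1 : nrm (star (b n) ** l) <= Tl.
    rewrite -[star _ ** _]/(<< (b n : regmod B), (l : regmod B) >>) adjE'.
    apply: le_trans (CSX _ _) _; rewrite ler_piMl ?hs_ge0 //.
    exact: (proj1 (xP n)).
  have h2 := sn_le_sub sn (star (b n) ** a n.+1) (star (b n) ** l).
  have h3 : nrm (star (b n) ** a n.+1 - star (b n) ** l) <= nrm (b n) * (q ^+ n / 3).
    rewrite -smulBr; apply: le_trans (csnM cs _ _) _.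
    by rewrite (csn_star cs) ler_wpM2l ?(csn_ge0 cs) // (sn_sym sn) lP.
  have h4 := a2 n.
  have h5 : n%:R <= q ^+ n * nrm (b n).
    rewrite /q exprVn ler_pdivlMl ?exprn_gt0 // mulrC ltW //.
    exact: (proj2 (xP n)).
  move: h2 h3 h4 h5; set u := nrm (b n); set v := q ^+ n.
  have -> : u * (v / 3) = v * u / 3 by ring.
  by move: h1; lra.
have := key (Num.truncn (Tl * 3)).+1; have := truncnS_gt (Tl * 3).
set N := _%:R; have : 0 <= Tl * 3 by rewrite mulr_ge0 ?hs_ge0.
by lra.
Qed.

(** The bound on [adj T] passes to [T] because [<< T b, T b >> = << b, adj T (T b) >>], where one
    factor [hseminorm nrm (T b)] cancels. *)
Lemma mmod_bounded (T : mmod X) : exists2 C : R, 0 <= C &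
  forall b, hseminorm nrm (T b) <= C * nrm b.
Proof.
have [C CT] := adj_bounded T.
have C0 : 0 <= C.
  by apply: le_trans (CT 0 _); [exact: csn_ge0 cs _|rewrite (sn0 (hs_seminorm cs CSX))].
exists C => // b.
have [->|T0] := eqVneq (hseminorm nrm (T b)) 0.
  by rewrite mulr_ge0 ?(csn_ge0 cs).
have Tp : 0 < hseminorm nrm (T b) by rewrite lt_neqAle eq_sym T0 hs_ge0.
have := CT ((hseminorm nrm (T b))^-1%:C *: T b).
rewrite (snZr (hs_seminorm cs CSX)) gtr0_norm ?invr_gt0 // mulVf // => /(_ (lexx _)).
rewrite adjopZ (snZr sn) gtr0_norm ?invr_gt0 // ler_pdivrMl // => h.
rewrite -(ler_pM2r Tp) -expr2 (hs_sqr cs) adjE -ipC (csn_star cs).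
have h2 := CSB (adj T (T b)) b; apply: le_trans h2 _; rewrite !(hs_regmod cs).
rewrite mulrAC ler_wpM2r ?(csn_ge0 cs) // mulrC; exact: h.
Qed.

(** By [mmod_bounded] the [sup] in [opnorm] is a least upper bound; the properties then follow by
    scaling and Cauchy-Schwarz. *)
Lemma opnorm_operator_seminorms :
  operator_seminorms (fun _ : unit => nrm) (fun _ => @opnorm R B (regmod B) X nrm).
Proof.
have hT (t : mmod X) : has_sup [set hseminorm nrm (t b) | b in
    [set b : regmod B | hseminorm nrm b <= 1]].
  split; first by exists (hseminorm nrm (t 0)), 0; rewrite //= (hs_regmod cs) (sn0 sn).
  have [C C0 CT] := mmod_bounded t; exists C => _ [b b1 <-].
  rewrite /= (hs_regmod cs) in b1; apply: le_trans (CT b) _.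
  by rewrite ler_piMr.
have os0 (t : mmod X) : 0 <= opnorm nrm t.
  apply: ub_le_sup; first exact: (proj2 (hT t)).
  by exists 0; rewrite ?adjop0 ?(sn0 (hs_seminorm cs CSX)) //= (hs_regmod cs) (sn0 sn).
have osl (t : mmod X) b : hseminorm nrm (t b) <= opnorm nrm t * nrm b.
  have [b0|b0] := eqVneq (nrm b) 0.
    by have [C C0 CT] := mmod_bounded t; have := CT b; rewrite b0 !mulr0.
  have bp : 0 < nrm b by rewrite lt_neqAle eq_sym b0 (csn_ge0 cs).
  rewrite mulrC -ler_pdivrMl //; apply: ub_le_sup; first exact: (proj2 (hT t)).
  exists ((nrm b)^-1%:C *: (b : regmod B)).
    by rewrite /= (hs_regmod cs) (snZr sn) gtr0_norm ?invr_gt0 // mulVf.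
  by rewrite adjopZ (snZr (hs_seminorm cs CSX)) gtr0_norm ?invr_gt0.
split=> [_ t|_ t b|_ t x|_ t c c0 ct].
- exact: os0.
- exact: osl.
- have [->|a0] := eqVneq (nrm (adj t x : B)) 0; first by rewrite mulr_ge0 ?hs_ge0.
  have ap : 0 < nrm (adj t x : B) by rewrite lt_neqAle eq_sym a0 (csn_ge0 cs).
  rewrite -(ler_pM2r ap) -expr2 -(hs_regmod cs) (hs_sqr cs) adjE'.
  apply: le_trans (CSX _ _) _; rewrite mulrC mulrAC.
  by rewrite ler_wpM2r ?hs_ge0 // (hs_regmod cs); exact: osl.
- apply: ge_sup; first exact: (proj1 (hT t)).
  move=> _ [b b1 <-]; rewrite /= (hs_regmod cs) in b1; apply: le_trans (ct b) _.
  by rewrite ler_piMr.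
Qed.

End UniformBoundedness.

Section MultiplierCstar.
Context {R : realType} {B : starAlgType R} (nrm : B -> R).
Hypothesis CB : Cstar_algebra nrm.
Let cs := ca_seminorm CB.
Let PP := fun _ : unit => cs.
Let Psep b : (forall i : unit, nrm b = 0) -> b = 0.
Proof. by move=> /(_ tt); exact: ca_definite CB b. Qed.
Let cB : complete_fam (fun _ : unit => nrm).
Proof. exact/(complete_famP (fun i => csn_seminorm (PP i)))/(ca_complete CB). Qed.
Let CSB := regmod_cauchy_schwarz cs.
Let OB := opnorm_operator_seminorms CB CSB.

Lemma mult_Cstar : Cstar_algebra (@opnorm R B (regmod B) (regmod B) nrm : mult B -> R).
Proof.
split.
- exact: (os_Cstar PP OB tt).
- move=> m m0; apply: (os_separated PP Psep OB) => //.
  by move=> x; exact: star_proper.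
- apply/(complete_famP (fun i => os_seminorm PP OB (fun=> CSB) i)).
  apply: (os_complete PP Psep cB OB (fun=> CSB)); first by move=> x; exact: star_proper.
  move=> F FF Fc; have [|x xF] := cB (F := F).
    move=> i e e0; have [x xF] := Fc i e e0; exists x; apply: filterS xF => y /=.
    by rewrite (hs_regmod cs).
  by exists x => i e e0; apply: filterS (xF i e e0) => y /=; rewrite (hs_regmod cs).
Qed.

Lemma mult_lmult_norm b : opnorm nrm (lmult b) = nrm b.
Proof. exact: (os_lmult PP OB tt b). Qed.

Lemma lmult_morphism : star_morphism (@lmult R B).
Proof.
split=> [k a b|a b|a]; apply: adjop_inj.
- apply/funext => c; change ((k *: a + b) ** c = k *: (a ** c) + b ** c).
  by rewrite smulDl smulZl.
- by apply/funext => c; rewrite /= smulA.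
- apply: adj_unique; first exact: regmod_nondegenerate.
  by move=> x y; rewrite /ip /= starM smulA.
Qed.

Lemma id_adjointable : adjointable (fun b : regmod B => b).
Proof. by split=> //; exists id. Qed.

Definition mult_one : mult B := to_adjop id_adjointable.

Lemma mult_mul1 (m : mult B) : mult_one ** m = m.
Proof. exact: adjop_inj. Qed.

Lemma mult_1mul (m : mult B) : m ** mult_one = m.
Proof. exact: adjop_inj. Qed.

End MultiplierCstar.

(** * Quotients and completions *)

Section QuotientCstar.
Context {R : realType} {B : starAlgType R} (p : csemi B).

Lemma qnorm_Cstar : Cstar_seminorm (@qnorm R B p).
Proof.
split=> [u v|k u|u v|u]; rewrite -(qreprK u).
- rewrite -(qreprK v) -qpiD !qnorm_qpi; exact: csnD (csemiP p) _ _.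
- rewrite -qpiZ !qnorm_qpi; exact: csnZ (csemiP p) _ _.
- rewrite -(qreprK v) -[_ ** _]qpiM !qnorm_qpi; exact: csnM (csemiP p) _ _.
- rewrite -[X in _ (X ** _)]qpi_star -[_ ** _]qpiM !qnorm_qpi.
  exact: csnX (csemiP p) _.
Qed.

Lemma qnorm_definite (u : qalg p) : qnorm u = 0 -> u = 0.
Proof. by rewrite -(qreprK u) qnorm_qpi => /qpi_eq0. Qed.

Lemma qpiB a b : qpi p (a - b) = qpi p a - qpi p b.
Proof. by rewrite qpiD -scaleN1r qpiZ scaleN1r. Qed.

Lemma qnorm_complete : complete_fam (fun _ : unit => p : B -> R) ->
  complete_fam (fun _ : unit => @qnorm R B p).
Proof.
apply: complete_fam_surj; first exact: qpi_surj.
by move=> _ x y; rewrite -qpiB qnorm_qpi.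
Qed.

Lemma qalg_Cstar : complete_fam (fun _ : unit => p : B -> R) ->
  Cstar_algebra (@qnorm R B p).
Proof.
move=> pc; split; [exact: qnorm_Cstar|exact: qnorm_definite|].
apply/(complete_famP (fun=> csn_seminorm qnorm_Cstar)).
exact: qnorm_complete.
Qed.

End QuotientCstar.

(** * Completion for one C*-seminorm *)

Section CauchySequences.
Context {R : realType} {A : starAlgType R} (p : csemi A).
Let pP := csemiP p.
Let ps := csn_seminorm pP.

Definition is_cauchy (s : nat -> A) : Prop := forall e : R, 0 < e ->
  exists N, forall m n, (N <= m)%N -> (N <= n)%N -> p (s m - s n) < e.

Definition is_cauchy_pred : {pred nat -> A} := fun s => `[< is_cauchy s >].

Lemma is_cauchyZ k s : is_cauchy s -> is_cauchy (fun n => k *: s n).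
Proof.
move=> sc e e0; pose c := ComplexField.Normc.normc k.
have c0 : 0 <= c by rewrite /c; case: k @c => u v; exact: sqrtr_ge0.
have c1 : 0 < c + 1 by lra.
have [N NP] := sc _ (divr_gt0 e0 c1); exists N => m n Nm Nn.
rewrite -scalerBr (snZ ps) -/c; have := NP m n Nm Nn.
rewrite ltr_pdivlMr // => h; apply: le_lt_trans h; rewrite mulrC.
by rewrite ler_wpM2l ?(csn_ge0 pP) //; lra.
Qed.

Lemma is_cauchyD s t : is_cauchy s -> is_cauchy t -> is_cauchy (fun n => s n + t n).
Proof.
move=> sc tc e e0; have e2 : 0 < e / 2 by rewrite divr_gt0.
have [N NP] := sc _ e2; have [M MP] := tc _ e2.
exists (maxn N M) => m n; rewrite !geq_max => /andP[Nm Mm] /andP[Nn Mn].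
rewrite opprD addrACA; apply: le_lt_trans (snD ps _ _) _.
by rewrite [ltRHS]splitr ltrD ?NP ?MP.
Qed.

Lemma is_cauchy_bounded s : is_cauchy s ->
  exists C, 0 < C /\ exists N, forall n, (N <= n)%N -> p (s n) <= C.
Proof.
move=> sc; have [N NP] := sc 1 ltr01.
exists (p (s N) + 1); split; first by have := csn_ge0 pP (s N); lra.
exists N => n Nn; apply: le_trans (sn_le_sub ps _ (s N)) _.
by rewrite lerD2l ltW // NP.
Qed.

Lemma is_cauchyM s t : is_cauchy s -> is_cauchy t -> is_cauchy (fun n => s n ** t n).
Proof.
move=> sc tc e e0.
have [C [C0 [N NP]]] := is_cauchy_bounded sc.
have [D [D0 [M MP]]] := is_cauchy_bounded tc.
have eC : 0 < e / 2 / C by rewrite !divr_gt0.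
have eD : 0 < e / 2 / D by rewrite !divr_gt0.
have [N' NP'] := sc _ eD; have [M' MP'] := tc _ eC.
exists (maxn (maxn N M) (maxn N' M')) => m n; rewrite !geq_max.
move=> /andP[/andP[Nm Mm] /andP[Nm' Mm']] /andP[/andP[Nn Mn] /andP[Nn' Mn']].
have -> : s m ** t m - s n ** t n = (s m - s n) ** t m + s n ** (t m - t n).
  by rewrite smulBl smulBr addrA subrK.
apply: le_lt_trans (snD ps _ _) _; rewrite [ltRHS]splitr; apply: ltr_leD.
  apply: le_lt_trans (csnM pP _ _) _.
  apply: le_lt_trans (_ : p (s m - s n) * D < _).
    by rewrite ler_wpM2l ?(csn_ge0 pP) // MP.
  by rewrite -ltr_pdivlMr // NP'.
apply: le_trans (csnM pP _ _) _.
apply: le_trans (_ : C * p (t m - t n) <= _).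
  by rewrite ler_wpM2r ?(csn_ge0 pP) // NP.
by rewrite mulrC -ler_pdivlMr // ltW // MP'.
Qed.

Lemma is_cauchy_star s : is_cauchy s -> is_cauchy (fun n => star (s n)).
Proof.
move=> sc e e0; have [N NP] := sc _ e0; exists N => m n Nm Nn.
by rewrite -starB csemi_star NP.
Qed.

Lemma is_cauchy_cst a : is_cauchy (fun=> a).
Proof. by move=> e e0; exists 0%N => m n _ _; rewrite subrr csemi0. Qed.

Fact is_cauchy_submod : submod_closed is_cauchy_pred.
Proof.
split=> [|k s t /asboolP sc /asboolP tc]; apply/asboolP.
  exact: (is_cauchy_cst 0).
exact: is_cauchyD (is_cauchyZ k sc) tc.
Qed.

HB.instance Definition _ :=
  GRing.isSubmodClosed.Build _ _ is_cauchy_pred is_cauchy_submod.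

(** The completion comes in two stages: the Cauchy sequences with termwise operations, where
    properness of the involution holds termwise, and then [qalg], which divides by the null
    sequences. *)
Record cauchy_seq := CauchySeq { cseq :> nat -> A; cseqP : cseq \in is_cauchy_pred }.

HB.instance Definition _ := [isSub for cseq].
HB.instance Definition _ := [Choice of cauchy_seq by <:].
HB.instance Definition _ := [SubChoice_isSubLmodule of cauchy_seq by <:].

Lemma cseq_cauchy (s : cauchy_seq) : is_cauchy s.
Proof. exact/asboolP/cseqP. Qed.

Lemma cseq_eq (s t : cauchy_seq) : (forall n, s n = t n) -> s = t.
Proof. by move=> st; apply: val_inj; apply/funext. Qed.

Definition cauchy_mul (s t : cauchy_seq) : cauchy_seq :=
  CauchySeq (asboolT (is_cauchyM (cseq_cauchy s) (cseq_cauchy t))).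
Definition cauchy_star (s : cauchy_seq) : cauchy_seq :=
  CauchySeq (asboolT (is_cauchy_star (cseq_cauchy s))).
Definition cauchy_cst (a : A) : cauchy_seq :=
  CauchySeq (asboolT (is_cauchy_cst a)).

Fact cauchy_mulA : associative cauchy_mul.
Proof. by move=> s t u; apply: cseq_eq => n; exact: smulA. Qed.
Fact cauchy_mulDl : left_distributive cauchy_mul +%R.
Proof. by move=> s t u; apply: cseq_eq => n; exact: smulDl. Qed.
Fact cauchy_mulDr : right_distributive cauchy_mul +%R.
Proof. by move=> s t u; apply: cseq_eq => n; exact: smulDr. Qed.
Fact cauchy_mulZl (k : R[i]) s t : cauchy_mul (k *: s) t = k *: cauchy_mul s t.
Proof. by apply: cseq_eq => n; exact: smulZl. Qed.
Fact cauchy_mulZr (k : R[i]) s t : cauchy_mul s (k *: t) = k *: cauchy_mul s t.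
Proof. by apply: cseq_eq => n; exact: smulZr. Qed.
Fact cauchy_starK : involutive cauchy_star.
Proof. by move=> s; apply: cseq_eq => n; exact: starK. Qed.
Fact cauchy_starD : {morph cauchy_star : s t / s + t}.
Proof. by move=> s t; apply: cseq_eq => n; exact: starD. Qed.
Fact cauchy_starZ (k : R[i]) s : cauchy_star (k *: s) = k^* *: cauchy_star s.
Proof. by apply: cseq_eq => n; exact: starZ. Qed.
Fact cauchy_starM s t :
  cauchy_star (cauchy_mul s t) = cauchy_mul (cauchy_star t) (cauchy_star s).
Proof. by apply: cseq_eq => n; exact: starM. Qed.
Fact cauchy_proper s : cauchy_mul (cauchy_star s) s = 0 -> s = 0.
Proof.
move=> s0; apply: cseq_eq => n; apply: star_proper.
exact: (congr1 (fun t : cauchy_seq => t n) s0).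
Qed.

HB.instance Definition _ := isStarAlgebra.Build R cauchy_seq
  cauchy_mulA cauchy_mulDl cauchy_mulDr cauchy_mulZl cauchy_mulZr
  cauchy_starK cauchy_starD cauchy_starZ cauchy_starM cauchy_proper.

Lemma cauchy_norm_cvg (s : cauchy_seq) : cvg (p (s n) @[n --> \oo]).
Proof.
apply/cauchy_cvgP/cauchy_exP => e e0.
have [N NP] := cseq_cauchy s e0; exists (p (s N)); exists N => // n /= Nn.
have h1 := sn_le_sub ps (s n) (s N); have h2 := sn_le_sub ps (s N) (s n).
have h3 := NP n N Nn (leqnn _); have h4 := NP N n (leqnn _) Nn.
by rewrite /ball /= ltr_norml; apply/andP; split; lra.
Qed.

Definition cauchy_norm (s : cauchy_seq) : R := lim (p (s n) @[n --> \oo]).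

Lemma cauchy_norm_le (s : cauchy_seq) (r : R) :
  (exists N, forall n, (N <= n)%N -> p (s n) <= r) -> cauchy_norm s <= r.
Proof.
by move=> [N Nr]; apply: limr_le; [exact: cauchy_norm_cvg|exists N].
Qed.

Lemma cauchy_norm_cst a : cauchy_norm (cauchy_cst a) = p a.
Proof. apply: (@cvg_lim R (@Rhausdorff R)); exact: (cvg_cst (p a)). Qed.

Lemma cauchy_normP : Cstar_seminorm cauchy_norm.
Proof.
have cv := cauchy_norm_cvg.
split=> [s t|k s|s t|s].
- rewrite /cauchy_norm -limD //; apply: ler_lim; first exact: cv (s + t).
    exact: is_cvgD.
  by near=> n; exact: csnD.
- apply: (@cvg_lim R (@Rhausdorff R)).
  have -> : (fun n => p ((k *: s : cauchy_seq) n)) =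
      (fun=> ComplexField.Normc.normc k) \* (fun n => p (s n)).
    by apply/funext => n; exact: (csnZ pP).
  apply: cvgM (cv s); exact: cvg_cst.
- rewrite /cauchy_norm -limM //; apply: ler_lim; first exact: cv (s ** t).
    exact: is_cvgM.
  by near=> n; exact: csnM.
- rewrite /cauchy_norm expr2 -limM //.
  congr (limn _); apply/funext => n.
  by rewrite [LHS](csnX pP) expr2.
Unshelve. all: by end_near. Qed.

Definition cauchy_csemi : csemi cauchy_seq := CSemi cauchy_normP.

(** Each [s n] is within [2^-n] of one of its own entries, seen as a constant sequence; the sequence
    of these entries is the limit. *)
Lemma cauchy_complete : complete_fam (fun _ : unit => cauchy_norm).
Proof.
have cs := csn_seminorm cauchy_normP.
apply: (complete_fam1P cs) => s sP.
have h0 n : 0 < 2^-1 ^+ n :> R by rewrite exprn_gt0 // invr_gt0.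
have half_anti m n : (n <= m)%N -> 2^-1 ^+ m <= 2^-1 ^+ n :> R.
  by move=> nm; apply: ler_wiXn2l nm; lra.
have /choice[k kP] (n : nat) : exists k, cauchy_norm (s n - cauchy_cst (s n k))
  <= 2^-1 ^+ n.
  have [N NP] := cseq_cauchy (s n) (h0 n); exists N; apply: cauchy_norm_le.
  by exists N => m Nm; apply/ltW/NP.
pose a n := s n (k n).
(* Passing through [s m] and [s n] costs [2^-m + 2 * 2^-n + 2^-n]. *)
have aa m n : (n <= m)%N -> p (a m - a n) <= 4 * 2^-1 ^+ n.
  move=> nm; have -> : p (a m - a n) = cauchy_norm (cauchy_cst (a m) -
    cauchy_cst (a n)).
    by rewrite -(cauchy_norm_cst (a m - a n)); congr cauchy_norm; exact: cseq_eq.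
  apply: le_trans (sn_tri cs (s m) _ _) _; rewrite (sn_sym cs).
  have h := le_trans (sn_tri cs (s n) (s m) (cauchy_cst (a n))) (lerD (sP m n
    nm) (kP n)).
  apply: le_trans (lerD (kP m) h) _.
  by move: (half_anti m n nm); clear; set u := _ ^+ m; set v := _ ^+ n; lra.
have half2 : 0 <= (2^-1 : R) <= 2^-1 by rewrite invr_ge0 lexx ler0n.
have ac : is_cauchy a.
  move=> e e0; have [N NP] := geometric_small 8 half2 e0; exists N => m n Nm Nn.
  apply: le_lt_trans (sn_tri ps (a N) _ _) _; rewrite [X in _ + X](sn_sym ps).
  by have := NP N (leqnn _); have := aa m N Nm; have := aa n N Nn; lra.
exists (CauchySeq (asboolT ac)) => e e0.
have [N NP] := geometric_small 8 half2 e0; exists N => n Nn.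
apply: le_lt_trans (sn_tri cs (cauchy_cst (a n)) _ _) _.
have h1 : cauchy_norm (cauchy_cst (a n) - CauchySeq (asboolT ac)) <= 4 * 2^-1 ^+ n.
  apply: cauchy_norm_le; exists n => m nm.
  by rewrite -[X in p X]/(a n - a m) (sn_sym ps); exact: aa.
have := NP n Nn; have := kP n; rewrite -/(a n); have := h0 n.
by move: h1; lra.
Qed.

End CauchySequences.

(** The multiplier algebra adjoins a unit, left multiplication being isometric on the completed
    quotient. Every inequality between norms of images in [U] is then one between values of [p]. *)
Lemma Cstar_embedding (R : realType) (A : starAlgType R) (p : A -> R) :
  Cstar_seminorm p ->
  exists (U : starAlgType R) (nrm : U -> R) (e : U) (phi : A -> U),
  [/\ Cstar_algebra nrm, forall x, e ** x = x, forall x, x ** e = x,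
      star_morphism phi & forall a, nrm (phi a) = p a].
Proof.
move=> pP; pose q := CSemi pP; pose P := cauchy_csemi q.
have CB := qalg_Cstar (@cauchy_complete R A q : complete_fam (fun _ : unit => P
  : _ -> R)).
exists (mult (qalg P)), (@opnorm R _ (regmod _) (regmod _) (@qnorm R _ P)).
exists (@mult_one R (qalg P)), (fun a => lmult (qpi P (cauchy_cst q a))); split.
- exact: mult_Cstar.
- exact: mult_mul1.
- exact: mult_1mul.
- have cM : star_morphism (fun a => cauchy_cst q a).
    by split=> [k a b|a b|a]; exact: cseq_eq.
  have lM := @lmult_morphism R (qalg P).
  have qM := qpi_morphism P.
  split=> [k a b|a b|a].
  + by rewrite (sm_linear cM) (sm_linear qM) (sm_linear lM).
  + by rewrite (sm_mul cM) (sm_mul qM) (sm_mul lM).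
  + by rewrite (sm_star cM) (sm_star qM) (sm_star lM).
- by move=> a; rewrite (mult_lmult_norm CB) qnorm_qpi; exact: (cauchy_norm_cst q).
Qed.

(** * Sums of squares for a C*-seminorm *)

Section LinearMaps.
Context {R : realType} {V W : lmodType R[i]} (f : V -> W) (fL : linear f).

Lemma linear_mapD x y : f (x + y) = f x + f y.
Proof. by have := fL 1 x y; rewrite !scale1r. Qed.

Lemma linear_map0 : f 0 = 0.
Proof. by apply: (addrI (f 0)); rewrite -linear_mapD !addr0. Qed.

Lemma linear_mapZ k x : f (k *: x) = k *: f x.
Proof. by have := fL k x 0; rewrite linear_map0 !addr0. Qed.

Lemma linear_mapB x y : f (x - y) = f x - f y.
Proof. by rewrite linear_mapD -scaleN1r linear_mapZ scaleN1r. Qed.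

End LinearMaps.

Section SumsOfSquares.
Context {R : realType} {A : starAlgType R}.

(** Positivity within [A], where no square roots are at hand: stable under sums by form, and mapped
    to [pos] elements by [Cstar_embedding]. *)
Definition sum_squares (h : A) : Prop :=
  exists s : seq A, h = \sum_(c <- s) star c ** c.

Lemma sum_squares1 (c : A) : sum_squares (star c ** c).
Proof. by exists [:: c]; rewrite big_seq1. Qed.

Lemma sum_squaresZ (r : R) h : 0 <= r -> sum_squares h -> sum_squares (r%:C *: h).
Proof.
move=> r0 [s ->]; exists [seq (Num.sqrt r)%:C *: c | c <- s].
rewrite big_map scaler_sumr; apply: eq_bigr => c _.
by rewrite starZr smulZl smulZr scaleCA -expr2 sqr_sqrtr.
Qed.

Lemma sum_squares_star h : sum_squares h -> star h = h.
Proof.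
move=> [s ->]; elim: s => [|c s IHs]; first by rewrite big_nil star0.
by rewrite big_cons starD IHs starM starK.
Qed.

Variables (p : A -> R) (pP : Cstar_seminorm p).
Let ps := csn_seminorm pP.

(** The factor [s - h] lives in the unital [U], where [pos_le] bounds it by [s]. *)
Lemma sum_squares_subl h z (s : R) : sum_squares h -> p h <= s ->
  p (s%:C *: z - h ** z) <= s * p z.
Proof.
move=> [c hc] hs; have [U [nrm [e [phi [CU el er phiM phin]]]]] := Cstar_embedding pP.
have pz := linear_map0 (sm_linear phiM); have pD := linear_mapD (sm_linear phiM).
have pZ := linear_mapZ (sm_linear phiM).
have ph : pos nrm e (phi h).
  rewrite hc; elim: c {hc} => [|c s' IHs].
    by rewrite big_nil pz; exact: pos0.
  rewrite big_cons pD (sm_mul phiM) (sm_star phiM); apply: posD => //.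
  exact: pos_star_mul.
rewrite -!phin pD pZ -scaleN1r pZ scaleN1r (sm_mul phiM).
have -> : s%:C *: phi z - phi h ** phi z = (s%:C *: e - phi h) ** phi z.
  by rewrite smulBl smulZl el.
apply: le_trans (csnM (ca_seminorm CU) _ _) _.
rewrite ler_wpM2r ?(csn_ge0 (ca_seminorm CU)) //.
by apply: (pos_le CU el er) => //; rewrite phin.
Qed.

Lemma sum_squares_subr h z (s : R) : sum_squares h -> p h <= s ->
  p (s%:C *: z - z ** h) <= s * p z.
Proof.
move=> hP hs; rewrite -(csn_star pP) -(csn_star pP z) starB starZr starM.
by rewrite (sum_squares_star hP); exact: sum_squares_subl.
Qed.

(** That is, [(1 + h)^-1] is a contraction: [(1 + p h) z] is the sum of [z + z h] and
    [(p h) z - z h], the latter of size at most [p h * p z]. *)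
Lemma le_norm_addr h z : sum_squares h -> p z <= p (z + z ** h).
Proof.
move=> hP; have p0 := csn_ge0 pP h.
have := sum_squares_subr z hP (lexx _).
have := snD ps (z + z ** h) ((p h)%:C *: z - z ** h).
rewrite addrACA subrr addr0 -{1}[z]scaleC1 -scaleCD (snZr ps).
by rewrite ger0_norm; [lra|rewrite addr_ge0].
Qed.

Lemma le_norm_addl h z : sum_squares h -> p z <= p (z + h ** z).
Proof.
move=> hP; rewrite -(csn_star pP) -(csn_star pP (z + _)) starD starM.
by rewrite (sum_squares_star hP); exact: le_norm_addr.
Qed.

Lemma sum_squares_mono h k : sum_squares h -> sum_squares k -> p h <= p (h + k).
Proof.
move=> [c hc] [d kd]; have [U [nrm [e [phi [CU el er phiM phin]]]]] :=
  Cstar_embedding pP.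
have pz := linear_map0 (sm_linear phiM); have pD := linear_mapD (sm_linear phiM).
have ph s : pos nrm e (phi (\sum_(c <- s) star c ** c)).
  elim: s => [|x s IHs]; first by rewrite big_nil pz; exact: pos0.
  rewrite big_cons pD (sm_mul phiM) (sm_star phiM); apply: posD => //.
  exact: pos_star_mul.
rewrite -!phin pD; apply: (pos_mono CU el er); first by rewrite hc.
by rewrite addrC addKr kd.
Qed.

(* [z = 1 - (1 + k)^-1]. *)
Lemma resolvent_norm_le2 k z : sum_squares k -> z + k ** z = k -> p z <= 2.
Proof.
move=> kP zk.
have h w : p (z ** w) <= 2 * p w.
  have v : w - z ** w + k ** (w - z ** w) = w.
    rewrite smulBr smulA addrACA -opprD -smulDl zk.
    by rewrite addrK.
  have h1 := le_norm_addl (w - z ** w) kP; rewrite v in h1.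
  have := snB ps w (w - z ** w); rewrite subKr; lra.
(* Multiplication by [z] has norm at most 2; the C*-identity at [star z] turns this into a bound on
   [z] itself. *)
have := h (star z); rewrite (csn_sqr' pP) (csn_star pP).
have := csn_ge0 pP z; nra.
Qed.

Section Module.
Context {X : ipModType A}.
Hypothesis Xpos : forall x : X, is_positive << x, x >>.

Lemma ip_sum_squares (x : X) : sum_squares << x, x >>.
Proof. by have [c ->] := Xpos x; exact: sum_squares1. Qed.

(** For [a = << x, y >>], [s > p << x, x >>] and [b = a / s], expanding the square of [y - x b]
    shows that [<< y, y >> - star a ** a / s] is positive in [U]; then [s] decreases to
    [p << x, x >>]. *)
Lemma positive_cauchy_schwarz : cauchy_schwarz p X.
Proof.
move=> x y; have [U [nrm [e [phi [CU el er phiM phin]]]]] := Cstar_embedding pP.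
have pz := linear_map0 (sm_linear phiM); have pD := linear_mapD (sm_linear phiM).
have pZ := linear_mapZ (sm_linear phiM).
have pip (w : X) : pos nrm e (phi << w, w >>).
  have [c ->] := Xpos w; rewrite (sm_mul phiM) (sm_star phiM); exact: pos_star_mul.
have key (s : R) : p << x, x >> < s -> p << x, y >> ^+ 2 <= s * p << y, y >>.
  move=> xs; have s0 : 0 < s by apply: le_lt_trans xs; exact: csn_ge0 pP _.
  set a : A := << x, y >>; pose b := s^-1%:C *: a; pose w := y - x <* b.
  pose c := s^-1%:C *: (star a ** a).
  have E1 : star b ** a = c by rewrite starZr smulZl.
  have E2 : star a ** b = c by rewrite smulZr.
  have E3 : star b ** b = s^-1%:C *: c by rewrite /b smulZr -/b E1.
  have E : << w, w >> = << y, y >> - c - (c - star b ** << x, x >> ** b) :> A.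
    rewrite /w ipBl !ipBr !ipMl !ipMr -/a -(ipC x y) -/a E1 E2.
    by rewrite smulA.
  have Ey : phi << y, y >> - phi c = phi << w, w >> +
      star (phi b) ** (s%:C *: e - phi << x, x >>) ** phi b.
    rewrite smulBr smulZr er smulBl smulZl -(sm_star phiM) -!(sm_mul phiM) E3.
    rewrite (pZ s^-1%:C c) scaleCA divff ?gt_eqF // scaleC1 E.
    by rewrite !(linear_mapB (sm_linear phiM)) subrK.
  have : nrm (phi c) <= nrm (phi << y, y >>).
    apply: (pos_mono CU el er).
      rewrite pZ (sm_mul phiM) (sm_star phiM); apply: (posZ CU) => //.
        by rewrite invr_ge0 ltW.
      exact: pos_star_mul.
    rewrite Ey; apply: (posD CU) => //; apply: (pos_conj CU el er).
    apply: (pos_sub CU er); last by rewrite phin ltW.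
    by rewrite -(sm_star phiM) ipC.
  rewrite !phin (snZr ps) (csnX pP) ger0_norm ?invr_ge0 ?(ltW s0) //.
  by rewrite ler_pdivrMl.
rewrite -ler_sqr ?nnegrE ?mulr_ge0 ?hs_ge0 ?(csn_ge0 pP) // exprMn !(hs_sqr pP).
apply/ler_addgt0Pr => d d0; have y0 := csn_ge0 pP << y, y >>.
have y1 : 0 < p << y, y >> + 1 by lra.
(* Multiplied by [p << y, y >>], the excess over [p << x, x >>] contributes at most [d]; the 1
   avoids a division by 0. *)
have := key (p << x, x >> + d / (p << y, y >> + 1)).
rewrite ltrDl divr_gt0 // => /(_ isT) h; apply: le_trans h _.
rewrite mulrDl lerD2l mulrAC ler_pdivrMr //.
by rewrite ler_wpM2l ?(ltW d0) //; lra.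
Qed.

(** The submodule generated by [x] is isometric to the one generated by [d] in [A], so the
    inequalities for [A] carry over. *)
Lemma hs_scale_act (k : R[i]) (x : X) (h d : A) : << x, x >> = star d ** d ->
  hseminorm p (k *: x + x <* h) = p (k *: d + d ** h).
Proof.
move=> xd; rewrite /hseminorm.
suff -> : << k *: x + x <* h, k *: x + x <* h >> =
    star (k *: d + d ** h) ** (k *: d + d ** h).
  by rewrite (csnX pP) sqrtr_sqr ger0_norm ?(csn_ge0 pP).
rewrite ipDl !ipDr !ipZl !ipMl !ipZr !ipMr xd starD starZ starM.
rewrite smulDl !smulDr !smulZl !smulZr !smulA.
by rewrite -!smulA.
Qed.

Lemma hs_sub_act (x : X) h (s : R) : sum_squares h -> p h <= s ->
  hseminorm p (s%:C *: x - x <* h) <= s * hseminorm p x.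
Proof.
move=> hP hs; have [d xd] := Xpos x.
rewrite -actNr (hs_scale_act _ _ xd) smulNr.
have := hs_scale_act 1 0 xd; rewrite !scale1r smul0r addr0.
have -> : x <* (0 : A) = 0 by have := actZr 0 x (0 : A); rewrite !scale0r.
by rewrite addr0 => ->; exact: sum_squares_subr.
Qed.

Lemma hs_le_add_act (x : X) h : sum_squares h ->
  hseminorm p x <= hseminorm p (x + x <* h).
Proof.
move=> hP; have [d xd] := Xpos x.
have := hs_scale_act 1 h xd; rewrite !scale1r => ->.
have := hs_scale_act 1 0 xd; rewrite !scale1r smul0r addr0.
have -> : x <* (0 : A) = 0 by have := actZr 0 x (0 : A); rewrite !scale0r.
by rewrite addr0 => ->; exact: le_norm_addr.
Qed.

(** With [k = l << x, x >>], the element [l << y, x >>] solves the equation of [resolvent_norm_le2];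
    it equals [l (<< y, y >> + << y, y >> k)], which dominates [l << y, y >>]. *)
Lemma resolvent_bound (x y : X) (l : R) : 0 < l ->
  y + l%:C *: (y <* << x, x >>) = x -> l * hseminorm p y ^+ 2 <= 2.
Proof.
move=> l0 yx; rewrite (hs_sqr pP).
pose k : A := l%:C *: << x, x >>.
have kP : sum_squares k by apply: sum_squaresZ; [exact: ltW|exact: ip_sum_squares].
have {}yx : y + y <* k = x by rewrite actZr.
have zk : l%:C *: << y, x >> + k ** (l%:C *: << y, x >>) = k.
  rewrite smulZr -scalerDr /k; congr (_ *: _); rewrite -/k -[in RHS]yx.
  by rewrite [in RHS]ipDl ipMl (sum_squares_star kP) yx.
have := resolvent_norm_le2 kP zk; apply: le_trans.
have E : << y, x >> = << y, y >> + << y, y >> ** k by rewrite -{1}yx ipDr ipMr.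
rewrite (snZr ps) gtr0_norm // ler_pM2l // E; exact: le_norm_addr.
Qed.

End Module.

(** [v b = b - z b] is [(1 + h)^-1 b], and the sum [r] of the [v b ** star (v b)] is
    [(1 + h)^-1 h (1 + h)^-1], of norm at most 2. The bound ignores the size of the [b], so for
    large multiples [z] acts as an approximate unit. *)
Lemma resolvent_family_bound (s : seq A) (z : A) (h := \sum_(b <- s) b ** star b) :
  z + h ** z = h -> forall b, b \in s -> p (b - z ** b) ^+ 2 <= 2.
Proof.
move=> zh b bs.
have [v vE] : {v : A -> A | forall c, v c = c - z ** c} by exists (fun c => c - z ** c).
have hP : sum_squares h.
  exists [seq star c | c <- s]; rewrite big_map.
  by apply: eq_bigr => c _; rewrite starK.
have vh c : v c + h ** v c = c.
  rewrite vE smulBr smulA addrACA -opprD -smulDl zh.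
  by rewrite addrK.
pose r := \sum_(c <- s) v c ** star (v c).
have rh : (r + r ** h) + h ** (r + r ** h) = h.
  have rr : r + h ** r = \sum_(c <- s) c ** star (v c).
    rewrite /r; elim: (s) => [|c t IHt]; first by rewrite !big_nil smul0r addr0.
    by rewrite !big_cons smulDr addrACA IHt smulA -smulDl vh.
  rewrite smulDr addrACA smulA -smulDl rr.
  rewrite [in RHS]/h; elim: (s) => [|c t IHt]; first by rewrite !big_nil smul0l addr0.
  rewrite !big_cons smulDl addrACA IHt; congr (_ + _).
  rewrite -smulA -smulDr; congr (_ ** _).
  by rewrite -[in RHS](vh c) starD starM (sum_squares_star hP).
have r2 : p r <= 2.
  apply: le_trans (le_norm_addr r hP) _.
  exact: resolvent_norm_le2 hP rh.
apply: le_trans r2; rewrite -(csn_sqr' pP) -vE /r (big_rem b) //=.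
apply: sum_squares_mono.
  by exists [:: star (v b)]; rewrite big_seq1 starK.
exists [seq star (v c) | c <- rem b s]; rewrite big_map.
by apply: eq_bigr => c _; rewrite starK.
Qed.

End SumsOfSquares.

(** * Resolvents in complete modules *)

(** [G i] is a defect that controls distances: the sets of points of small defect for finitely many
    [i] generate a Cauchy filter, so unrelated near-solutions suffice. *)
Lemma approx_limit (R : realType) (V : lmodType R[i]) (I : Type)
    (Q G : I -> V -> R) :
  (forall i, seminorm (Q i)) -> complete_fam Q ->
  (forall i v w, Q i (v - w) <= G i v + G i w) ->
  (forall (J : set I) (e : R), finite_set J -> 0 < e ->
    exists v, forall i, J i -> G i v < e) ->
  exists v, forall i (e : R), 0 < e -> exists w, G i w < e /\ Q i (v - w) < e.
Proof.
move=> QS cQ QG eG.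
pose F : set_system V := filter_from [set Je : set I * R | finite_set Je.1 /\ 0 < Je.2]
  (fun Je => [set w | forall i, Je.1 i -> G i w < Je.2]).
have FF : Filter F.
  apply: filter_from_filter; first by exists (set0, 1); split;
    [exact: finite_set0|exact: ltr01].
  move=> [J d] [K e] /= [Jf d0] [Kf e0].
  exists (J `|` K, Num.min d e); rewrite /= ?lt_min ?d0 ?finite_setU //.
  move=> v /= vJK; split=> i Ji.
    by have := vJK i (or_introl Ji); rewrite lt_min => /andP[].
  by have := vJK i (or_intror Ji); rewrite lt_min => /andP[].
have FPF : ProperFilter F.
  by apply: filter_from_proper => -[J e] /= [Jf e0]; have [v] := eG J e Jf e0; exists v.
have FG i (e : R) : 0 < e -> F [set w | G i w < e].
  move=> e0; exists ([set i], e); first by split=> //; exact: finite_set1.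
  by move=> w; apply.
have [i e e0|v vF] := cQ F FPF.
  have e2 : 0 < e / 2 by rewrite divr_gt0.
  have [x xe] := filter_ex (FG i _ e2); exists x; apply: filterS (FG i _ e2) => w /= we.
  by apply: le_lt_trans (QG i w x) _; rewrite [ltRHS]splitr ltrD.
exists v => i e e0; have [w [/= w1 w2]] := filter_ex (filterI (FG i e e0) (vF i e e0)).
by exists w; rewrite (sn_sym (QS i)).
Qed.

Lemma finite_set_bound (T I : Type) (R : realType) (G : I -> T ->
  R) (i0 : I) (J : set I) :
  (forall i j, exists k, forall v, G i v <= G k v /\ G j v <= G k v) ->
  finite_set J -> exists k, forall i, J i -> forall v, G i v <= G k v.
Proof.
move=> dG [n]; elim: n J => [|n IHn] J.
  by rewrite II0 card_eq0 => /eqP ->; exists i0.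
move=> /eq_cardSP[i Ji /IHn[k kP]]; have [l lP] := dG i k.
exists l => j Jj v; have [->|ji] := pselect (j = i); first exact: (proj1 (lP v)).
by apply: le_trans (kP j _ v) (proj2 (lP v)).
Qed.

Lemma approx_limit_directed (R : realType) (V : lmodType R[i]) (I : Type)
    (Q G : I -> V -> R) (i0 : I) :
  (forall i, seminorm (Q i)) -> complete_fam Q ->
  (forall i v w, Q i (v - w) <= G i v + G i w) ->
  (forall i j, exists k, forall v, G i v <= G k v /\ G j v <= G k v) ->
  (forall i (e : R), 0 < e -> exists v, G i v < e) ->
  exists v, forall i (e : R), 0 < e -> exists w, G i w < e /\ Q i (v - w) < e.
Proof.
move=> QS cQ QG dG eG; apply: approx_limit => // J e Jf e0.
have [k kP] := finite_set_bound i0 dG Jf; have [v ve] := eG k e e0.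
by exists v => i Ji; apply: le_lt_trans (kP i Ji v) ve.
Qed.

Lemma exprn_small (R : realType) (q C e : R) : 0 <= q < 1 -> 0 <= C -> 0 < e ->
  exists n, q ^+ n * C < e.
Proof.
move=> /andP[q0 q1] C0 e0.
have H n : q ^+ n * (1 + n%:R * (1 - q)) <= 1.
  elim: n => [|n IHn]; first by rewrite expr0 mul0r addr0 mulr1.
  apply: le_trans IHn; rewrite exprS [q * _]mulrC -mulrA ler_wpM2l ?exprn_ge0 //.
  have n0 : 0 <= n%:R :> R by [].
  rewrite -[n.+1]addn1 natrD; set N := n%:R in n0 *.
  have := mulr_ge0 n0 (sqr_ge0 (1 - q)); have := sqr_ge0 (1 - q); nra.
have q1' : 0 < 1 - q by rewrite subr_gt0.
pose n := (Num.truncn (C / e / (1 - q))).+1; exists n.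
have nC : C / e < n%:R * (1 - q).
  by rewrite -ltr_pdivrMr //; exact: truncnS_gt.
have n1 : 0 < 1 + n%:R * (1 - q).
  by rewrite ltr_wpDr // mulr_ge0 // ltW.
apply: le_lt_trans (_ : C / (1 + n%:R * (1 - q)) < e).
  by rewrite mulrC ler_wpM2l // -[leRHS]mul1r ler_pdivlMr.
rewrite ltr_pdivrMr // mulrC -ltr_pdivrMr //; lra.
Qed.

Section Family.
Context {R : realType} {A : starAlgType R} {I : Type} (P : I -> A -> R).
Variable i0 : I.
Hypothesis PP : forall i, Cstar_seminorm (P i).
Hypothesis dirP : forall i j, exists k, forall a, P i a <= P k a /\ P j a <= P k a.
Context {X : ipModType A}.
Hypothesis Xpos : forall x : X, is_positive << x, x >>.
Hypothesis Xsep : forall x : X, (forall i, hseminorm (P i) x = 0) -> x = 0.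
Hypothesis cX : complete_fam (fun i => @hseminorm R A X (P i)).
Let xs i := hs_seminorm (PP i) (positive_cauchy_schwarz (PP i) Xpos).

Lemma hs_eq (x y : X) :
  (forall i (e : R), 0 < e -> hseminorm (P i) (x - y) < e) -> x = y.
Proof.
move=> xy; apply/subr0_eq/Xsep => i; apply/le_anti; rewrite hs_ge0 andbT.
by apply/ler_addgt0Pr => e e0; rewrite add0r ltW // xy.
Qed.

Lemma hs_directed i j : exists k, forall x : X,
  hseminorm (P i) x <= hseminorm (P k) x /\ hseminorm (P j) x <= hseminorm (P k) x.
Proof.
have [k kP] := dirP i j; exists k => x; have [h1 h2] := kP << x, x >>.
by split; exact: ler_wsqrtr.
Qed.

Section Resolvent.
Variables (h : A) (hP : sum_squares h) (x : X).

(** As [1 + h = (1 + s) (1 - (s - h) / (1 + s))], this is the remainder [x ((s - h) / (1 + s)) ^ n]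
    of the Neumann series for [x (1 + h)^-1]. Its estimate for [P i] asks for [P i h <= s], so [s]
    varies with the seminorm. *)
Fixpoint neumann (s : R) (n : nat) : X :=
  if n is m.+1 then (1 + s)^-1%:C *: (s%:C *: neumann s m - neumann s m <* h)
  else x.

Lemma neumann_le i (s : R) n : P i h <= s ->
  hseminorm (P i) (neumann s n) <= (s / (1 + s)) ^+ n * hseminorm (P i) x.
Proof.
move=> hs; have s0 := le_trans (csn_ge0 (PP i) h) hs.
have s1 : 0 < 1 + s by lra.
elim: n => [|n IHn]; first by rewrite mul1r.
rewrite /= (snZr (xs i)) gtr0_norm ?invr_gt0 // exprS -mulrA mulrC mulrAC.
rewrite ler_wpM2r ?invr_ge0 ?(ltW s1) //.
apply: le_trans (hs_sub_act (PP i) Xpos _ hP hs) _.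
by rewrite ler_wpM2l.
Qed.

Lemma neumann_sum (s : R) n : 0 <= s ->
  exists y, y + y <* h = x - neumann s n.
Proof.
move=> s0; have s1 : 1 + s != 0 by rewrite gt_eqF //; lra.
elim: n => [|n [y yE]].
  by exists 0; rewrite act0l subrr addr0.
exists (y + (1 + s)^-1%:C *: neumann s n).
rewrite actDl addrACA yE actZl -scalerDr /=; set v := neumann s n.
set a := _ *: (v + _); set b := _ *: (_ - _).
have -> : v = a + b.
  rewrite -scalerDr addrACA subrr addr0 -{2}[v]scaleC1 -scaleCD scaleCA.
  by rewrite mulVf // scaleC1.
by rewrite opprD addrA addrAC subrK.
Qed.

(** The defect of the equation controls distances since [1 + h] does not shorten vectors; the series
    with [s = P i h] makes it small for one [i], enough by directedness. *)
Lemma resolvent_exists : exists y, y + y <* h = x.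
Proof.
pose G i (y : X) := hseminorm (P i) (y + y <* h - x).
have GG y w : y + y <* h - x - (w + w <* h - x) = (y - w) + (y - w) <* h.
  by rewrite opprB addrA subrK opprD addrACA actDl actNl.
have [||i e e0|y yG] := approx_limit_directed (G := G) i0 xs cX.
- move=> i y w; apply: le_trans (snB (xs i) _ _).
  by rewrite GG; exact: hs_le_add_act.
- by move=> i j; have [k kP] := hs_directed i j; exists k => y; exact: kP.
- have s0 := csn_ge0 (PP i) h.
  have q1 : 0 <= P i h / (1 + P i h) < 1.
    by rewrite divr_ge0 ?ltr_pdivrMr ?addr_ge0 //=; lra.
  have [n ne] := exprn_small q1 (hs_ge0 (P i) x) e0.
  have [y yE] := neumann_sum n s0; exists y.
  rewrite /G yE addrAC subrr sub0r (snN (xs i)).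
  exact: le_lt_trans (neumann_le n (lexx _)) ne.
exists y; apply: hs_eq => i e e0.
have s0 := csn_ge0 (PP i) h.
pose c := 2 + P i h; have c0 : 0 < c by rewrite /c; lra.
have [w [w1 w2]] := yG i _ (divr_gt0 e0 c0).
rewrite -(subrK (w + w <* h - x) (y + y <* h - x)) GG.
apply: le_lt_trans (snD (xs i) _ _) _.
have h1 : hseminorm (P i) (y - w + (y - w) <* h) <= (1 + P i h) * hseminorm (P
  i) (y - w).
  apply: le_trans (snD (xs i) _ _) _; rewrite mulrDl mul1r lerD2l mulrC.
  exact: hs_act (PP i) _ _.
have h2 : (1 + P i h) * hseminorm (P i) (y - w) <= (1 + P i h) * (e / c).
  by rewrite ler_wpM2l ?addr_ge0 // ltW.
apply: lt_le_trans (ler_ltD (le_trans h1 h2) w1) _.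
by rewrite -[X in _ + X]mul1r -mulrDl addrAC -/c mulrC divfK // gt_eqF.
Qed.

End Resolvent.

Lemma resolvent_ip (x : X) (l : R) : 0 < l -> exists y,
  [/\ y + l%:C *: (y <* << x, x >>) = x,
      forall i, hseminorm (P i) y <= hseminorm (P i) x &
      forall i, l * hseminorm (P i) y ^+ 2 <= 2].
Proof.
move=> l0; have hP : sum_squares (l%:C *: << x, x >>).
  by apply: sum_squaresZ; [exact: ltW|exact: ip_sum_squares].
have [y yx] := resolvent_exists hP x; exists y.
have yx' : y + l%:C *: (y <* << x, x >>) = x by rewrite -actZr.
split=> //.
- by move=> i; rewrite -{1}yx; exact: (hs_le_add_act (PP i) Xpos).
- by move=> i; exact: (resolvent_bound (PP i) Xpos l0 yx').
Qed.

(** The defect is the distance to [r i]: the point [r k] has none for [k], and by compatibility none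
    for the smaller seminorms. *)
Lemma glue (r : I -> X) :
  (forall i k, (forall a, P i a <= P k a) -> hseminorm (P i) (r i - r k) = 0) ->
  exists x, forall i, hseminorm (P i) (x - r i) = 0.
Proof.
move=> rc; pose G i (w : X) := hseminorm (P i) (w - r i).
have [i v w|i j|i e e0|x xG] := approx_limit_directed (G := G) i0 xs cX.
- by apply: le_trans (sn_tri (xs i) (r i) _ _) _;
  rewrite /G [X in _ + X](sn_sym (xs i)).
- have [k kP] := dirP i j; exists k => w.
  have H i' : (forall a, P i' a <= P k a) -> G i' w <= G k w.
    move=> ik; apply: le_trans (sn_tri (xs i') (r k) _ _) _.
    rewrite [X in _ + X](sn_sym (xs i')) rc // addr0.
    exact: ler_wsqrtr.
  by split; apply: H => a; have [] := kP a.
- by exists (r i); rewrite /G subrr (sn0 (xs i)).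
exists x => i; apply/le_anti; rewrite hs_ge0 andbT; apply/ler_addgt0Pr => e e0.
rewrite add0r; have [w [w1 w2]] := xG i _ (divr_gt0 e0 (ltr0Sn R 1)).
apply: le_trans (sn_tri (xs i) w _ _) _; rewrite /G in w1; lra.
Qed.

(** The parameter [l = 1 / (4 r ^ 2)] balances two bounds: the error [l y << x, x >>] is at most
    [l r ^ 3 = r / 4], and the squared length of [y] is at most [2 / l = 8 r ^ 2] for every
    seminorm. *)
Lemma resolvent_step i (x : X) (r : R) : 0 < r -> hseminorm (P i) x <= r ->
  exists y, hseminorm (P i) (x - y) <= r / 4 /\
    forall j, hseminorm (P j) y <= 3 * r.
Proof.
move=> r0 xr; have l0 : 0 < (4 * r ^+ 2)^-1 by rewrite invr_gt0 mulr_gt0 ?exprn_gt0.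
have [y [yx yle yb]] := resolvent_ip x l0.
have h0 := @hs_ge0 _ _ (P i) X.
exists y; split.
  rewrite -{1}yx addrAC subrr add0r (snZr (xs i)) gtr0_norm //.
  rewrite ler_pdivrMl ?mulr_gt0 ?exprn_gt0 //.
  have -> : 4 * r ^+ 2 * (r / 4) = r * r ^+ 2 by field.
  apply: le_trans (hs_act (PP i) _ _) _; rewrite -(hs_sqr (PP i)).
  apply: ler_pM; rewrite ?sqr_ge0 //; first exact: le_trans (yle i) xr.
  by rewrite ler_sqr ?nnegrE // ltW.
move=> j; have := yb j; rewrite mulrC ler_pdivrMr ?mulr_gt0 ?exprn_gt0 // => yj.
rewrite -ler_sqr ?nnegrE ?hs_ge0 //; last by rewrite mulr_ge0 // ltW.
by have := sqr_ge0 r; rewrite exprMn; lra.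
Qed.

(* The limit is reached by a series whose terms are small for all the
   seminorms; [err] is the part of [s n - s 0] not yet captured by it. *)
Lemma complete_single i : complete_fam (fun _ : unit => @hseminorm R A X (P i)).
Proof.
apply: (complete_fam1P (xs i)) => s sP.
have h0 n : 0 < 2^-1 ^+ n :> R by rewrite exprn_gt0 // invr_gt0.
(* [resolvent_step] with [r = 4 * 2^-n]. The default value 0 for longer vectors allows the recursion
   to be defined before its bounds are proved. *)
have /choice[g gP] (dn : X * nat) : exists y,
    hseminorm (P i) dn.1 <= 4 * 2^-1 ^+ dn.2 ->
    hseminorm (P i) (dn.1 - y) <= 2^-1 ^+ dn.2 /\
    forall j, hseminorm (P j) y <= 12 * 2^-1 ^+ dn.2.
  case: dn => d n /=; have r0 : 0 < 4 * 2^-1 ^+ n :> R by rewrite mulr_gt0.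
  have [dr|//] := boolP (hseminorm (P i) d <= 4 * 2^-1 ^+ n); last by exists 0.
  have [y [y1 y2]] := resolvent_step r0 dr; exists y => _; split.
    by rewrite mulrAC divff ?mul1r // ?pnatr_eq0 in y1.
  by move=> j; have := y2 j; rewrite mulrA -natrM.
pose fix err n : X := if n is m.+1 then
  err m + (s m.+1 - s m) - g (err m + (s m.+1 - s m), m) else 0.
pose d n := err n + (s n.+1 - s n).
have errS n : err n.+1 = d n - g (d n, n) by [].
(* [err n] and the increment of [s] are each at most [2 * 2^-n], so the step applies to their sum
   and leaves [2^-n = 2 * 2^-(n+1)]. *)
have errP n : hseminorm (P i) (err n) <= 2 * 2^-1 ^+ n /\
    hseminorm (P i) (d n) <= 4 * 2^-1 ^+ n.
  elim: n => [|n [IH1 IH2]].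
    rewrite /d /= add0r (sn0 (xs i)) mulr_ge0 ?(ltW (h0 _)) //; split=> //.
    by apply: le_trans (sP _ _ (leqnSn 0)) _;
      rewrite ler_wpM2r ?(ltW (h0 _)) // ler_nat.
  have E : hseminorm (P i) (err n.+1) <= 2 * 2^-1 ^+ n.+1.
    rewrite errS; have [h _] := gP (d n, n) IH2; apply: le_trans h _.
    by rewrite exprS mulrA divff ?pnatr_eq0 ?mul1r.
  split=> //; apply: le_trans (snD (xs i) _ _) _.
  have := sP _ _ (leqnSn n.+1); move: E; clear; set u := hseminorm _ _.
  set v := hseminorm _ _; set w := _ ^+ _; lra.
pose y n := g (d n, n).
have yP j n : hseminorm (P j) (y n) <= 12 * 2^-1 ^+ n.
  by have [_ h] := gP (d n, n) (proj2 (errP n)); exact: h.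
pose Y n := \sum_(k < n) y k.
have YE n : Y n + err n = s n - s 0%N.
  elim: n => [|n IHn]; first by rewrite /Y big_ord0 subrr addr0.
  rewrite errS {1}/Y big_ord_recr /= -/(Y n) -/(y n) [d n - _]addrC addrA addrK.
  by rewrite /d addrA IHn addrC addrA subrK.
have [|j m n|z zP] := complete_fam_seq xs (s := Y) (b :=
  fun n => 12 / (1 - 2^-1) * 2^-1 ^+ n) cX.
- by move=> e e0; apply: geometric_small => //; apply/andP; split; lra.
- apply: (geometric_partial (N := fun m n => hseminorm (P j) (Y m - Y n))) => //.
  + by apply/andP; split; lra.
  + by move=> k; rewrite subrr (sn0 (xs j)).
  + by move=> k l k'; exact: sn_tri (xs j) _ _ _.
  + by move=> k; rewrite /Y big_ord_recr /= addrAC subrr add0r; exact: yP.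
exists (z + s 0%N) => e e0.
have half2 : 0 <= (2^-1 : R) <= 2^-1 by rewrite invr_ge0 lexx ler0n.
(* [26 = 2 + 24], for [err n] and for the tail of the series. *)
have [N NP] := geometric_small 26 half2 e0; exists N => n Nn.
have -> : s n - (z + s 0%N) = err n - (z - Y n).
  by rewrite opprB addrA [err n + _]addrC YE opprD addrA addrAC.
apply: le_lt_trans (snB (xs i) _ _) _; apply: le_lt_trans (NP n Nn).
have [e1 _] := errP n; apply: le_trans (lerD e1 (zP i n)) _.
have -> : 12 / (1 - 2^-1) = 24 :> R by field.
by rewrite -mulrDl -natrD.
Qed.

End Family.

(** * Positivity and push-forward of multipliers *)

Lemma complete_fam_ext (R : realType) (V : lmodType R[i]) (I : Type)
    (P Q : I -> V -> R) :
  (forall i v, P i v = Q i v) -> complete_fam P -> complete_fam Q.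
Proof.
move=> PQ; suff -> : P = Q by [].
by apply/funext => i; apply/funext => v.
Qed.

Section Paschke.
Context {R : realType} {B : starAlgType R} (nrm : B -> R) {X : ipModType B}.
Hypothesis CB : Cstar_algebra nrm.
Hypothesis Xpos : forall x : X, is_positive << x, x >>.

Lemma imod_ip (x y : X) : << imod x, imod y >> = lmult (<< x, y >> : B).
Proof.
apply: adjop_inj; apply/funext => b.
have -> : adjfun << imod x, imod y >> b = adj (imod x) (y <* (b : B)) by [].
have nd := @regmod_nondegenerate R B.
have <- := @adj_unique _ _ _ _ (imod x) (fun z => << x, z >> : regmod B) nd.
  by rewrite ipMr.
by move=> c z; exact: ipMl.
Qed.

Lemma act_lmult (t : mmod X) b : t <* lmult b = imod (t b).
Proof. by apply: adjop_inj; apply/funext => c; exact: adjop_act. Qed.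

Lemma act_mult_lmult (t : mmod X) (m : mult B) b :
  t <* (m ** lmult b) = imod (t (m b)).
Proof. by rewrite actM act_lmult. Qed.

(** With [g] and [j] from [abs_split] and [m = (j ** g) ** lmult b], the element [- (star m ** m)]
    is the image of [<< t (g b), t (g b) >>], hence positive, so [m = 0]. Thus [j ** g] annihilates
    [B]. *)
Lemma mult_pos_root (t : mmod X) : exists k : mult B,
  @pos R (mult B) (opnorm nrm) (@mult_one R B) k /\ << t, t >> = k ** k.
Proof.
have CM := mult_Cstar CB; have ul := @mult_mul1 R B; have ur := @mult_1mul R B.
have lM := @lmult_morphism R B.
have sh : star << t, t >> = << t, t >> :> mult B by rewrite ipC.
have [g [j [sg sjg gh]]] := abs_split CM ul ur sh.
suff jg : j ** g = 0.
  by move=> /(_ jg)/(pos_sqrt CM ul ur)[k [pk kk _]]; exists k.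
apply: adjop_inj; apply/funext => b.
pose m := (j ** g) ** lmult b.
have mm : star m ** m = 0.
  apply: (pos_anti CM ul ur); first exact: (pos_star_mul CM ul ur).
  have -> : - (star m ** m) = star (lmult b) ** (g ** << t, t >> ** g) ** lmult b.
    by rewrite gh starM sjg smulNr smulNl !smulA.
  have -> : star (lmult b) ** (g ** << t, t >> ** g) ** lmult b =
      << t <* (g ** lmult b), t <* (g ** lmult b) >>.
    by rewrite ipMr ipMl starM sg !smulA.
  rewrite act_mult_lmult imod_ip; have [c ->] := Xpos (t (g b)).
  rewrite (sm_mul lM) (sm_star lM); exact: (pos_star_mul CM ul ur).
have m0 : m = 0 by exact: star_proper.
pose y : B := adjfun (j ** g) b.
have yy : star (star y) ** star y = 0.
  rewrite starK; have <- : adjfun m (star y) = y ** star y by exact: adjop_act.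
  by rewrite m0.
by rewrite -[LHS](starK y) (star_proper _ yy) star0.
Qed.

Lemma mult_ip_positive (t : mmod X) : is_positive << t, t >>.
Proof.
by have [k [[sk _] ->]] := mult_pos_root t; exists k; rewrite sk.
Qed.

End Paschke.

Lemma adj_imod (R : realType) (B : starAlgType R) (X : ipModType B) (x y : X) :
  adj (imod x) y = << x, y >>.
Proof.
have nd := @regmod_nondegenerate R B.
rewrite -(@adj_unique _ _ _ _ (imod x) (fun z => << x, z >> : regmod B) nd) //.
by move=> c z; exact: ipMl.
Qed.

Section Pushforward.
Context {R : realType} {A : starAlgType R} (p : csemi A).
Context {X : ipModType A} {X' : ipModType (qalg p)}.
Variable sX : quotient_map (qpi p) X X'.

Lemma qmap_hseminorm x : hseminorm (@qnorm R A p) (sX x) = hseminorm p x.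
Proof. by rewrite /hseminorm (mm_ip (qmapP sX)) qnorm_qpi. Qed.

Lemma qmap_cauchy_schwarz : cauchy_schwarz p X -> cauchy_schwarz (@qnorm R A p) X'.
Proof.
move=> cs x' y'; have [x <-] := qmap_surj sX x'; have [y <-] := qmap_surj sX y'.
by rewrite (mm_ip (qmapP sX)) qnorm_qpi !qmap_hseminorm.
Qed.

Lemma qmap_complete : complete_fam (fun _ : unit => @hseminorm R A X p) ->
  complete_fam (fun _ : unit => @hseminorm R _ X' (@qnorm R A p)).
Proof.
apply: complete_fam_surj; first exact: (qmap_surj sX).
by move=> _ x y; rewrite -(linear_mapB (mm_linear (qmapP sX))) qmap_hseminorm.
Qed.

Lemma qmap_positive : (forall x : X, is_positive << x, x >>) ->
  forall x' : X', is_positive << x', x' >>.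
Proof.
move=> Xpos x'; have [x <-] := qmap_surj sX x'; have [c xc] := Xpos x.
exists (qpi p c); rewrite (mm_ip (qmapP sX)) xc.
by rewrite (sm_mul (qpi_morphism p)) (sm_star (qpi_morphism p)).
Qed.

Definition push_norm (t : mmod X) : R := opnorm (@qnorm R A p) (push (pi_ p) sX t).

End Pushforward.

Section PushSeminorms.
Context {R : realType} {A : starAlgType R} {I : Type} (P : I -> csemi A).
Hypothesis CAp : forall i, Cstar_algebra (@qnorm R A (P i)).
Context {X : ipModType A} {X' : forall i, ipModType (qalg (P i))}.
Variable sX : forall i, quotient_map (qpi (P i)) X (X' i).
Hypothesis CSX : forall i, cauchy_schwarz (P i) X.

Lemma push_operator_seminorms :
  operator_seminorms (fun i => P i : A -> R) (fun i => push_norm (sX i)).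
Proof.
have OS i := opnorm_operator_seminorms (CAp i) (qmap_cauchy_schwarz (sX i) (CSX i)).
split=> [i t|i t b|i t x|i t c c0 tc].
- exact: (os_ge0 (OS i) tt).
- rewrite -(qmap_hseminorm (sX i)) -(pushE (pi_ (P i))) -qnorm_qpi.
  exact: (os_le (OS i) tt).
- rewrite -qnorm_qpi -(qmap_hseminorm (sX i)).
  have := os_adj (OS i) tt (push (pi_ (P i)) (sX i) t) (sX i x).
  by rewrite -push_adj pushE.
- rewrite /push_norm; apply: (os_lub (OS i) (i := tt) c0) => b';
  have [b <-] := qpi_surj b'.
  have := tc b; rewrite -(qmap_hseminorm (sX i)) -(pushE (pi_ (P i))).
  by rewrite -qnorm_qpi.
Qed.

End PushSeminorms.

(** * Locally C*-algebras and gluing *)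

Section LocallyCstarFacts.
Context {R : realType} {A : topStarAlgType R} (hA : locally_Cstar A).
Implicit Types p q : ccsemi A.

Let PS p := csn_seminorm (csemiP p).

Lemma lc_nbhsP (a : A) (U : set A) :
  nbhs a U <-> nbhs (a : snorm_top (@A_seminorm R A)) U.
Proof.
by rewrite !nbhsE; split=> -[O [Oo Oa] OU]; exists O => //; split=> //;
  apply/(lc_seminorms hA).
Qed.

Lemma lc_complete_fam : complete_fam (@A_seminorm R A).
Proof.
move=> F FF Fc.
have cS : tvs_complete (snorm_top (@A_seminorm R A)).
  move=> G GG Gc; have [U /lc_nbhsP/Gc //|x Gx] := lc_complete hA (F := G).
  by exists x => U /lc_nbhsP/Gx.
exact: (proj1 (complete_famP (P := @A_seminorm R A) PS)).
Qed.

Lemma lc_separated (a : A) : (forall p, A_seminorm p a = 0) -> a = 0.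
Proof.
move=> a0; apply/esym/(lc_hausdorff hA) => U V U0 /lc_nbhsP.
move=> /(snorm_nbhsP PS)[J [_ [e e0 eV]]]; exists 0; split.
  exact: nbhs_singleton.
by apply: eV => p _; rewrite sub0r (snN (PS p)) [X in X < _]a0.
Qed.

Lemma max_Cstar (p q : csemi A) : Cstar_seminorm (fun a => Num.max (p a) (q a)).
Proof.
have pP := csemiP p; have qP := csemiP q.
split=> [a b|k a|a b|a].
- rewrite ge_max; apply/andP; split.
    by apply: le_trans (csnD pP _ _) _; rewrite lerD // le_max lexx.
  by apply: le_trans (csnD qP _ _) _; rewrite lerD // le_max lexx orbT.
- rewrite (csnZ pP) (csnZ qP) maxr_pMr //.
  by case: k => u v; exact: sqrtr_ge0.
- rewrite ge_max; apply/andP; split.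
    apply: le_trans (csnM pP _ _) _.
    by apply: ler_pM; rewrite ?(csn_ge0 pP) // le_max lexx.
  apply: le_trans (csnM qP _ _) _.
  by apply: ler_pM; rewrite ?(csn_ge0 qP) // le_max lexx orbT.
- rewrite (csnX pP) (csnX qP); have p0 := csn_ge0 pP a; have q0 := csn_ge0 qP a.
  by case: (leP (p a) (q a)) => pq; [rewrite max_r // ler_sqr|rewrite max_l //
    ler_sqr ?nnegrE // ltW].
Qed.

Lemma max_continuous p q : continuous (CSemi (max_Cstar p q)).
Proof.
move=> a; apply: continuous_max; exact: ccsemi_continuous.
Qed.

Definition max_ccsemi p q : ccsemi A := CCSemi (@max_continuous p q).

Lemma ccsemi_directed p q : exists r : ccsemi A, forall a,
  A_seminorm p a <= A_seminorm r a /\ A_seminorm q a <= A_seminorm r a.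
Proof.
by exists (max_ccsemi p q) => a; rewrite /A_seminorm /= !le_max !lexx orbT.
Qed.

Lemma zero_Cstar : Cstar_seminorm (fun _ : A => 0 : R).
Proof. by split=> [a b|k a|a b|a]; rewrite ?addr0 ?mulr0 ?expr0n. Qed.

(** Supplies the index [i0] that the results on directed families ask for. *)
Definition zero_ccsemi : ccsemi A :=
  @CCSemi R A (CSemi zero_Cstar) (fun a => cvg_cst 0).

Lemma regmod_positive (a : regmod A) : is_positive << a, a >>.
Proof. by exists a. Qed.

Lemma regmod_complete_fam :
  complete_fam (fun p : ccsemi A => @hseminorm R A (regmod A) p).
Proof.
apply: complete_fam_ext lc_complete_fam => p a.
by rewrite (hs_regmod (csemiP p)).
Qed.

Lemma regmod_separated (a : regmod A) :
  (forall p, hseminorm p a = 0) -> a = 0.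
Proof.
by move=> a0; apply: lc_separated => p; rewrite -[RHS](a0 p) (hs_regmod (csemiP p)).
Qed.

(** [complete_single] for [A] as a module over itself: completeness for all seminorms yields
    completeness for one. *)
Lemma lc_quotient_Cstar p : Cstar_algebra (@qnorm R A p).
Proof.
apply: qalg_Cstar.
have := @complete_single R A _ (@A_seminorm R A) zero_ccsemi (fun q => csemiP q)
  ccsemi_directed _ regmod_positive regmod_separated regmod_complete_fam p.
by apply: complete_fam_ext => _ a; exact: (hs_regmod (csemiP p)).
Qed.

End LocallyCstarFacts.

Section HilbertModuleFacts.
Context {R : realType} {A : topStarAlgType R} (hA : locally_Cstar A).
Context {X : ipModType A}.
Hypothesis Xpos : forall x : X, is_positive << x, x >>.
Hypothesis Xdef : forall x : X, << x, x >> = 0 :> A -> x = 0.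
Hypothesis cX : complete_fam (fun p : ccsemi A => @hseminorm R A X p).
Implicit Types p q : ccsemi A.
Let CSX p := positive_cauchy_schwarz (csemiP p) Xpos.

Lemma hilbert_separated (x : X) : (forall p, hseminorm p x = 0) -> x = 0.
Proof.
move=> x0; apply: Xdef; apply: (lc_separated hA) => p.
by rewrite /A_seminorm -(hs_sqr (csemiP p)) x0 expr0n.
Qed.

Lemma hilbert_nondegenerate : nondegenerate X.
Proof. by move=> x /(_ x)/Xdef. Qed.

Section Glue.
Context {X' : forall p, ipModType (qalg p)}.
Variable sX : forall p, quotient_map (qpi p) X (X' p).

(** Stated through representatives and for any quotient modules [X'], so as to cover both [pi_] and
    [sigma_]. *)
Definition compatible (t : forall p, mmod (X' p)) : Prop :=
  forall p q, csge p q -> forall (a : A) (x : X),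
    t p (qpi p a) = sX p x -> t q (qpi q a) = sX q x.

Lemma qmap_eq0 p x y : sX p x = sX p y <-> hseminorm p (x - y) = 0.
Proof.
have qP := qnorm_Cstar p.
have E : hseminorm p (x - y) = hseminorm (@qnorm R A p) (sX p x - sX p y).
  by rewrite -(linear_mapB (mm_linear (qmapP (sX p)))) (qmap_hseminorm (sX p)).
rewrite E; split=> [->|h0]; first by rewrite subrr /hseminorm ip0l (sn0
  (csn_seminorm qP)) sqrtr0.
apply/subr0_eq/(qmap_nondegenerate (sX p)) => z; apply: qnorm_definite.
apply/le_anti; rewrite (csn_ge0 qP) andbT.
by apply: le_trans (qmap_cauchy_schwarz (sX p) (@CSX p) _ _) _; rewrite h0 mul0r.
Qed.

Lemma qpi_ip p (a b : A) :
  << (qpi p a : regmod (qalg p)), (qpi p b : regmod (qalg p)) >> = qpi p (star a ** b).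
Proof. by rewrite -[X in _ = X]/(qpi p << (a : regmod A),
  b >>) -(mm_ip (qmapP (pi_ p))). Qed.

(** Tested against [c], the relation involves only a representative [y] of [t p (qpi p c)], and [y]
    represents [t q (qpi q c)] as well. *)
Lemma compatible_adj t : compatible t -> forall p q, csge p q -> forall b x,
  adj (t p) (sX p x) = qpi p b -> adj (t q) (sX q x) = qpi q b.
Proof.
move=> tc p q pq b x tx; apply/subr0_eq/regmod_nondegenerate => c'.
have [c <-] := qpi_surj c'; have [y yc] := qmap_surj (sX p) (t p (qpi p c)).
have yq := tc p q pq c y (esym yc).
rewrite ipBl adjE' yq (mm_ip (qmapP (sX q))) qpi_ip -qpiB.
apply/qpi_eq0/(csge_eq0 pq)/qpi_eq.
by rewrite -qpi_ip -tx adjE' -yc (mm_ip (qmapP (sX p))).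
Qed.

(** The values of the operator and of its adjoint are glued one by one; the adjoint relation holds
    modulo every kernel, hence in [A]. *)
Lemma glue_adjop (t : forall p, mmod (X' p)) : compatible t ->
  exists T : mmod X, forall p, push (pi_ p) (sX p) T = t p.
Proof.
move=> tc; have dA := ccsemi_directed (A := A).
have /choice[T TP] (a : A) : exists x : X, forall p, sX p x = t p (qpi p a).
  have /choice[r rP] p : exists x, sX p x = t p (qpi p a) by exact: qmap_surj.
  have [q p qp|x xr] := glue (@zero_ccsemi R A) (fun p => csemiP p) dA Xpos cX (r := r).
    by apply/qmap_eq0; rewrite rP; apply: (tc p q qp); rewrite rP.
  by exists x => p; rewrite -rP; apply/qmap_eq0.
have /choice[S SP] (x : X) : exists b : A, forall p, qpi p b = adj (t p) (sX p x).
  have /choice[r rP] p : exists b, qpi p b = adj (t p) (sX p x) by exact: qpi_surj.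
  have [q p qp|b br] := glue (@zero_ccsemi R A) (fun p => csemiP p) dA regmod_positive
      (regmod_complete_fam hA) (r := r).
    rewrite (hs_regmod (csemiP q)); apply/qpi_eq; rewrite rP.
    by apply: (compatible_adj tc qp); rewrite rP.
  by exists b => p; rewrite -rP; apply/qpi_eq; rewrite -(hs_regmod (csemiP p)).
have TS : is_adjoint (T : regmod A -> X) (S : X -> regmod A).
  move=> a x; apply/subr0_eq/(lc_separated hA) => p; apply/qpi_eq.
  rewrite -(mm_ip (qmapP (sX p))) TP -[RHS]qpi_ip SP.
  exact: adjE.
exists (to_adjop (is_adjoint_adjointable (@regmod_nondegenerate R A)
  hilbert_nondegenerate TS)).
by move=> p; apply/esym/push_unique => a; rewrite /= -TP.
Qed.

Lemma push_injective (S T : mmod X) :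
  (forall p, push (pi_ p) (sX p) S = push (pi_ p) (sX p) T) -> S = T.
Proof.
move=> ST; apply: adjop_inj; apply/funext => a; apply/subr0_eq/hilbert_separated => p.
apply/qmap_eq0; rewrite -!(pushE (pi_ p)).
by have := congr1 (fun f : mmod (X' p) => f (qpi p a)) (ST p).
Qed.

End Glue.
End HilbertModuleFacts.

(** * The inverse system of multiplier modules *)

Lemma snorm_openP (R : realType) (V : lmodType R[i]) (I : Type)
    (P : I -> V -> R) (U : set (snorm_top P)) : open U <-> snorm_open P U.
Proof. by []. Qed.

Section Homeomorphisms.
Context {R : realType} {V W : lmodType R[i]} {I : Type}.
Variables (P : I -> V -> R) (Q : I -> W -> R) (f : V -> W).
Hypothesis QS : forall i, seminorm (Q i).
Hypothesis f_linear : linear f.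
Hypothesis f_isometry : forall i x, Q i (f x) = P i x.

Lemma isometry_homeomorphism : bijective f ->
  homeomorphism (snorm_top P) (snorm_top Q) f.
Proof.
move=> [g fK gK]; split; first by exists g.
move=> U; rewrite !snorm_openP; split=> Uo x Ux.
  have [|J [Jf [e e0 eU]]] := Uo (g x); first by rewrite /preimage /= gK.
  exists J; split=> //; exists e => // y ye.
  rewrite -[y]gK; apply: eU => i Ji.
  by rewrite -f_isometry (linear_mapB f_linear) !gK ye.
have [J [Jf [e e0 eU]]] := Uo _ Ux.
exists J; split=> //; exists e => // y ye; apply: eU => i Ji.
by rewrite -(linear_mapB f_linear) f_isometry ye.
Qed.

Lemma isometry_embedding : injective f ->
  topological_embedding (snorm_top P) (snorm_top Q) f.
Proof.
move=> finj; split=> // U; rewrite snorm_openP;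
  split=> [Uo|[W' /snorm_openP Wo <-] x Wx]; last first.
  have [J [Jf [e e0 eU]]] := Wo _ Wx.
  exists J; split=> //; exists e => // y ye; apply: eU => i Ji.
  by rewrite -(linear_mapB f_linear) f_isometry ye.
(* The open set has to extend beyond the image of [f]: it consists of all [z] having a ball whose
   preimage lies in [U]. *)
exists [set z | exists J : set I, finite_set J /\ exists2 e : R, 0 < e &
    forall x, (forall i, J i -> Q i (f x - z) < e) -> U x].
  apply/snorm_openP => z [J [Jf [e e0 eU]]]; exists J; split=> //;
    exists (e / 2); first by rewrite divr_gt0.
  move=> w we; exists J; split=> //; exists (e / 2); first by rewrite divr_gt0.
  move=> x xe; apply: eU => i Ji; apply: le_lt_trans (sn_tri (QS i) w _ _) _.
  by rewrite [ltRHS]splitr ltrD ?xe ?we.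
apply/seteqP; split=> x /=.
  by move=> [J [_ [e e0 eU]]]; apply: eU => i _; rewrite subrr (sn0 (QS i)).
move=> Ux; have [J [Jf [e e0 eU]]] := Uo _ Ux.
exists J; split=> //; exists e => // y ye; apply: eU => i Ji.
by rewrite -f_isometry (linear_mapB f_linear) ye.
Qed.

End Homeomorphisms.

Section MultiplierModules.
Context {R : realType} {B : starAlgType R} (nrm : B -> R) {X : ipModType B}.
Hypothesis CB : Cstar_algebra nrm.
Hypothesis hX : hilbert_module (fun _ : unit => nrm) X.
Let cs := ca_seminorm CB.

Lemma mmod_hilbert :
  hilbert_module (fun _ : unit => @opnorm R B (regmod B) (regmod B) nrm : mult B
    -> R) (mmod X).
Proof.
have [Xpos Xdef Xc] := hX.
have CSX := positive_cauchy_schwarz cs Xpos.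
have XS (i : unit) := hs_seminorm cs CSX.
have Psep (b : B) : (unit -> nrm b = 0) -> b = 0 by move=> /(_ tt);
  exact: ca_definite CB b.
have BS (i : unit) := csn_seminorm cs.
have cB := proj1 (complete_famP BS) (ca_complete CB).
have OX := opnorm_operator_seminorms CB CSX.
have OB := opnorm_operator_seminorms CB (regmod_cauchy_schwarz cs).
have cX := proj1 (complete_famP XS) Xc.
have OS (i : unit) := os_seminorm (fun=> cs) OX (fun=> CSX) i.
have E (t : mmod X) := os_hseminorm (fun=> cs) OX tt t OB.
split=> [t|t tt0|].
- exact: mult_ip_positive CB Xpos t.
- apply: adjop_inj; apply/funext => b; apply: Xdef.
  by rewrite adjE -[adj t (t b)]/(<< t, t >> b) tt0 ip0r.
- have -> : (fun _ : unit => @hseminorm R (mult B) (mmod X) (opnorm nrm)) =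
  (fun=> opnorm nrm).
    by apply/funext => _; apply/funext => t; exact: E.
  apply/(complete_famP OS).
  exact: (os_complete (fun=> cs) Psep cB OX (fun=> CSX) Xdef cX).
Qed.

End MultiplierModules.

Lemma bijective_of (T U : Type) (f : T -> U) :
  injective f -> (forall y, exists x, f x = y) -> bijective f.
Proof.
by move=> fi /choice[g gK]; exists g => // x; apply: fi; rewrite gK.
Qed.

Section MultiplierLimits.
Context {R : realType} {A : topStarAlgType R} {E : ipModType A}.
Hypothesis hA : locally_Cstar A.
Hypothesis hE : hilbert_module (@A_seminorm R A) E.
Implicit Types p q : ccsemi A.

Let PP p := csemiP p.
Let Epos : forall x : E, is_positive << x, x >>. Proof. by case: hE. Qed.
Let Edef : forall x : E, << x, x >> = 0 :> A -> x = 0. Proof. by case: hE. Qed.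
Let CSE p := positive_cauchy_schwarz (PP p) Epos.
Let ES p := hs_seminorm (PP p) (CSE p).
Let CAp p := lc_quotient_Cstar hA p.
Let CSA p := regmod_cauchy_schwarz (PP p).

Lemma hilbert_complete_fam : complete_fam (fun p => @hseminorm R A E p).
Proof. by have [_ _ cE] := hE; exact: (proj1 (complete_famP ES)). Qed.
Let cE := hilbert_complete_fam.

Lemma qsigma_eq0 p (x : E) : qsigma p x = 0 <-> hseminorm p x = 0.
Proof.
have <- : qsigma p 0 = 0 :> qmod p E := linear_map0 (@qsigma_linear R A p E).
by rewrite (qmap_eq0 Epos (fun p => sigma_ p E)) subr0.
Qed.

Lemma qmod_hilbert p : hilbert_module (fun _ : unit => @qnorm R A p) (qmod p E).
Proof.
have pQ := qmap_positive (sigma_ p E) Epos.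
have QS (i : unit) := hs_seminorm (qnorm_Cstar p) (positive_cauchy_schwarz
  (qnorm_Cstar p) pQ).
split=> [//|u|].
- have [x <-] := qsigma_surj u; rewrite -[<< _, _ >>](qsigma_ip p x x) => /qpi_eq0 x0.
  by apply/qsigma_eq0; rewrite /hseminorm x0 sqrtr0.
- apply/(complete_famP QS); apply: (qmap_complete (sigma_ p E)).
  exact: (complete_single (@zero_ccsemi R A) PP (@ccsemi_directed R A) Epos
    (hilbert_separated hA Edef) cE).
Qed.

Lemma multiplier_system :
  hilbert_system (@MAp_norm R A) (@MAp_map R A) (@MEp_map R A E).
Proof.
split=> [p||p|].
- exact: mult_Cstar (CAp p).
- exact: MAp_system.
- exact: mmod_hilbert (CAp p) (qmod_hilbert p).
- exact: MEp_system.
Qed.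

Lemma ME_operator_seminorms : operator_seminorms (@A_seminorm R A) (@ME_seminorm R A E).
Proof. exact: (push_operator_seminorms CAp (fun p => sigma_ p E) CSE). Qed.

Lemma MA_operator_seminorms :
  @operator_seminorms _ _ _ (@A_seminorm R A) (regmod A) (@MA_seminorm R A).
Proof. exact: (push_operator_seminorms CAp (fun p => pi_ p) CSA). Qed.

Lemma MA_lim_morphism : star_morphism (@MA_lim R A).
Proof.
split=> [k m n|m n|m]; apply: llim_eq => p.
- exact: push_linear.
- exact: push_comp.
- exact: push_adj.
Qed.

Lemma MA_lim_bijective : bijective (@MA_lim R A).
Proof.
apply: bijective_of => [m n mn|l].
  apply: (push_injective hA regmod_positive (fun a =>
    @star_proper _ A a) (sX := fun p => pi_ p)) => p.
  exact: (congr1 (fun l : limMA A => lproj l p) mn).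
have [|m mP] := glue_adjop hA regmod_positive (fun a => @star_proper _ A a)
    (regmod_complete_fam hA) (sX := fun p => pi_ p) (t := fun p => lproj l p).
  move=> p q pq a x lx; have := lprojP l pq.
  move=> /(congr1 (fun f : mult (qalg q) => f (qpi q a))) <-.
  rewrite -(qpi2E pq); apply: etrans (mult2E pq (lproj l p) _) _.
  by apply: etrans (congr1 (@qpi2 R A p q) lx) _; exact: (qpi2E pq).
by exists m; apply: llim_eq => p; exact: mP.
Qed.

Lemma ME_lim_bijective : bijective (@ME_lim R A E).
Proof.
apply: bijective_of => [s t st|l].
  apply: (push_injective hA Epos Edef (sX := fun p => sigma_ p E)) => p.
  exact: (congr1 (fun l : limME E => lproj l p) st).
have [|t tP] := glue_adjop hA Epos Edef cE (sX :=
  fun p => sigma_ p E) (t := fun p => lproj l p).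
  move=> p q pq a x lx; have := lprojP l pq.
  move=> /(congr1 (fun f : mmod (qmod q E) => f (qpi q a))) <-.
  rewrite -(qpi2E pq); apply: etrans (mmod2E pq (lproj l p) _) _.
  by apply: etrans (congr1 (@qsigma2 R A p q E) lx) _; exact: (qsigma2E pq).
by exists t; apply: llim_eq => p; exact: tP.
Qed.

End MultiplierLimits.

Lemma seminorm_surj (R : realType) (V W : lmodType R[i]) (f : V -> W)
    (N : V -> R) (M : W -> R) : linear f -> (forall w, exists v, f v = w) ->
  (forall v, M (f v) = N v) -> seminorm N -> seminorm M.
Proof.
move=> fL fS MN NS; split=> [x y|k x]; have [v <-] := fS x.
  by have [w <-] := fS y; rewrite -(linear_mapD fL) !MN; exact: snD NS _ _.
by rewrite -(linear_mapZ fL) !MN; exact: snZ NS _ _.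
Qed.

Lemma mmod_definite (R : realType) (B : starAlgType R) (X : ipModType B) (t : mmod X) :
  (forall x : X, << x, x >> = 0 :> B -> x = 0) ->
  << t, t >> = 0 :> mult B -> t = 0.
Proof.
move=> Xdef tt0; apply: adjop_inj; apply/funext => b; apply: Xdef.
by rewrite adjE -[adj t (t b)]/(<< t, t >> b) tt0 ip0r.
Qed.

Section UnitaryEquivalence.
Context {R : realType} {A : topStarAlgType R} {E : ipModType A}.
Hypothesis hA : locally_Cstar A.
Hypothesis hE : hilbert_module (@A_seminorm R A) E.
Implicit Types p q : ccsemi A.

Let PP p := csemiP p.
Let Epos : forall x : E, is_positive << x, x >>. Proof. by case: hE. Qed.
Let Edef : forall x : E, << x, x >> = 0 :> A -> x = 0. Proof. by case: hE. Qed.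
Let CSE p := positive_cauchy_schwarz (PP p) Epos.
Let CAp p := lc_quotient_Cstar hA p.
Let cE := hilbert_complete_fam hE.

Lemma ME_lim_linear : linear (@ME_lim R A E).
Proof. by move=> k s t; apply: llim_eq => p; exact: push_linear. Qed.

Lemma ME_lim_act (t : mmod E) (m : mult A) : ME_lim (t <* m) = ME_lim t <* MA_lim m.
Proof. by apply: llim_eq => p; exact: push_comp. Qed.

Lemma ME_lim_ip (s t : mmod E) : << ME_lim s, ME_lim t >> = MA_lim << s, t >>.
Proof.
apply: llim_eq => p.
rewrite -[LHS]/(adjop_comp (adj (mmod1 p s)) (mmod1 p t)) -push_adj.
exact/esym/push_comp.
Qed.

Lemma limME_ip_positive (x : limME E) : is_positive << x, x >>.
Proof.
have qpos p := qmap_positive (sigma_ p E) Epos.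
have [k kP] : exists k : forall p, MAp p, forall p,
    @pos R (MAp p) (@MAp_norm R A p) (@mult_one R (qalg p)) (k p) /\
    << lproj x p, lproj x p >> = k p ** k p.
  exists (fun p => projT1 (cid (mult_pos_root (CAp p) (qpos p) (lproj x p)))) => p.
  exact: projT2 (cid (mult_pos_root (CAp p) (qpos p) (lproj x p))).
have kc p q (pq : ccsemi_ge p q) : MAp_map pq (k p) = k q.
  have CM := mult_Cstar (CAp q); have ul := @mult_mul1 R (qalg q).
  have ur := @mult_1mul R (qalg q).
  have phiM := ss_morphism (@MAp_system R A) pq.
  have [pk kk] := kP p; have [pkq kkq] := kP q.
  apply: (pos_sqrt_unique CM ul ur) => //.
    (* [pos] refers to the norm and the unit, so it is transported through a root: a morphism maps
       squares of self-adjoint elements to such squares. *)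
    have [j [[sj _] jj _]] := pos_sqrt (mult_Cstar (CAp p)) (@mult_mul1 R (qalg p))
      (@mult_1mul R (qalg p)) pk.
    have -> : MAp_map pq (k p) = MAp_map pq j ** MAp_map pq j.
      by rewrite -jj; exact: (sm_mul phiM).
    by apply: (pos_sqr CM ul ur); rewrite -[RHS](congr1 _ sj) (sm_star phiM).
  apply: etrans (esym (sm_mul phiM _ _)) _; rewrite -kk -[RHS]kkq.
  exact: (lprojP << x, x >> pq).
exists (@LLim _ _ _ (@MAp R A) (@MAp_map R A) (ss_linear (@MAp_system R A)) k kc).
apply: llim_eq => p; have [[sk _] kk] := kP p.
by rewrite -[RHS]/(star (k p) ** k p) sk -kk.
Qed.

Lemma mmod_ip_positive (t : mmod E) : is_positive << t, t >>.
Proof.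
have [K] := limME_ip_positive (ME_lim t); rewrite ME_lim_ip.
have [g MK gK] := MA_lim_bijective hA; rewrite -(gK K) => tK.
exists (g K); apply: (can_inj MK); rewrite tK.
by rewrite (sm_mul (@MA_lim_morphism R A)) (sm_star (@MA_lim_morphism R A)).
Qed.

Let OE := ME_operator_seminorms hA hE.
Let OA := MA_operator_seminorms hA.
Let NS := os_seminorm PP OE CSE.

Lemma ME_hseminorm p (t : mmod E) : hseminorm (@MA_seminorm R A p) t = ME_seminorm p t.
Proof. exact: (os_hseminorm PP OE p t OA). Qed.

Lemma ME_complete : complete_fam (@ME_seminorm R A E).
Proof.
exact: (os_complete PP (lc_separated hA) (lc_complete_fam hA) OE CSE Edef cE).
Qed.

Let hMS p : seminorm (@hseminorm R _ (mmod E) (@MA_seminorm R A p)).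
Proof.
have [h1 h2] := NS p; split=> [s t|k t]; rewrite !ME_hseminorm; [exact: h1|exact: h2].
Qed.

Let hMc : complete_fam (fun p => @hseminorm R _ (mmod E) (@MA_seminorm R A p)).
Proof. by apply: complete_fam_ext ME_complete => p t; rewrite ME_hseminorm. Qed.

Lemma ME_hilbert : hilbert_module (@MA_seminorm R A) (mmod E).
Proof.
split; [exact: mmod_ip_positive|by move=> t; exact: mmod_definite|].
exact/(complete_famP hMS).
Qed.

Lemma ME_lim_surj (x : limME E) : exists t, ME_lim t = x.
Proof. by have [g _ gK] := ME_lim_bijective hA hE; exists (g x). Qed.

Lemma limME_hilbert : hilbert_module (@limMA_seminorm R A) (limME E).
Proof.
have hE' p (t : mmod E) : hseminorm (@limMA_seminorm R A p) (ME_lim t) =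
    hseminorm (@MA_seminorm R A p) t by rewrite /hseminorm ME_lim_ip.
split; first exact: limME_ip_positive.
  move=> x; have [t <-] := ME_lim_surj x; rewrite ME_lim_ip => tt0.
  rewrite -(linear_map0 ME_lim_linear); congr ME_lim.
  apply: (mmod_definite Edef); apply: (bij_inj (MA_lim_bijective hA)).
  by rewrite tt0 (linear_map0 (sm_linear (@MA_lim_morphism R A))).
apply/complete_famP.
  by move=> p; apply: seminorm_surj ME_lim_linear ME_lim_surj (hE' p) (hMS p).
apply: complete_fam_surj ME_lim_surj _ hMc => p s t.
by rewrite -(linear_mapB ME_lim_linear) hE'.
Qed.

Lemma MA_lim_homeomorphism :
  homeomorphism (snorm_top (@MA_seminorm R A)) (snorm_top (@limMA_seminorm R A))
    (@MA_lim R A).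
Proof.
exact: isometry_homeomorphism (sm_linear (@MA_lim_morphism R A))
  (fun _ _ => erefl) (MA_lim_bijective hA).
Qed.

Lemma ME_lim_unitary : unitary_along (@MA_lim R A) (@ME_lim R A E).
Proof.
have [V UV VU] := ME_lim_bijective hA hE.
split; [exact: ME_lim_linear|exact: ME_lim_act|exists V; split=> //].
- by move=> k x y; apply: (can_inj UV); rewrite ME_lim_linear !VU.
- by move=> y m; apply: (can_inj UV); rewrite ME_lim_act !VU.
- by move=> x y; rewrite -ME_lim_ip VU.
Qed.

End UnitaryEquivalence.

(** * The strict topology *)

Section ProductTopology.
Context {I : Type} {T : I -> topologicalType}.

Lemma coordinate_continuous i : continuous (fun f : prod_topology T => f i).
Proof.
move=> f W Wf; have /cvg_sup/(_ i) h : nbhs f --> f by exact: cvg_id.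
by apply: h; exact: (@initial_continuous _ _ (fun f : forall i, T i => f i) f W Wf).
Qed.

Lemma into_product_continuous (S : topologicalType) (g : S -> prod_topology T) :
  (forall i, continuous (fun s => g s i)) -> continuous g.
Proof.
move=> gc s; apply/cvg_sup => i U [?/= [[W oW <-]] /= Wsi /filterS]; apply.
by apply: gc; exact: open_nbhs_nbhs.
Qed.

Lemma initial_coordinate_nbhs (S : choiceType) (f : S -> prod_topology T) i
    (x : S) (W : set (T i)) :
  nbhs (f x i) W -> nbhs (x : initial_topology f) [set z | W (f z i)].
Proof.
move=> Wf.
exact: (@initial_continuous _ _ f x _ (@coordinate_continuous i (f x) W Wf)).
Qed.

End ProductTopology.

Section StrictHomeomorphism.
Context {R : realType} {A : topStarAlgType R} {E : ipModType A}.
Hypothesis hA : locally_Cstar A.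
Hypothesis hE : hilbert_module (@A_seminorm R A) E.
Implicit Types p q : ccsemi A.

Let PP p := csemiP p.
Let Epos : forall x : E, is_positive << x, x >>. Proof. by case: hE. Qed.
Let Edef : forall x : E, << x, x >> = 0 :> A -> x = 0. Proof. by case: hE. Qed.
Let CSE p := positive_cauchy_schwarz (PP p) Epos.
Let cE := hilbert_complete_fam hE.
Let CSEp p := qmap_cauchy_schwarz (sigma_ p E) (CSE p).
Let strictS := strict_seminormP (P := @A_seminorm R A) PP CSE.
Let strictSp p := strict_seminormP (P := fun _ : unit => @qnorm R A p)
  (fun=> qnorm_Cstar p) (fun=> @CSEp p).

(** Since [qpi p] and [qsigma p] are onto, this matches the two families of strict seminorms; both
    directions of [strict_homeomorphism] rest on it. *)
Lemma strict_seminorm_mmod1 p (a : A) (x : E) (t : mmod E) :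
  strict_seminorm (fun _ : unit => @qnorm R A p) (tt, qpi p a, qsigma p x) (mmod1 p t) =
  strict_seminorm (@A_seminorm R A) (p, a, x) t.
Proof.
rewrite /strict_seminorm /=; congr (_ + _).
  by rewrite -[RHS](qmap_hseminorm (sigma_ p E)); congr hseminorm; exact: mmod1E.
rewrite -[adj (mmod1 p t)](push_adj (pi_ p) (sigma_ p E)).
by rewrite -[qsigma p x]/(sigma_ p E x) pushE; exact: qnorm_qpi.
Qed.

Lemma mmod1_linear p : linear (@mmod1 R A p E).
Proof. exact: push_linear. Qed.

Lemma mmod1_continuous p :
  continuous (@mmod1 R A p E : strict_top (@A_seminorm R A) E -> @MEp_strict R A E p).
Proof.
move=> t U /(snorm_nbhsP (@strictSp p))[J [Jf [e e0 eU]]].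
have h : nbhs t [set s : strict_top (@A_seminorm R A) E | forall j, J j ->
    strict_seminorm (fun _ : unit => @qnorm R A p) j (mmod1 p s - mmod1 p t) < e].
  apply: finite_set_filter => // -[[[] a'] x'] _.
  have [a <-] := qpi_surj a'; have [x <-] := qsigma_surj x'.
  apply: filterS (snorm_nbhs1 strictS (p, a, x) t e0) => s /=.
  by rewrite -(linear_mapB (mmod1_linear p)) strict_seminorm_mmod1.
by apply: filterS h => s /= /eU.
Qed.

Let strict_dist p (a : A) (x : E) (s t : mmod (qmod p E)) : R :=
  strict_seminorm (fun _ : unit => @qnorm R A p) (tt, qpi p a, qsigma p x) (s - t).

Lemma strict_homeomorphism :
  homeomorphism (strict_top (@A_seminorm R A) E) (limME_strict E) (@ME_lim R A E).
Proof.
split; first exact: (ME_lim_bijective hA hE).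
move=> U; split; last first.
  have fc : continuous (@ME_lim R A E : strict_top (@A_seminorm R A) E ->
    limME_strict E).
    apply: continuous_comp_initial; apply: into_product_continuous => p.
    exact: mmod1_continuous.
  by move/continuousP : fc => /(_ U).
move=> Uo; rewrite openE => y Uy; have [t ty] := ME_lim_surj hA hE y.
have [|J [Jf [e e0 eU]]] := Uo t; first by rewrite /preimage /= ty.
have h : nbhs (y : limME_strict E) [set x | forall j, J j ->
    strict_dist j.1.2 j.2 (lproj x j.1.1) (lproj y j.1.1) < e].
  apply: finite_set_filter => // -[[p a] x] _.
  have yW : nbhs (lproj y p : @MEp_strict R A E p)
      [set u : @MEp_strict R A E p | strict_dist a x u (lproj y p) < e].
    exact: (snorm_nbhs1 (@strictSp p)).
  exact: (@initial_coordinate_nbhs _ _ _ (@limME_prod R A E) p y _ yW).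
apply: filterS h => x /= xe; have [s sx] := ME_lim_surj hA hE x.
rewrite -sx; apply: eU => -[[p a] z] Jj.
have := xe _ Jj; rewrite -sx -ty => h.
by rewrite -strict_seminorm_mmod1 (linear_mapB (mmod1_linear p)).
Qed.

Lemma strict_tvs_complete : tvs_complete (strict_top (@A_seminorm R A) E).
Proof.
apply/(complete_famP strictS).
exact: (strict_complete PP (lc_separated hA) CSE Edef (lc_complete_fam hA) cE).
Qed.

End StrictHomeomorphism.

(** * The embedding of a module in its multiplier module *)

Section Embedding.
Context {R : realType} {B : starAlgType R} {I : Type} (P : I -> B -> R).
Hypothesis PP : forall i, Cstar_seminorm (P i).
Hypothesis Psep : forall b, (forall i, P i b = 0) -> b = 0.
Context {X : ipModType B} (N : I -> mmod X -> R) (NP : operator_seminorms P N).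
Hypothesis CSX : forall i, cauchy_schwarz (P i) X.
Hypothesis Xdef : forall x : X, << x, x >> = 0 :> B -> x = 0.
Hypothesis cX : complete_fam (fun i => @hseminorm R B X (P i)).
Let xs i := hs_seminorm (PP i) (CSX i).
Let ns i := os_seminorm PP NP CSX i.

Lemma imod_linear : linear (@imod R B X).
Proof.
move=> k x y; apply: adjop_inj; apply/funext => b.
by rewrite -[LHS]/((k *: x + y) <* (b : B)) actDl actZl.
Qed.

Lemma imod_act (x : X) b : imod (x <* b) = imod x <* lmult b.
Proof. by apply: adjop_inj; apply/funext => c; rewrite /= actM. Qed.

Lemma ip_imod (t : mmod X) (x : X) : << t, imod x >> = lmult (adj t x : B).
Proof. by apply: adjop_inj; apply/funext => c; exact: adjop_act. Qed.

Lemma imod_norm i (x : X) : N i (imod x) = hseminorm (P i) x.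
Proof.
apply/le_anti/andP; split.
  by apply: (os_lub NP); [exact: hs_ge0|move=> b; exact: hs_act (PP i) _ _].
have [->|x0] := eqVneq (hseminorm (P i) x) 0; first exact: (os_ge0 NP).
have := os_adj NP i (imod x) x; rewrite adj_imod -(hs_sqr (PP i)) expr2.
by rewrite ler_pM2r // lt_neqAle eq_sym x0 hs_ge0.
Qed.

Lemma imod_injective : injective (@imod R B X).
Proof.
move=> x y xy; apply/subr0_eq; apply: Xdef; apply: Psep => i.
by rewrite -(hs_sqr (PP i)) -imod_norm (linear_mapB imod_linear) xy subrr (sn0
  (ns i)) expr0n.
Qed.

(** [approx_limit], the defect being the distance from [imod x] to [t]. The hypothesis is spelled
    out for finite sets of seminorms to fit both a closure point and a limit of a sequence. *)
Lemma imod_range_closed (t : mmod X) :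
  (forall (J : set I) (e : R), finite_set J -> 0 < e ->
    exists x, forall i, J i -> N i (imod x - t) < e) ->
  exists x, t = imod x.
Proof.
move=> tJ; have [i v w||x xG] := approx_limit (G := fun i x => N i (imod x - t)) xs cX.
- rewrite -imod_norm (linear_mapB imod_linear).
  by apply: le_trans (sn_tri (ns i) t _ _) _; rewrite (sn_sym (ns i) t).
- exact: tJ.
exists x; apply/esym/subr0_eq; apply: (os_separated PP Psep NP Xdef) => i.
apply/le_anti; rewrite (os_ge0 NP) andbT; apply/ler_addgt0Pr => e e0; rewrite add0r.
have [w [w1 w2]] := xG i _ (divr_gt0 e0 (ltr0Sn R 1)).
apply: le_trans (sn_tri (ns i) (imod w) _ _) _.
by rewrite -(linear_mapB imod_linear) imod_norm; lra.
Qed.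

Lemma os_act (M : I -> mult B -> R) i (t : mmod X) (m : mult B) :
  @operator_seminorms _ _ _ P (regmod B) M -> N i (t <* m) <= N i t * M i m.
Proof.
move=> MP; apply: (os_lub NP); first by rewrite mulr_ge0 ?(os_ge0 NP) ?(os_ge0 MP).
move=> b; apply: le_trans (os_le NP i t (m b)) _; rewrite -mulrA.
rewrite ler_wpM2l ?(os_ge0 NP) //.
by have := os_le MP i m b; rewrite (hs_regmod (PP i)).
Qed.

(** [B] is a right ideal of [M(B)]; the formula is the star of [star m] applied to [star b]. *)
Lemma lmult_mul (b : B) (m : mult B) : lmult b ** m = lmult (star (adj m (star b) : B)).
Proof.
apply: adjop_inj; apply/funext => c.
rewrite -[LHS]/(b ** (m c : B)) -[RHS]/(star (adj m (star b) : B) ** c).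
have := adjE' m (star b : regmod B) c; rewrite /ip /= starK.
by move=> ->.
Qed.

End Embedding.

(** * Stability under multipliers, closed range and strict density *)

Section StrictDensity.
Context {R : realType} {A : topStarAlgType R} {E : ipModType A}.
Hypothesis hA : locally_Cstar A.
Hypothesis hE : hilbert_module (@A_seminorm R A) E.
Implicit Types p q : ccsemi A.

Let PP p := csemiP p.
Let Epos : forall x : E, is_positive << x, x >>. Proof. by case: hE. Qed.
Let Edef : forall x : E, << x, x >> = 0 :> A -> x = 0. Proof. by case: hE. Qed.
Let CSE p := positive_cauchy_schwarz (PP p) Epos.
Let cE := hilbert_complete_fam hE.
Let OE := ME_operator_seminorms hA hE.
Let OA := MA_operator_seminorms hA.
Let NS := os_seminorm PP OE CSE.

(* [x] is the limit, at a rate independent of the seminorm, of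
   [x - y_n = y_n <* h_n], and [lmult h_n ** m] lies in [A]. *)
Lemma imod_act_mult (x : E) (m : mult A) : exists y : E, imod x <* m = imod y.
Proof.
have half2 : 0 <= (2^-1 : R) <= 2^-1 by rewrite invr_ge0 lexx ler0n.
have /choice[y yP] (n : nat) : exists y : E,
    y + (4 ^+ n)%:C *: (y <* << x, x >>) = x /\
    forall p, hseminorm p y <= 2 * 2^-1 ^+ n.
  (* For [l = 4 ^ n] the bound [l * hseminorm p y ^ 2 <= 2] is a rate of order [2^-n], the same for
     all [p]. *)
  have l0 : 0 < 4 ^+ n :> R by rewrite exprn_gt0.
  have [y [y1 _ y2]] := resolvent_ip (@zero_ccsemi R A) PP (@ccsemi_directed R A) Epos
    (hilbert_separated hA Edef) cE x l0.
  exists y; split=> // p; have := y2 p.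
  have h0 : 0 < 2^-1 ^+ n :> R by rewrite exprn_gt0 // invr_gt0.
  have -> : 4 ^+ n = (2^-1 ^+ n)^-1 ^+ 2 :> R.
    by rewrite -exprVn invrK -exprM mulnC exprM; congr (_ ^+ n); rewrite expr2 -natrM.
  rewrite -exprMn => h.
  rewrite mulrC -ler_pdivrMl //; have y0 := @hs_ge0 _ _ p E y.
  have : 0 <= (2^-1 ^+ n)^-1 * hseminorm p y by rewrite mulr_ge0 // invr_ge0 ltW.
  by move: h; set u := _ * _; nra.
pose b n := (4 ^+ n)%:C *: << x, x >> : A.
pose w n := y n <* star (adj m (star (b n)) : A).
have wE n : imod (w n) - imod x <* m = - (imod (y n) <* m).
  have [yx _] := yP n; have xE : y n + y n <* b n = x by rewrite actZr.
  rewrite -{1}xE (linear_mapD (@imod_linear R A E)) actDl /w !imod_act -actM lmult_mul.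
  by rewrite opprD addrCA subrr addr0.
apply: (imod_range_closed PP (lc_separated hA) OE CSE Edef cE) => J e Jf e0.
have nJ : \oo [set n | forall p, J p -> ME_seminorm p (imod (w n) - imod x <* m) < e].
  apply: finite_set_filter => // p _.
  have [n nP] := geometric_small (2 * MA_seminorm p m) half2 e0.
  exists n => // k /= nk; rewrite wE (snN (NS p)).
  apply: le_lt_trans (os_act PP OE p (imod (y k)) m OA) _.
  apply: le_lt_trans (nP k nk); rewrite (imod_norm PP OE).
  rewrite mulrAC ler_wpM2r ?(os_ge0 OA) //; exact: (proj2 (yP k)).
by have [n nP] := filter_ex nJ; exists (w n).
Qed.

Lemma range_imod_closed :
  closed (range (@imod R A E) : set (snorm_top (@ME_seminorm R A E))).
Proof.
move=> t tcl; have [J e Jf e0|x ->] :=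
    @imod_range_closed _ _ _ _ PP (lc_separated hA) _ _ OE CSE Edef cE t;
      last by exists x.
have [|_ [[x _ <-] xJ]] := tcl [set s : snorm_top (@ME_seminorm R A E) |
    forall i, J i -> ME_seminorm i ((s : mmod E) - t) < e].
  by apply/(snorm_nbhsP NS); exists J; split=> //; exists e.
by exists x.
Qed.

Lemma finite_set_seq (T : Type) (J : set T) (f : T -> A) :
  finite_set J -> exists s : seq A, forall j, J j -> f j \in s.
Proof.
move=> [n]; elim: n J => [|n IHn] J.
  by rewrite II0 card_eq0 => /eqP ->; exists [::].
move=> /eq_cardSP[i Ji /IHn[s sP]]; exists (f i :: s) => j Jj; rewrite in_cons.
have [->|ji] := pselect (j = i); first by rewrite eqxx.
by rewrite (sP j) ?orbT.
Qed.

(** [resolvent_exists] solves [y + y h = h], and [star y] solves the mirrored equation; their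
    difference [D] satisfies [(1 + h) D (1 + h) = 0], so [D = 0]. *)
Lemma self_adjoint_resolvent (s : seq A) (h := \sum_(b <- s) b ** star b) :
  exists z, star z = z /\ z + h ** z = h.
Proof.
have hP : sum_squares h.
  exists [seq star c | c <- s]; rewrite big_map.
  by apply: eq_bigr => c _; rewrite starK.
have [y0 yh0] := resolvent_exists (@zero_ccsemi R A) PP (@ccsemi_directed R A)
  regmod_positive (regmod_separated hA) (regmod_complete_fam hA) hP (h : regmod A).
have [y yh] : exists y : A, y + y ** h = h by exists y0.
have sh := sum_squares_star hP.
have zh : star y + h ** star y = h by have := congr1 star yh; rewrite starD starM sh.
suff yz : y - star y = 0.
  by exists (star y); rewrite zh starK; split=> //; exact: subr0_eq yz.
apply: (lc_separated hA) => p; apply/le_anti; rewrite (csn_ge0 (PP p)) andbT.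
apply: le_trans (le_norm_addl (PP p) _ hP) _.
apply: le_trans (le_norm_addr (PP p) _ hP) _.
set D := y - star y.
have -> : D + h ** D + (D + h ** D) ** h = 0.
  have E1 : D + h ** D = (y + h ** y) - h by rewrite smulBr -{4}zh opprD addrACA.
  have E2 : (y + h ** y) + (y + h ** y) ** h = h + h ** h.
    by rewrite smulDl addrACA yh -smulA -smulDr yh.
  by rewrite E1 smulBl addrACA E2 -opprD subrr.
by rewrite (csemi0 p).
Qed.

(** The approximant is [imod (t z)], that is [t <* lmult z]. Its distance to [t] sees only [a - z a]
    and [adj t x - z (adj t x)], so one self-adjoint [z] serves both parts of the strict
    seminorms. *)
Lemma range_imod_dense :
  dense (range (@imod R A E) : set (strict_top (@A_seminorm R A) E)).
Proof.
move=> O [t Ot] Oo; have [J [Jf [e e0 eO]]] := Oo t Ot.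
(* Scaling [b] by [c p] gives [p (b - z b) < 2 / c p], that is [(ME_seminorm p t + 1) * p (b - z b)
   < e / 2]; the 1 covers a vanishing seminorm. *)
pose c p : R := 4 * (ME_seminorm p t + 1) / e.
have c0 p : 0 < c p.
  by rewrite /c divr_gt0 // mulr_gt0 // ltr_wpDl // (os_ge0 OE).
have [s1 s1P] := finite_set_seq (fun j : ccsemi A * A * E => (c j.1.1)%:C *: j.1.2) Jf.
have [s2 s2P] := finite_set_seq
  (fun j : ccsemi A * A * E => (c j.1.1)%:C *: (adj t j.2 : A)) Jf.
have [z [sz zh]] := self_adjoint_resolvent (s1 ++ s2).
have zb p b : (c p)%:C *: b \in s1 ++ s2 -> (ME_seminorm p t + 1) * p (b - z **
  b) < e / 2.
  move=> bs; have := resolvent_family_bound (PP p) zh bs.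
  rewrite smulZr -scalerBr (snZr (csn_seminorm (PP p))) gtr0_norm // => h.
  have p0 := csn_ge0 (PP p) (b - z ** b).
  have u2 : c p * p (b - z ** b) < 2 by have := mulr_ge0 (ltW (c0 p)) p0; nra.
  rewrite /c in u2.
  have E2 : 4 * (ME_seminorm p t + 1) / e * p (b - z ** b) =
     (ME_seminorm p t + 1) * p (b - z ** b) * 4 / e by field; rewrite gt_eqF.
  by rewrite E2 ltr_pdivrMr // in u2; lra.
have sn p := os_seminorm PP OE CSE p.
exists (imod (t (z : A))); split; last by exists (t (z : A)).
apply: eO => -[[p a] x] Jj; rewrite /strict_seminorm /=.
have a1 := zb p a; have x1 := zb p (adj t x : A).
rewrite mem_cat (s1P _ Jj) in a1; rewrite mem_cat (s2P _ Jj) orbT in x1.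
have {}a1 := a1 isT; have {}x1 := x1 isT.
have n0 := os_ge0 OE p t.
have h1 : hseminorm p ((imod (t (z : A)) - t) a) <= ME_seminorm p t * p (a - z ** a).
  rewrite -[(imod _ - t) a]/(t (z : A) <* a - t a) -adjop_act -adjopB.
  apply: le_trans (os_le OE p t _) _; rewrite -[X in _ * X](sn_sym (csn_seminorm
    (PP p))).
  exact: lexx.
have h2 : p (adj (imod (t (z : A)) - t) x : A) = p ((adj t x : A) - z ** adj t x).
  rewrite adjB; last exact: regmod_nondegenerate.
  rewrite adj_imod adjE.
  rewrite -[<< _, _ >>]/(star z ** (adj t x : A)) sz.
  exact: (sn_sym (csn_seminorm (PP p))).
have p1 := csn_ge0 (PP p) (a - z ** a).
have p2 := csn_ge0 (PP p) ((adj t x : A) - z ** adj t x).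
have {}h2 : p (adj (imod (t (z : A)) - t) x : A) <= p ((adj t x : A) - z ** adj t x).
  by rewrite h2.
apply: le_lt_trans (lerD h1 h2) _.
by rewrite [ltRHS]splitr; apply: ltrD; nra.
Qed.

End StrictDensity.

Theorem theorem3p3 (R : realType) (A : topStarAlgType R) (E : ipModType A)
    (hA : locally_Cstar A) (hE : hilbert_module (@A_seminorm R A) E) :
  (forall (p : ccsemi A) (x : E), qsigma p x = 0 <-> hseminorm p x = 0) /\
  [/\ (* (1) *)
      hilbert_system (@MAp_norm R A) (@MAp_map R A) (@MEp_map R A E),
      (* (2) *)
      [/\ hilbert_module (@MA_seminorm R A) (mmod E),
          hilbert_module (@limMA_seminorm R A) (limME E),
          star_morphism (@MA_lim R A),
          homeomorphism (snorm_top (@MA_seminorm R A))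
                        (snorm_top (@limMA_seminorm R A)) (@MA_lim R A) &
          unitary_along (@MA_lim R A) (@ME_lim R A E)],
      (* (3) *)
      homeomorphism (strict_top (@A_seminorm R A) E) (limME_strict E)
                    (@ME_lim R A E),
      (* (4) *)
      tvs_complete (strict_top (@A_seminorm R A) E) &
      (* (5) *)
      [/\ [/\ linear (@imod R A E),
              forall (x : E) (a : A), imod (x <* a) = imod x <* lmult a,
              forall x y : E, << imod x, imod y >> = lmult (<< x, y >> : A) &
              topological_embedding
                (snorm_top (fun p : ccsemi A => @hseminorm R A E p))
                (snorm_top (@ME_seminorm R A E)) (@imod R A E)],
          forall (x : E) (m : mult A), exists y : E, imod x <* m = imod y,
          closed (range (@imod R A E) : set (snorm_top (@ME_seminorm R A E))),
          forall (t : mmod E) (a : A), t <* lmult a = imod (t a) &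
          forall (t : mmod E) (x : E),
            << t, imod x >> = lmult (adj t x : A)]
   ] /\
   (* (6) *)
   dense (range (@imod R A E) : set (strict_top (@A_seminorm R A) E)).
Proof.
have [Epos Edef Ec] := hE.
have PP (p : ccsemi A) := csemiP p.
have CSE (p : ccsemi A) := positive_cauchy_schwarz (PP p) Epos.
have OE := ME_operator_seminorms hA hE.
have inj := imod_injective PP (lc_separated hA) OE CSE Edef.
split; first exact: qsigma_eq0.
split; last exact: range_imod_dense.
split; first exact: multiplier_system.
- split; [exact: ME_hilbert|exact: limME_hilbert|exact: MA_lim_morphism| |].
    exact: MA_lim_homeomorphism.
  exact: ME_lim_unitary.
- exact: strict_homeomorphism.
- exact: strict_tvs_complete.
split.
- split; [exact: imod_linear|exact: imod_act|exact: imod_ip|].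
  apply: (isometry_embedding _ (@imod_linear R A E)) => //.
    exact: (os_seminorm PP OE CSE).
  exact: (imod_norm PP OE).
- exact: imod_act_mult.
- exact: range_imod_closed.
- exact: act_lmult.
- exact: ip_imod.
Qed.
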